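(* Let $G$ be an $n$-vertex noncrossing geometric graph, $n\ge 1$, whose vertices are in general position (no three collinear). (a) If $G$ is $0$-regular (a point set), then $\mathrm{mm}(G)\geq \frac{n-1}{3}$. (b) If $G$ is $1$-regular (a perfect matching), then $\mathrm{mm}(G)\geq \frac{n-2}{6}$. (c) If $G$ is $2$-regular (disjoint polygons), then $\mathrm{mm}(G)\geq \frac{n-3}{11}$. Moreover, all these bounds are tight for infinitely many values of $n$: in each of the cases (a), (b), (c), there are infinitely many $n$ for which some $n$-vertex noncrossing geometric graph $G$ of the respective type, with vertices in general position, attains equality.
   Context: A geometric graph is a graph drawn in the plane whose vertices are distinct points and whose edges are straight-line segments between their endpoints. It is noncrossing if no vertex lies in the relative interior of an edge and any two distinct edges intersect at most in a common endpoint. For a geometric graph $G$ and a set $M$ of segments between vertices of $G$, $G+M$ denotes the geometric graph obtained by adding the segments of $M$ as edges. A matching $M$ (a set of segments on the vertices of $G$, no two sharing an endpoint; possibly empty) is compatible with $G$ if no segment of $M$ is an edge of $G$ and $G+M$ is noncrossing. A compatible matching $M$ of $G$ is maximal if there is no compatible matching $M'$ of $G$ properly containing $M$. $\mathrm{mm}(G)$ denotes the minimum number of edges in a maximal compatible matching of $G$. A graph is $d$-regular if all of its vertices have degree $d$. *)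

(* Defs.v *)
From HB Require Import structures.
From mathcomp Require Import all_boot all_order all_algebra.
From mathcomp Require Import boolp reals.
Set Implicit Arguments.
Unset Strict Implicit.
Unset Printing Implicit Defensive.
Import Order.TTheory GRing.Theory Num.Theory.
Local Open Scope ring_scope.

(* An unordered pair of distinct vertex labels; through the placement of the
   vertices it stands for the straight-line segment joining them. *)
Definition edge (n : nat) := {e : {set 'I_n} | #|e| == 2%N}.

Record geometric_graph (R : realType) (n : nat) := GeometricGraph {
  pos : 'I_n -> 'rV[R]_2;
  pos_inj : injective pos;
  edges : {set edge n} }.

Section GeometricGraphs.
Variables (R : realType) (n : nat).
Implicit Types (G : geometric_graph R n) (e f : edge n) (M : {set edge n}).
Implicit Types (x : 'rV[R]_2).

Definition on_segment G e x : Prop :=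
  exists u v (t : R), [/\ val e = [set u; v], 0 <= t <= 1
    & x = (1 - t) *: pos G u + t *: pos G v].

Definition in_relint G e x : Prop :=
  exists u v (t : R), [/\ val e = [set u; v], 0 < t < 1
    & x = (1 - t) *: pos G u + t *: pos G v].

Definition noncrossing G : Prop :=
  (forall e w, e \in edges G -> ~ in_relint G e (pos G w)) /\
  (forall e f, e \in edges G -> f \in edges G -> e != f ->
     forall x, on_segment G e x -> on_segment G f x ->
       exists w, [/\ w \in val e, w \in val f & x = pos G w]).

Definition collinear (p q r : 'rV[R]_2) : Prop :=
  exists a d : 'rV[R]_2, d != 0 /\
    forall x, x \in [:: p; q; r] -> exists t : R, x = a + t *: d.

Definition general_position G : Prop :=
  forall i j k : 'I_n, uniq [:: i; j; k] ->
    ~ collinear (pos G i) (pos G j) (pos G k).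

Definition degree G (v : 'I_n) : nat := #|[set e in edges G | v \in val e]|.

Definition regular G (d : nat) : Prop := forall v, degree G v = d.

Definition add_edges G M : geometric_graph R n :=
  GeometricGraph (@pos_inj R n G) (edges G :|: M).

Definition is_matching M : Prop :=
  forall e f, e \in M -> f \in M -> e != f -> [disjoint val e & val f].

Definition compatible_matching G M : Prop :=
  [/\ is_matching M, [disjoint M & edges G] & noncrossing (add_edges G M)].

Definition maximal_compatible_matching G M : Prop :=
  compatible_matching G M /\
  ~ exists M', compatible_matching G M' /\ M \proper M'.

(* The default set0 of [arg min] is returned only when there is no maximal
   compatible matching at all, which by mmP never happens for noncrossing G. *)
Definition mm G : nat :=
  #|[arg min_(M < set0 | `[< maximal_compatible_matching G M >]) #|M|]|.

Lemma mmP G : noncrossing G ->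
  (exists2 M, maximal_compatible_matching G M & #|M| = mm G) /\
  (forall M, maximal_compatible_matching G M -> (mm G <= #|M|)%N).
Proof.
move=> ncG.
have c0 : compatible_matching G set0.
  split; first by move=> e f; rewrite inE.
    by rewrite disjoints_subset sub0set.
  by rewrite /noncrossing /on_segment /in_relint /= setU0.
have [M0 /maxsetP[/asboolP cM0 maxM0] _] :
  {M | maxset (fun M => `[< compatible_matching G M >]) M & set0 \subset M}.
  by apply: maxset_exists; apply/asboolP.
have P0 : maximal_compatible_matching G M0.
  split=> // -[M' [cM' pM']].
  have eM' : M' = M0 by apply: maxM0; [apply/asboolP | apply: proper_sub].
  by rewrite eM' properxx in pM'.
have -> : mm G =
  #|[arg min_(M < M0 | `[< maximal_compatible_matching G M >]) #|M|]|.
  rewrite /mm /arg_min /extremum; case: pickP => //= none; exfalso.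
  case: (@arg_minnP _ M0 (fun M => `[< maximal_compatible_matching G M >])
           (fun M => #|M|) (asboolT P0)) => M PM minM.
  have /negP := negbT (none M); apply; apply/andP; split=> //.
  by apply/forallP=> M'; apply/implyP; apply: minM.
case: arg_minnP => [|M /asboolP PM minM]; first exact/asboolP.
split; first by exists M.
by move=> M' PM'; apply: minM; apply/asboolP.
Qed.

End GeometricGraphs.

(* Main.v *)
(** Lower bounds. Let [M] be a maximal compatible matching. Extend every
    nonisolated vertex of [G + M] by a ray running backwards along one of its
    edges until it hits something (a large triangle catches the rays that
    escape). All faces of the resulting straight-line graph are convex, and its
    number of edges exceeds its number of vertices by at most the number [e] of
    edges of [G + M], so it has at most [e + 1] bounded faces. Unmatched vertices
    on a common face see each other, hence are adjacent in [G]. Each of them lies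
    on 1, 2 or 3 faces when [G] is 0-, 1- or 2-regular, so counting incidences
    gives (a) and (b); for (c) a face may carry three unmatched vertices only if
    it is a triangle of [G], and these triangles are disjoint.

    Faces are never constructed: two points are in the same face when the segment
    between them avoids the graph, and the number of pairwise separated points is
    bounded by charging each of them to an edge at the lexicographically least
    vertex it sees.

    Tightness. A small gadget is drawn around a shrunken copy of the previous
    example, and the result is perturbed into general position. All conditions
    are strict inequalities between orientations of triples, so the gadget is
    checked once, with integer coordinates and the inner copy collapsed to the
    origin. *)

Require Import Defs.
From Stdlib Require Import ZArith.
From mathcomp Require Import all_boot all_order all_algebra.
From mathcomp Require Import boolp reals.
From mathcomp Require Import ring lra zify ssrZ.
Set Implicit Arguments.
Unset Strict Implicit.
Unset Printing Implicit Defensive.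
Import Order.TTheory GRing.Theory Num.Theory.
Local Open Scope ring_scope.

(** Convexity of the faces is used in one form only: in every lexicographic order given by two
    independent affine forms, a vertex without a higher neighbour is the highest one. Applied in a
    triangle with two free sides, this shows that the graph cannot reach into it, and so visibility
    is transitive. The second form breaks ties. A generic direction could not replace it, since the
    orders are dictated by the triangle or the vertex at hand, and the vertices created by the
    extensions are in no general position.

    A straight passage through a vertex excludes a local maximum there. This is why a ray running
    backwards along an existing edge is the right extension, and why one extension per vertex is
    enough.

    The factors 3, 6 and 11 come out of the incidence counts. The additive constants 1, 2 and 3
    belong to a single vertex, edge or triangle: its empty matching is maximal, and as the innermost
    configuration it lets the tight examples start from no matching edge at all. *)

(** * Properties that hold for all sufficiently small positive parameters *)

Section Small.
Variable R : realFieldType.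

(** Eventual truth as the parameter tends to 0 from above. It is closed under finite conjunctions,
    so that all requirements on a perturbation can be collected before [small_ex] picks its size. *)
Definition small (P : R -> Prop) : Prop :=
  exists2 d : R, 0 < d & forall e, 0 < e < d -> P e.

Lemma smallT (P : R -> Prop) : (forall e, 0 < e -> P e) -> small P.
Proof. by move=> h; exists 1 => // e /andP[e0 _]; apply: h. Qed.

Lemma smallW (P Q : R -> Prop) :
  (forall e, 0 < e -> P e -> Q e) -> small P -> small Q.
Proof.
by move=> h [d d0 hd]; exists d => // e ed; apply: h (hd _ ed); case/andP: ed.
Qed.

Lemma smallI (P Q : R -> Prop) :
  small P -> small Q -> small (fun e => P e /\ Q e).
Proof.
move=> [d d0 hd] [d' d'0 hd']; exists (Num.min d d'); first by rewrite lt_min d0.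
by move=> e /andP[e0]; rewrite lt_min => /andP[ed ed']; split; [apply: hd|apply: hd'];
  rewrite e0.
Qed.

Lemma small_all (T : eqType) (s : seq T) (P : T -> R -> Prop) :
  (forall x, x \in s -> small (P x)) ->
  small (fun e => forall x, x \in s -> P x e).
Proof.
elim: s => [|a s IH] h; first exact: smallT.
have ha := h a (mem_head _ _).
have {}IH := IH (fun x xs => h x (mem_behead (s := a :: s) xs)).
apply: smallW (smallI ha IH) => e _ [h1 h2] x; rewrite inE => /orP[/eqP->//|].
exact: h2.
Qed.

Lemma small_allT (T : finType) (P : T -> R -> Prop) :
  (forall x, small (P x)) -> small (fun e => forall x, P x e).
Proof.
move=> h; have := @small_all T (enum T) P (fun x _ => h x).
by apply: smallW => e _ he x; apply: he; rewrite mem_enum.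
Qed.

Lemma small_lt (d : R) : 0 < d -> small (fun e => e < d).
Proof. by move=> d0; exists d => // e /andP[]. Qed.

Lemma small_ex (P : R -> Prop) : small P -> exists2 e, 0 < e & P e.
Proof. by move=> [d d0 h]; exists (d / 2); [lra|apply: h; lra]. Qed.

Lemma small_lin (a b : R) : 0 < a -> small (fun e => 0 < a + e * b).
Proof.
move=> a0; have n0 : 0 < `|b| + 1 by rewrite ltr_wpDl.
exists (a / (`|b| + 1)); first by rewrite divr_gt0.
move=> e /andP[e0]; rewrite ltr_pdivlMr // => h.
have := ler_norm (- b); rewrite normrN => h1; nra.
Qed.

Lemma small_quad (a b c : R) : 0 < a -> small (fun e => 0 < a + e * b + e * e * c).
Proof.
move=> a0; have h2 : 0 < a / 2 by lra.
apply: smallW (smallI (small_lin b h2) (smallI (small_lin c h2) (small_lt ltr01))).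
by move=> e e0 [h [h' e1]]; have [c0|c0] := lerP 0 c; nra.
Qed.

Lemma small_scale (k : R) (P : R -> Prop) :
  0 < k -> small P -> small (fun e => P (e * k)).
Proof.
move=> k0 [d d0 h]; exists (d / k); first exact: divr_gt0.
move=> e /andP[e0]; rewrite ltr_pdivlMr // => ek.
by apply: h; rewrite ek mulr_gt0.
Qed.

End Small.

(** Transitivity and irreflexivity are asked only on [Q], because comparing directions by the sign
    of a cross product is transitive only within a half-plane. *)
Lemma exists_extremal (T : eqType) (s : seq T) (Q : T -> Prop) (r : T -> T -> Prop) :
  (forall a b c, Q a -> Q b -> Q c -> r a b -> r b c -> r a c) ->
  (forall a, Q a -> ~ r a a) ->
  (exists2 a, a \in s & Q a) ->
  exists a, [/\ a \in s, Q a & forall b, b \in s -> Q b -> ~ r a b].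
Proof.
move=> tr irr; elim: s => [[a]|c s IH [a]]; first by rewrite in_nil.
have [hs|hs] := EM (exists2 a, a \in s & Q a); last first.
  rewrite inE => /orP[/eqP-> Qc|as_ Qa]; last by case: hs; exists a.
  exists c; split=> //; first exact: mem_head.
  move=> b; rewrite inE => /orP[/eqP-> _|bs Qb]; first exact: irr.
  by case: hs; exists b.
move=> _ _; have [m [ms Qm max]] := IH hs.
have [[Qc rmc]|nc] := EM (Q c /\ r m c).
  exists c; split=> //; first exact: mem_head.
  move=> b; rewrite inE => /orP[/eqP-> _|bs Qb]; first exact: irr.
  by move=> rcb; apply: (max b bs Qb); apply: tr rmc rcb.
exists m; split=> //; first by rewrite inE ms orbT.
move=> b; rewrite inE => /orP[/eqP-> Qc rmc|]; first exact: nc.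
exact: max.
Qed.

(** * Points and segments of the plane *)

Section Plane.
Variable R : realFieldType.
Notation pt := (R * R)%type.
Implicit Types (p q a b z w d e n : pt) (l : R * R * R) (t : R).

Definition lerp p q t : pt := (p.1 + t * (q.1 - p.1), p.2 + t * (q.2 - p.2)).
Definition seg p q z : Prop := exists2 t, 0 <= t <= 1 & z = lerp p q t.
Definition vec p q : pt := (q.1 - p.1, q.2 - p.2).
Definition shift p d t : pt := (p.1 + t * d.1, p.2 + t * d.2).
Definition cross d e : R := d.1 * e.2 - d.2 * e.1.
Definition orient p q z : R := cross (vec p q) (vec p z).
(** A triple codes an affine form, with linear part [lin] and values [aff]. Separating lines,
    barycentric coordinates and the orders on the plane are all given by such forms. *)
Definition lin l d : R := l.1.1 * d.1 + l.1.2 * d.2.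
Definition aff l z : R := lin l z + l.2.
Definition orientl p q : R * R * R :=
  (p.2 - q.2, q.1 - p.1, p.1 * (q.2 - p.2) - p.2 * (q.1 - p.1)).
Definition dotl d p : R * R * R := (d.1, d.2, - (d.1 * p.1 + d.2 * p.2)).
Definition oppl l : R * R * R := (- l.1.1, - l.1.2, - l.2).

Lemma pt_eq p q : p.1 = q.1 -> p.2 = q.2 -> p = q.
Proof. by case: p q => p1 p2 [q1 q2] /= -> ->. Qed.

Lemma aff_orientl p q z : aff (orientl p q) z = orient p q z.
Proof. by rewrite /aff /lin /orient /cross /=; ring. Qed.

Lemma aff_dotl d p z :
  aff (dotl d p) z = d.1 * (z.1 - p.1) + d.2 * (z.2 - p.2).
Proof. by rewrite /aff /lin /=; ring. Qed.

Lemma aff_oppl l z : aff (oppl l) z = - aff l z.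
Proof. by rewrite /aff /lin /=; ring. Qed.

Lemma aff_lerp l p q t : aff l (lerp p q t) = (1 - t) * aff l p + t * aff l q.
Proof. by rewrite /aff /lin /=; ring. Qed.

Lemma aff_shift l p d t : aff l (shift p d t) = aff l p + t * lin l d.
Proof. by rewrite /aff /lin /=; ring. Qed.

Lemma aff_vec l p q : lin l (vec p q) = aff l q - aff l p.
Proof. by rewrite /aff /lin /=; ring. Qed.

Lemma lerp0 p q : lerp p q 0 = p.
Proof. by apply: pt_eq; rewrite /=; ring. Qed.

Lemma lerp1 p q : lerp p q 1 = q.
Proof. by apply: pt_eq; rewrite /=; ring. Qed.

Lemma lerpC p q t : lerp p q t = lerp q p (1 - t).
Proof. by apply: pt_eq; rewrite /=; ring. Qed.

Lemma shift_vec p q t : shift p (vec p q) t = lerp p q t.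
Proof. by []. Qed.

Lemma vec_neq0 p q : p != q -> vec p q != (0, 0).
Proof.
apply: contra => /eqP[h1 h2]; apply/eqP/pt_eq; [move: h1|move: h2]; lra.
Qed.

Lemma dot_gt0 d : d != (0, 0) -> 0 < d.1 * d.1 + d.2 * d.2.
Proof.
case: d => d1 d2 /=; rewrite xpair_eqE => h.
have [d10|d10] := eqVneq d1 0; last first.
  have := sqr_ge0 d2; have : 0 < d1 ^+ 2 by rewrite exprn_even_gt0.
  rewrite !expr2; lra.
have d20 : d2 != 0 by move: h; rewrite d10 eqxx.
have : 0 < d2 ^+ 2 by rewrite exprn_even_gt0.
rewrite d10 expr2; lra.
Qed.

Lemma dist_gt0 p q : p != q ->
  0 < (q.1 - p.1) * (q.1 - p.1) + (q.2 - p.2) * (q.2 - p.2).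
Proof. by move=> /vec_neq0 /dot_gt0. Qed.

Lemma segl p q : seg p q p.
Proof. by exists 0; rewrite ?lerp0 //; lra. Qed.

Lemma segr p q : seg p q q.
Proof. by exists 1; rewrite ?lerp1 //; lra. Qed.

Lemma segC p q z : seg p q z -> seg q p z.
Proof. by move=> [t ht ->]; exists (1 - t); [lra|rewrite lerpC]. Qed.

Lemma lerp_lerp p q s t : lerp p (lerp p q s) t = lerp p q (s * t).
Proof. by apply: pt_eq; rewrite /=; ring. Qed.

Lemma seg_lerp p q t : 0 <= t <= 1 -> seg p q (lerp p q t).
Proof. by move=> ht; exists t. Qed.

Lemma lerp_mid p q s t u : lerp (lerp p q s) (lerp p q t) u = lerp p q (s + u * (t - s)).
Proof. by apply: pt_eq; rewrite /=; ring. Qed.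

Lemma seg_sub p q a b z : seg p q a -> seg p q b -> seg a b z -> seg p q z.
Proof.
move=> [s hs ->] [t ht ->] [u hu ->]; rewrite lerp_mid; exists (s + u * (t - s)) => //.
by apply/andP; split; nra.
Qed.

Lemma seg_aff_le0 l p q z : aff l p <= 0 -> aff l q <= 0 -> seg p q z -> aff l z <= 0.
Proof. by move=> hp hq [t ht ->]; rewrite aff_lerp; nra. Qed.

Lemma orient0_lerp p q z : p != q -> orient p q z = 0 -> exists t, z = lerp p q t.
Proof.
move=> /dist_gt0 d0; rewrite /orient /cross /= => h.
(* The parameter of the orthogonal projection of [z] onto the line. *)
exists (((z.1 - p.1) * (q.1 - p.1) + (z.2 - p.2) * (q.2 - p.2)) /
  ((q.1 - p.1) * (q.1 - p.1) + (q.2 - p.2) * (q.2 - p.2))).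
set D := (X in _ / X); set X := (X in X / _).
have dn : D != 0 by rewrite gt_eqF.
have h1 := congr1 (fun u => (q.2 - p.2) * u) h.
have h2 := congr1 (fun u => (q.1 - p.1) * u) h.
apply: pt_eq => /=.
  have -> : p.1 + X / D * (q.1 - p.1) = (p.1 * D + X * (q.1 - p.1)) / D by field.
  by apply/(canRL (mulfK dn)); rewrite /D /X; move: h1 => /=; lra.
have -> : p.2 + X / D * (q.2 - p.2) = (p.2 * D + X * (q.2 - p.2)) / D by field.
by apply/(canRL (mulfK dn)); rewrite /D /X; move: h2 => /=; lra.
Qed.

Lemma orient_lerp p q t : orient p q (lerp p q t) = 0.
Proof. by rewrite /orient /cross /=; ring. Qed.

(** Off the line [p q], that line separates; on it, the perpendicular through the end nearer to [z]
    does. *)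
Lemma sep_point p q z : ~ seg p q z ->
  exists l, [/\ 0 < aff l z, aff l p <= 0 & aff l q <= 0].
Proof.
move=> nz; have op : orient p q p = 0 by rewrite /orient /cross /=; ring.
have oq : orient p q q = 0 by rewrite /orient /cross /=; ring.
have [h|h|h] := ltgtP (orient p q z) 0.
- by exists (oppl (orientl p q)); rewrite !aff_oppl !aff_orientl op oq; split; lra.
- by exists (orientl p q); rewrite !aff_orientl op oq; split; lra.
have [pq|pq] := eqVneq p q.
  have zp : p != z by apply/eqP => e; apply: nz; rewrite -e; apply: segl.
  exists (dotl (vec p z) p); rewrite !aff_dotl -pq /=; have := dist_gt0 zp.
  by move=> ?; split; lra.
have [t zt] := orient0_lerp pq h; have d0 := dist_gt0 pq.
have [t0|t0] := ltP t 0.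
  exists (dotl (vec q p) p); rewrite !aff_dotl zt /=; split; [nra|lra|nra].
have [t1|t1] := ltP 1 t; last by case: nz; exists t => //; lra.
exists (dotl (vec p q) q); rewrite !aff_dotl zt /=; split; [nra|nra|lra].
Qed.

(** The strict inequality at [z] of a separating form survives on a small triangle with corner
    [z]. *)
Lemma far_small p q z d e : ~ seg p q z ->
  small (fun h => forall x y, 0 <= x -> 0 <= y -> x + y <= 1 ->
    ~ seg p q (shift (shift z d (h * x)) e (h * y))).
Proof.
move=> /sep_point[l [lz lp_ lq]].
apply: smallW (smallI (small_lin (lin l d) lz) (small_lin (lin l e) lz)).
move=> h h0 [hd he] x y x0 y0 xy /(seg_aff_le0 lp_ lq); rewrite !aff_shift.
have h1 := mulr_ge0 x0 (ltW hd); have h2 := mulr_ge0 y0 (ltW he).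
have [xy1|xy1] := ltP (x + y) 1.
  have : 0 < (1 - x - y) * aff l z by rewrite mulr_gt0 //; lra.
  lra.
have [x1|x1] := ltP 0 x; first by have := mulr_gt0 x1 hd; nra.
have y1 : y = 1 by lra.
have x2 : x = 0 by lra.
by rewrite x2 y1; lra.
Qed.

Lemma far_ray p q z d : ~ seg p q z -> small (fun h => ~ seg p q (shift z d h)).
Proof.
move=> /sep_point[l [lz lp_ lq]].
apply: smallW (small_lin (lin l d) lz) => h h0 hd /(seg_aff_le0 lp_ lq).
rewrite aff_shift; lra.
Qed.

(** The parameters are those where [orient a b] vanishes on [p q] and [orient p q] on [a b]. Their
    denominators agree up to sign and are nonzero by the strict hypothesis. *)
Lemma seg_meet p q a b :
  orient a b p * orient a b q < 0 -> orient p q a * orient p q b <= 0 ->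
  exists s t, [/\ 0 < s < 1, 0 <= t <= 1 & lerp p q s = lerp a b t].
Proof.
set op := orient a b p; set oq := orient a b q.
set ha := orient p q a; set hb := orient p q b => h1 h2.
have e1 : op - oq = hb - ha by rewrite /op /oq /ha /hb /orient /cross /=; ring.
have n0 : op - oq != 0.
  apply/eqP => h; have e : op = oq by lra.
  by have := sqr_ge0 oq; move: h1; rewrite e expr2; lra.
have n1 : ha - hb != 0 by apply/eqP => h; move/eqP: n0; lra.
have n2 : hb - ha != 0 by rewrite -e1.
have eqs : lerp p q (op / (op - oq)) = lerp a b (ha / (ha - hb)).
  have n3 : orient a b p - orient a b q != 0 by [].
  have n4 : orient p q a - orient p q b != 0 by [].
  rewrite /op /oq /ha /hb; apply: pt_eq => /=; move: n3 n4; rewrite /orient /cross /= => n3 n4;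
    field; rewrite n3 n4 //.
exists (op / (op - oq)), (ha / (ha - hb)); split=> //.
  have [o0|o0] := ltP 0 op.
    have h : 0 < op - oq by nra.
    by apply/andP; split; [rewrite divr_gt0 | rewrite ltr_pdivrMr //; nra].
  have h : 0 < oq - op by nra.
  have o1 : 0 < - op by nra.
  rewrite -(opprB oq op) invrN mulrN -mulNr.
  by apply/andP; split; [rewrite divr_gt0 | rewrite ltr_pdivrMr //; nra].
have [o0|o0] := ltP 0 (ha - hb).
  have h : 0 <= ha by nra.
  by apply/andP; split; [rewrite divr_ge0 // ltW | rewrite ler_pdivrMr //; nra].
have h : 0 < hb - ha by lra.
have h3 : 0 <= - ha by nra.
rewrite -(opprB hb ha) invrN mulrN -mulNr.
by apply/andP; split; [rewrite divr_ge0 // ltW | rewrite ler_pdivrMr //; nra].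
Qed.

Lemma same_side_of_unit_interval (x y : R) :
  (forall u, 0 <= u <= 1 -> ~ 0 < x + u * (y - x) < 1) ->
  x <= 0 /\ y <= 0 \/ 1 <= x /\ 1 <= y.
Proof.
move=> nin; have h0 : 0 <= (0 : R) <= 1 by rewrite lexx ler01.
have h1 : 0 <= (1 : R) <= 1 by rewrite ler01 lexx.
have nx := nin 0 h0; have ny := nin 1 h1; rewrite mul0r addr0 in nx.
rewrite mul1r addrC subrK in ny.
(* An interval reaching from below 0 to above 1 contains 1/2. *)
have half (v w : R) : v <= 0 -> 1 <= w -> 0 <= (1 / 2 - v) / (w - v) <= 1 /\
    (1 / 2 - v) / (w - v) * (w - v) = 1 / 2 - v :> R.
  move=> v0 w1; have d0 : 0 < w - v by lra.
  rewrite mulfVK ?gt_eqF //; split=> //; apply/andP; split.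
    by apply: divr_ge0; lra.
  by rewrite ler_pdivrMr //; lra.
have [x0|x0] := leP x 0; have [y0|y0] := leP y 0; try by left.
- have y1 : 1 <= y by rewrite leNgt; apply/negP => y1; apply: ny; rewrite y0.
  by have [h e] := half x y x0 y1; case: (nin _ h); rewrite e; lra.
- have x1 : 1 <= x by rewrite leNgt; apply/negP => x1; apply: nx; rewrite x0.
  have [h e] := half y x y0 x1; case: (nin (1 - (1 / 2 - y) / (x - y))); first by lra.
  rewrite (_ : x + _ = y + (1 / 2 - y) / (x - y) * (x - y)); last by ring.
  by rewrite e; lra.
by right; split; rewrite leNgt; apply/negP => h; [apply: nx; rewrite x0|apply: ny; rewrite y0].
Qed.

(* The final alternative puts [w], pushed slightly in direction [n], strictly on the side of
   [p q] of the separating line. *)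
Lemma sep_seg p q a b n t : p != q -> a != b -> 0 < t < 1 -> cross (vec p q) n != 0 ->
  (forall z, seg p q z -> seg a b z -> z = p \/ z = q) ->
  exists l, [/\ 0 <= aff l p, 0 <= aff l q, aff l a <= 0, aff l b <= 0 &
    0 < aff l (lerp p q t) \/ aff l (lerp p q t) = 0 /\ 0 < lin l n].
Proof.
move=> pq ab t01 nn dis; have d0 := dist_gt0 pq.
have inner s : 0 < s < 1 -> ~ seg a b (lerp p q s).
  move=> s01 h; have s01' : 0 <= s <= 1 by lra.
  have [] := dis _ (seg_lerp p q s01') h; move=> /(congr1 (fun z => 
    (z.1 - p.1) * (q.1 - p.1) + (z.2 - p.2) * (q.2 - p.2))) /=; nra.
have oa : orient a b a = 0 by rewrite /orient /cross /=; ring.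
have ob : orient a b b = 0 by rewrite /orient /cross /=; ring.
have op : orient p q p = 0 by rewrite /orient /cross /=; ring.
have oq : orient p q q = 0 by rewrite /orient /cross /=; ring.
(* The line [a b] cuts [p q] in its relative interior, a point that the segment [a b] avoids. Hence
   [a] and [b] are strictly on one side of the line [p q], which separates. *)
have opp : orient a b p * orient a b q < 0 -> exists l, [/\ 0 <= aff l p,
    0 <= aff l q, aff l a <= 0, aff l b <= 0 &
    0 < aff l (lerp p q t) \/ aff l (lerp p q t) = 0 /\ 0 < lin l n].
  move=> ho.
  have [l [lp lq lab ln]] : exists l, [/\ aff l p = 0, aff l q = 0,
      aff l a * aff l b = orient p q a * orient p q b & 0 < lin l n].
    have lE : lin (orientl p q) n = cross (vec p q) n by rewrite /lin /cross /=; ring.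
    have [k|k] := ltP 0 (cross (vec p q) n).
      by exists (orientl p q); rewrite lE !aff_orientl.
    exists (oppl (orientl p q)); rewrite !aff_oppl !aff_orientl op oq mulrNN oppr0; split=> //.
    have -> : lin (oppl (orientl p q)) n = - lin (orientl p q) n by rewrite /lin /=; ring.
    by rewrite lE oppr_gt0 lt_neqAle nn.
  have wl : aff l (lerp p q t) = 0 by rewrite aff_lerp lp lq; ring.
  have [h|h] := leP (orient p q a * orient p q b) 0.
    have [s [s' [hs hs' e]]] := seg_meet ho h.
    by case: (inner _ hs); rewrite e; apply: seg_lerp.
  (* If [a] and [b] are on the side of [n], the separating line is moved to the parallel through the
     nearer of them. Otherwise it remains the line [p q], and [n] decides. *)
  rewrite -lab in h; have [a0|a0] := ltP 0 (aff l a).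
    have b0 : 0 < aff l b by nra.
    pose m := Num.min (aff l a) (aff l b).
    have m0 : 0 < m by rewrite lt_min a0.
    have ma : m <= aff l a by rewrite ge_min lexx.
    have mb : m <= aff l b by rewrite ge_min lexx orbT.
    pose l' := (- l.1.1, - l.1.2, m - l.2).
    have lE z : aff l' z = m - aff l z by rewrite /aff /lin /=; ring.
    by exists l'; rewrite !lE lp lq wl; split; try lra; left; lra.
  have a1 : aff l a < 0.
    by rewrite lt_neqAle a0 andbT; apply/eqP => e; move: h; rewrite e mul0r ltxx.
  have b0 : aff l b < 0 by nra.
  by exists l; rewrite lp lq; split; try lra; right.
have same l : aff l a = 0 -> aff l b = 0 -> 0 <= aff l p -> 0 <= aff l q ->
    0 < aff l p + aff l q -> exists l, [/\ 0 <= aff l p,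
    0 <= aff l q, aff l a <= 0, aff l b <= 0 &
    0 < aff l (lerp p q t) \/ aff l (lerp p q t) = 0 /\ 0 < lin l n].
  move=> la lb lp lq lpq; exists l; rewrite la lb lp lq aff_lerp; split=> //; left.
  have [t0 t1] := andP t01; have t2 : 0 < 1 - t by lra.
  have [h|h] := ltP 0 (aff l p).
    by rewrite ltr_wpDr ?mulr_gt0 // mulr_ge0 // ltW.
  by rewrite ltr_wpDl ?mulr_ge0 ?mulr_gt0 ?(ltW t2) //; lra.
have samep := same (orientl a b); have samen := same (oppl (orientl a b)).
rewrite !aff_oppl !aff_orientl oa ob oppr0 in samep samen.
have [cp|cp|cp] := ltgtP (orient a b p) 0; have [cq|cq|cq] := ltgtP (orient a b q) 0;
  rewrite ?cp ?cq in samep samen.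
- by apply: samen => //; lra.
- by apply: opp; rewrite pmulr_llt0.
- by apply: samen => //; lra.
- by apply: opp; rewrite pmulr_rlt0.
- by apply: samep => //; lra.
- by apply: samep => //; lra.
- by apply: samen => //; lra.
- by apply: samep => //; lra.
(* All four points are collinear, and a perpendicular at [p] or [q] separates. *)
have [s ps] := orient0_lerp ab cp; have [s' qs] := orient0_lerp ab cq.
have [ta ea] : exists ta, a = lerp p q ta.
  by apply: orient0_lerp => //; rewrite ps qs /orient /cross /=; ring.
have [tb eb] : exists tb, b = lerp p q tb.
  by apply: orient0_lerp => //; rewrite ps qs /orient /cross /=; ring.
have nin u : 0 <= u <= 1 -> ~ 0 < ta + u * (tb - ta) < 1.
  by move=> hu h; apply: (inner _ h); rewrite -lerp_mid -ea -eb; apply: seg_lerp.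
have [h|h] := same_side_of_unit_interval nin.
- exists (dotl (vec p q) p); rewrite aff_lerp !aff_dotl ea eb /=.
  by split; [lra|nra|nra|nra|left; nra].
exists (dotl (vec q p) q); rewrite aff_lerp !aff_dotl ea eb /=.
by split; [nra|lra|nra|nra|left; nra].
Qed.

End Plane.

(** * Visibility in a convex subdivision *)

Section Exit.
Variable R : realFieldType.

Lemma conv_ge0 (t a b : R) : 0 <= t <= 1 -> 0 <= a -> 0 <= b -> 0 <= a + t * (b - a).
Proof. by move=> t01 a0 b0; nra. Qed.

Lemma before_root (t s a b : R) :
  t <= s -> 0 < a - b -> s * (a - b) = a -> 0 <= a + t * (b - a).
Proof. by move=> ts ab h; nra. Qed.

(** A pair holds the values of an affine form at the two ends of a segment. The least zero of the
    forms that become negative is the moment when the segment leaves the convex region where all are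
    nonnegative. *)
Lemma exit_time (s : seq (R * R)) :
  (forall u, u \in s -> 0 <= u.1) -> (exists2 u, u \in s & u.2 < 0) ->
  exists t, [/\ 0 <= t <= 1, forall u, u \in s -> 0 <= u.1 + t * (u.2 - u.1)
    & exists2 u, u \in s & u.2 < 0 /\ u.1 + t * (u.2 - u.1) = 0].
Proof.
move=> s0 ex; pose f (u : R * R) := u.1 / (u.1 - u.2).
have [u [us u2 umin]] := @exists_extremal _ s (fun u => u.2 < 0)
  (fun u v => f v < f u) (fun _ _ _ _ _ _ h1 h2 => lt_trans h2 h1)
  (fun a _ => elimF idP (ltxx (f a))) ex.
have u1 := s0 u us.
have fE v : 0 <= v.1 -> v.2 < 0 -> f v * (v.1 - v.2) = v.1.
  by move=> ? ?; rewrite /f mulfVK //; apply/eqP; lra.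
have f0 v : 0 <= v.1 -> v.2 < 0 -> 0 <= f v <= 1.
  move=> ? ?; have h : 0 < v.1 - v.2 by lra.
  by apply/andP; split; [rewrite divr_ge0 // ltW | rewrite ler_pdivrMr //; lra].
exists (f u); split; first exact: f0.
- move=> v vs; have v1 := s0 v vs; have fu := f0 u u1 u2.
  have [v2|v2] := ltP v.2 0; last exact: conv_ge0.
  have := umin v vs v2; move/negP; rewrite -leNgt => h.
  have d0 : 0 < v.1 - v.2 by lra.
  by apply: (before_root h d0); apply: fE.
by exists u => //; split=> //; have := fE u u1 u2; lra.
Qed.

(** With [a, c] and [b, d] the values of two affine forms at the ends of a segment: no point of the
    segment is lexicographically above both ends. *)
Lemma comb_lex (t a b c d : R) : 0 <= t <= 1 ->
  a < (1 - t) * a + t * b \/ a = (1 - t) * a + t * b /\ c < (1 - t) * c + t * d ->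
  b < (1 - t) * a + t * b \/ b = (1 - t) * a + t * b /\ d < (1 - t) * c + t * d -> False.
Proof.
move=> /andP[t0 t1].
have [->|t_n0] := eqVneq t 0; first by move=> [h1|[h1 h2]]; lra.
have [->|t_n1] := eqVneq t 1; first by move=> _ [h1|[h1 h2]]; lra.
have {t0}t_gt0 : 0 < t by rewrite lt_neqAle eq_sym t_n0.
have {t1}t_lt1 : 0 < 1 - t by rewrite subr_gt0 lt_neqAle t_n1.
have key x y : (x < (1 - t) * x + t * y) = (x < y).
  have e : (1 - t) * x + t * y - x = t * (y - x) by ring.
  by rewrite -subr_gt0 e pmulr_rgt0 // subr_gt0.
have key' x y : (y < (1 - t) * x + t * y) = (y < x).
  have e : (1 - t) * x + t * y - y = (1 - t) * (x - y) by ring.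
  by rewrite -subr_gt0 e pmulr_rgt0 // subr_gt0.
rewrite !key !key' => -[h1|[h1 h2]] [h3|[h3 h4]]; [lra| |  |lra].
  have : (1 - t) * (a - b) = 0 by lra.
  by move/eqP; rewrite mulf_eq0 gt_eqF //= subr_eq0 => /eqP; lra.
have : t * (b - a) = 0 by lra.
by move/eqP; rewrite mulf_eq0 gt_eqF //= subr_eq0 => /eqP; lra.
Qed.

End Exit.

Section Graph.
Variable R : realFieldType.
Notation pt := (R * R)%type.
Implicit Types (p q a b x y z w v : pt) (l m : R * R * R).
Variables (V : seq pt) (E : seq (pt * pt)).

Definition onH z : Prop := exists2 e, e \in E & seg e.1 e.2 z.
Definition adj v w : Prop := (v, w) \in E \/ (w, v) \in E.
(* Half-open, so that [z] may be a vertex of the graph. *)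
Definition sees x z : Prop := forall t, 0 <= t < 1 -> ~ onH (lerp x z t).
Definition ltlex l m a b : Prop :=
  aff l a < aff l b \/ aff l a = aff l b /\ aff m a < aff m b.
(* Says that all bounded faces are convex, without mentioning faces. *)
Definition local_max_global : Prop := forall l m, cross l.1 m.1 != 0 ->
  forall v, v \in V -> (forall w, adj v w -> ~ ltlex l m v w) ->
  forall w, w \in V -> ~ ltlex l m v w.
(** The convex hull of [V] without its extreme points: an extreme point is highest in some of these
    orders, while every other point of the hull is exceeded by a vertex in each of them. *)
Definition inside x : Prop := forall l m, cross l.1 m.1 != 0 ->
  exists2 v, v \in V & ltlex l m x v.

Lemma ltlex_trans l m a b c : ltlex l m a b -> ltlex l m b c -> ltlex l m a c.
Proof.
rewrite /ltlex => -[h1|[h1 h2]] [h3|[h3 h4]]; [left; lra..|right; split; lra].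
Qed.

Lemma ltlex_irr l m a : ~ ltlex l m a a.
Proof. by case=> [|[_]]; rewrite ltxx. Qed.

Lemma nltlex l m a b : ~ ltlex l m a b ->
  aff l b < aff l a \/ aff l b = aff l a /\ aff m b <= aff m a.
Proof.
move=> h; have [h1|h1|h1] := ltgtP (aff l b) (aff l a); first by left.
  by case: h; left.
by right; split=> //; rewrite leNgt; apply/negP => h2; apply: h; right.
Qed.

Lemma adj_onH v w z : adj v w -> seg v w z -> onH z.
Proof. by case=> h hz; [exists (v, w) | exists (w, v)] => //; apply: segC. Qed.

Hypothesis endp : forall e, e \in E -> e.1 \in V /\ e.2 \in V.
Hypothesis lmg : local_max_global.

Lemma adjV v w : adj v w -> w \in V.
Proof. by case=> /endp[]. Qed.

Section Triangle.
Variables (x y z : pt) (A B C : R * R * R).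
Hypothesis sum1 : forall p, aff A p + aff B p + aff C p = 1.
Hypothesis baryE : forall p,
  p.1 = aff A p * x.1 + aff B p * y.1 + aff C p * z.1 /\
  p.2 = aff A p * x.2 + aff B p * y.2 + aff C p * z.2.
Hypothesis By1 : aff B y = 1.
Hypothesis AB : cross B.1 A.1 != 0.
Hypothesis insy : inside y.
Variable c : R.
Hypothesis c0 : 0 <= c.

(** Marks the part of the triangle to be shown free: everything above the base [x z], and the points
    of the base with [aff A] above [c]. For [c = 0] these are all points of the base but [z]; for
    [c = 1] there are none. *)
Let up w : Prop := 0 < aff B w \/ aff B w = 0 /\ c < aff A w.
Let tri w : Prop := [/\ 0 <= aff A w, 0 <= aff B w & 0 <= aff C w].

Hypothesis yz : sees y z.
Hypothesis yx : forall w, seg x y w -> onH w -> ~ up w.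

(** A rising edge cannot leave through the base, and [yz] and [yx] keep the graph off the other two
    sides. *)
Lemma tri_step v v' : tri v -> up v -> ~ ltlex B A v' v ->
  (forall w, seg v v' w -> onH w) -> tri v' /\ up v'.
Proof.
move=> [a0 b0 c0'] uv /nltlex lx ho.
have b1 : aff B v <= aff B v' by lra.
have uv' : up v'.
  rewrite /up; case: uv lx => [h|[h1 h2]] [h3|[h3 h4]]; try by left; lra.
  by right; split; lra.
pose s := [:: (aff A v, aff A v'); (aff C v, aff C v')].
suff nex : ~ exists2 u, u \in s & u.2 < 0.
  split=> //; split; [|lra|]; rewrite leNgt; apply/negP => neg; apply: nex.
    by exists (aff A v, aff A v') => //; rewrite !inE eqxx.
  by exists (aff C v, aff C v') => //; rewrite !inE eqxx orbT.
move=> /(exit_time _)[]; first by move=> u; rewrite !inE => /orP[]/eqP->.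
move=> t [t01 pos [u us [_ u0]]]; set w := lerp v v' t.
have Aw : aff A w = aff A v + t * (aff A v' - aff A v) by rewrite aff_lerp; ring.
have Bw : aff B w = aff B v + t * (aff B v' - aff B v) by rewrite aff_lerp; ring.
have Cw : aff C w = aff C v + t * (aff C v' - aff C v) by rewrite aff_lerp; ring.
have A0 : 0 <= aff A w by rewrite Aw; apply: (pos (aff A v, aff A v')); rewrite !inE eqxx.
have C0 : 0 <= aff C w.
  by rewrite Cw; apply: (pos (aff C v, aff C v')); rewrite !inE eqxx orbT.
have ow : onH w by apply: ho; apply: seg_lerp.
have t0 : 0 <= t by case/andP: t01.
have B0 : aff B v <= aff B w by rewrite Bw lerDl mulr_ge0 // subr_ge0.
have uw : up w.
  rewrite /up; have [?|B1] := ltP 0 (aff B w); [by left|right].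
  have B2 : aff B w = 0 by lra.
  split=> //; have B3 : aff B v = 0 by lra.
  have A1 : c < aff A v by case: uv => [|[]//]; lra.
  case: lx => [lx|[lx lx']]; last first.
    by rewrite Aw (lt_le_trans A1) // lerDl mulr_ge0 // subr_ge0.
  suff t1 : t = 0 by rewrite Aw t1; lra.
  move: Bw; rewrite B2 B3 add0r subr0 => /esym/eqP; rewrite mulf_eq0.
  by case/orP => /eqP // h; move: lx; rewrite h B3 ltxx.
have [e1 e2] := baryE w; have s1 := sum1 w.
move: us; rewrite !inE => /orP[]/eqP uE; move: u0; rewrite uE /= -?Aw -?Cw => w0.
  have Bw0 : 0 < aff B w.
    by case: uw => [//|[_ h]]; move: h; rewrite w0 ltNge c0.
  apply: (yz (t := aff C w)); first lra.
  suff -> : lerp y z (aff C w) = w by [].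
  have h : aff B w = 1 - aff C w by lra.
  by apply: pt_eq; rewrite ?e1 ?e2 w0 h /=; ring.
apply: (yx _ ow uw); exists (aff B w); first lra.
have h : aff A w = 1 - aff B w by lra.
by apply: pt_eq; rewrite ?e1 ?e2 w0 h /=; ring.
Qed.

(* A lexicographically highest vertex inside the triangle has a higher neighbour, and the edge
   to it cannot leave the triangle. *)
Lemma tri_free w : onH w -> tri w -> ~ up w.
Proof.
move=> [e eE we] tw uw; have [pV qV] := endp eE.
have [v0 [v0V tv0 uv0]] : exists v0, [/\ v0 \in V, tri v0 & up v0].
  have [hp|hp] := EM (ltlex B A e.1 w); last first.
    have [] := tri_step tw uw hp; last by exists e.1.
    by move=> u hu; exists e => //; apply: seg_sub hu => //; apply: segl.
  have hq : ~ ltlex B A e.2 w.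
    case: we hp => t t01 we hp hq.
    have Bw : aff B w = (1 - t) * aff B e.1 + t * aff B e.2 by rewrite we aff_lerp.
    have Aw : aff A w = (1 - t) * aff A e.1 + t * aff A e.2 by rewrite we aff_lerp.
    by move: hp hq; rewrite /ltlex Bw Aw; apply: comb_lex.
  have [] := tri_step tw uw hq; last by exists e.2.
  by move=> u hu; exists e => //; apply: seg_sub hu => //; apply: segr.
have [v [vV [tv uv] vmax]] := @exists_extremal _ V (fun v => tri v /\ up v) (ltlex B A)
  (fun a b c _ _ _ => @ltlex_trans B A a b c) (fun a _ => @ltlex_irr B A a)
  (ex_intro2 _ _ v0 v0V (conj tv0 uv0)).
have loc u : adj v u -> ~ ltlex B A v u.
  move=> vu lt; have nlt : ~ ltlex B A u v.
    by move=> lt'; apply: (@ltlex_irr B A v); apply: ltlex_trans lt lt'.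
  have [] := tri_step tv uv nlt; first by move=> u' ; apply: adj_onH.
  by move=> tu uu; apply: (vmax u (adjV vu)).
(* The point [y] is the highest of the triangle and some vertex is higher still, so [v] is not a
   global maximum. *)
have glob := lmg AB vV loc; have [v1 v1V lt1] := insy AB.
apply: (glob v1 v1V); case: tv => a0 b0 c1; have s1 := sum1 v.
have [b1|b1] := ltP (aff B v) 1.
  by apply: ltlex_trans lt1; left; rewrite By1.
have [e1 e2] := baryE v.
suff -> : v = y by [].
have [av [bv cv]] : aff A v = 0 /\ aff B v = 1 /\ aff C v = 0 by split; [|split]; lra.
by apply: pt_eq; rewrite ?e1 ?e2 av bv cv; ring.
Qed.

End Triangle.

End Graph.

Section Bary.
Variable R : realFieldType.
Notation pt := (R * R)%type.
Implicit Types (x y z p : pt) (k : R).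

Definition scalel k (l : R * R * R) : R * R * R := (k * l.1.1, k * l.1.2, k * l.2).

Lemma aff_scalel k l p : aff (scalel k l) p = k * aff l p.
Proof. by rewrite /aff /lin /=; ring. Qed.

(** The coordinates are orientations of subtriangles divided by that of the whole triangle. *)
Lemma barycentric x y z : orient x y z != 0 -> exists A B C : R * R * R,
  [/\ forall p, aff A p + aff B p + aff C p = 1,
     forall p, p.1 = aff A p * x.1 + aff B p * y.1 + aff C p * z.1 /\
               p.2 = aff A p * x.2 + aff B p * y.2 + aff C p * z.2,
     cross B.1 A.1 != 0,
     [/\ aff A x = 1, aff A y = 0 & aff A z = 0] &
     [/\ aff B x = 0, aff B y = 1 & aff B z = 0] /\
     [/\ aff C x = 0, aff C y = 0 & aff C z = 1]].
Proof.
set D := orient x y z => D0.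
exists (scalel D^-1 (orientl y z)), (scalel D^-1 (orientl z x)), (scalel D^-1 (orientl x y)).
have E1 p : aff (scalel D^-1 (orientl y z)) p = orient y z p / D.
  by rewrite aff_scalel aff_orientl mulrC.
have E2 p : aff (scalel D^-1 (orientl z x)) p = orient z x p / D.
  by rewrite aff_scalel aff_orientl mulrC.
have E3 p : aff (scalel D^-1 (orientl x y)) p = orient x y p / D.
  by rewrite aff_scalel aff_orientl mulrC.
have Dn : orient x y z != 0 by [].
split.
- move=> p; rewrite E1 E2 E3 /D; move: Dn; rewrite /orient /cross /= => Dn; field.
  exact: Dn.
- move=> p; rewrite E1 E2 E3 /D; move: Dn; rewrite /orient /cross /= => Dn.
  by split; field; exact: Dn.
- have -> : cross (scalel D^-1 (orientl z x)).1 (scalel D^-1 (orientl y z)).1 = - D^-1.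
    rewrite /cross /= /D; move: Dn; rewrite /orient /cross /= => Dn; field; exact: Dn.
  by rewrite oppr_eq0 invr_eq0.
- rewrite !E1; have -> : orient y z x = D by rewrite /D /orient /cross /=; ring.
  have -> : orient y z y = 0 by rewrite /orient /cross /=; ring.
  have -> : orient y z z = 0 by rewrite /orient /cross /=; ring.
  by rewrite divff // mul0r.
rewrite !E2 !E3; have -> : orient z x y = D by rewrite /D /orient /cross /=; ring.
have -> : orient z x z = 0 by rewrite /orient /cross /=; ring.
have -> : orient z x x = 0 by rewrite /orient /cross /=; ring.
have -> : orient x y x = 0 by rewrite /orient /cross /=; ring.
have -> : orient x y y = 0 by rewrite /orient /cross /=; ring.
by rewrite -/D divff // mul0r.
Qed.

Lemma lex_conv l m x w v (s : R) : 0 <= s < 1 -> ltlex l m x v -> ~ ltlex l m v w ->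
  ltlex l m (lerp x w s) v.
Proof.
move=> /andP[s0 s1] xv /nltlex wv; rewrite /ltlex !aff_lerp.
have key (a b c : R) : a < b -> c <= b -> (1 - s) * a + s * c < b.
  move=> ab cb; have h1 : 0 < (1 - s) * (b - a) by rewrite mulr_gt0 ?subr_gt0.
  have h2 : 0 <= s * (b - c) by rewrite mulr_ge0 ?subr_ge0.
  by lra.
case: xv wv => [h1|[h1 h2]] [h3|[h3 h4]].
- by left; apply: key => //; lra.
- by left; apply: key => //; lra.
- have [->|sn0] := eqVneq s 0; first by right; split; [rewrite h1|]; lra.
  left; have h5 : 0 < s * (aff l v - aff l w).
    by rewrite mulr_gt0 ?subr_gt0 // lt_neqAle eq_sym sn0.
  by rewrite h1; lra.
by right; split; [rewrite h1 h3; ring|apply: key].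
Qed.

End Bary.

Section Visibility.
Variable R : realFieldType.
Notation pt := (R * R)%type.
Implicit Types (p q a b x y z w v d n : pt) (l m : R * R * R).
Variables (V : seq pt) (E : seq (pt * pt)).
Notation onH := (onH E).
Notation adj := (adj E).
Notation sees := (sees E).
Notation inside := (inside V).

Definition lexlt p q : bool := (p.1 < q.1) || (p.1 == q.1) && (p.2 < q.2).

Lemma lexlt_neq p q : lexlt p q -> p != q.
Proof. by apply: contraTneq => ->; rewrite /lexlt !ltxx andbF. Qed.

(** Putting the smaller end of an edge first fixes its representation and places the directions of
    all edges leaving a vertex in one half-plane. The vertex provided by [sub_meet] is a common end
    of both edges by [sub_vertex]. *)
Record subdivision : Prop := Subdivision {
  sub_endp : forall e, e \in E -> e.1 \in V /\ e.2 \in V;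
  sub_lex : forall e, e \in E -> lexlt e.1 e.2;
  sub_vertex : forall e v, e \in E -> v \in V -> seg e.1 e.2 v -> v = e.1 \/ v = e.2;
  sub_meet : forall e f z, e \in E -> f \in E -> e != f ->
    seg e.1 e.2 z -> seg f.1 f.2 z -> z \in V;
  sub_onH : forall v, v \in V -> onH v }.

Hypothesis subH : subdivision.
Hypothesis lmg : local_max_global V E.
Let endp := sub_endp subH.

Lemma sees_sym x z : ~ onH z -> sees x z -> sees z x.
Proof.
move=> nz h t t01; have [->|t0] := eqVneq t 0; first by rewrite lerp0.
rewrite lerpC; apply: h; have : 0 < t by rewrite lt_neqAle eq_sym t0; case/andP: t01.
lra.
Qed.

Lemma sees_sub x z t : 0 <= t <= 1 -> sees x z -> sees x (lerp x z t).
Proof. by move=> t01 h s s01; rewrite lerp_lerp; apply: h; apply/andP; split; nra. Qed.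

Lemma onH_vertex z : onH z -> exists e, [/\ e \in E, e.1 \in V, e.2 \in V & seg e.1 e.2 z].
Proof. by move=> [e eE ze]; have [] := endp eE; exists e. Qed.

Lemma onH_le w l m : onH w -> exists2 v, v \in V & ~ ltlex l m v w.
Proof.
move=> /onH_vertex[e [_ pV qV [t t01 wE]]].
have [hp|] := EM (ltlex l m e.1 w); last by exists e.1.
exists e.2 => // hq; move: hp hq.
by rewrite wE /ltlex !aff_lerp; apply: comb_lex.
Qed.

(** The higher of a vertex above [x] and a vertex not below [w] is above the whole half-open
    segment. *)
Lemma inside_lerp x w s : inside x -> onH w \/ inside w -> 0 <= s < 1 ->
  inside (lerp x w s).
Proof.
move=> ix hw s01 l m lm; have [v vV xv] := ix l m lm.
have [u uV wu] : exists2 u, u \in V & ~ ltlex l m u w.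
  case: hw => [/onH_le|iw]; first exact.
  have [u uV wu] := iw l m lm; exists u => // uw.
  by apply: (@ltlex_irr _ l m u); apply: ltlex_trans uw wu.
have [uv|uv] := EM (ltlex l m v u).
  by exists u => //; apply: lex_conv => //; apply: ltlex_trans xv uv.
exists v => //; apply: lex_conv => // vw.
by move: (nltlex uv) (nltlex wu) vw; rewrite /ltlex; lra.
Qed.

Lemma sees_closed x y w : ~ onH x -> sees y x -> seg x y w -> ~ onH w.
Proof.
move=> nx yx [s s01 ->]; have [->|s0] := eqVneq s 0; first by rewrite lerp0.
rewrite lerpC; apply: yx.
by have : 0 < s; [rewrite lt_neqAle eq_sym s0; case/andP: s01 | lra].
Qed.

(** The collinear case of [sees_trans], where there is no triangle: the segments from [y] to [x] and
    to the third point cover the one in question. *)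
Lemma sees_trans_line x y t : ~ onH x -> sees y x -> sees y (lerp x y t) ->
  sees x (lerp x y t).
Proof.
move=> nx yx yz s /andP[s0 s1]; rewrite lerp_lerp mulrC.
have [st|st] := ltP (s * t) 0.
  have t0 : t < 0 by rewrite ltNge; apply/negP => t0; have := mulr_ge0 s0 t0; lra.
  have d0 : 0 < 1 - t by lra.
  have -> : lerp x y (s * t) = lerp y (lerp x y t) ((1 - s * t) / (1 - t)).
    by apply: pt_eq => /=; field; rewrite gt_eqF.
  by apply: yz; rewrite divr_ge0 ?ltr_pdivrMr //=; nra.
have [st1|st1] := leP (s * t) 1.
  by apply: sees_closed nx yx _; apply: seg_lerp; lra.
have t1 : 1 < t.
  rewrite ltNge; apply/negP => t1.
  by have := mulr_ge0 s0 (_ : 0 <= 1 - t); rewrite subr_ge0 => /(_ t1); lra.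
have d0 : 0 < t - 1 by lra.
have -> : lerp x y (s * t) = lerp y (lerp x y t) ((s * t - 1) / (t - 1)).
  by apply: pt_eq => /=; field; rewrite gt_eqF.
by apply: yz; rewrite divr_ge0 ?ltr_pdivrMr //=; nra.
Qed.

(** The segment [x z] without [z] is the free part of the base of the triangle in [tri_free] with
    [c = 0]. *)
Lemma sees_trans x y z : inside y -> ~ onH x -> sees y x -> sees y z -> sees x z.
Proof.
move=> iy nx yx yz; have [deg|] := eqVneq (orient x y z) 0.
  have [<-//|xy] := eqVneq y x; rewrite eq_sym in xy.
  by have [t zE] := orient0_lerp xy deg; rewrite zE in yz *; apply: sees_trans_line.
move=> /barycentric[A [B [C [sum1 baryE AB [Ax Ay Az] [[Bx By Bz] [Cx Cy Cz]]]]]] t t01 ot.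
have := @tri_free _ V E endp lmg x y z A B C sum1 baryE By AB iy 0 (lexx 0) yz.
move=> /(_ _ _ ot)[].
- by move=> w xw ow _; apply: sees_closed xw ow.
- by rewrite !aff_lerp Ax Az Bx Bz Cx Cz; split; lra.
by right; rewrite !aff_lerp Ax Az Bx Bz; split; lra.
Qed.

(** Here [x] and [z] may lie on the graph, so [tri_free] is used with [c = 1] and the base is left
    out. *)
Lemma triangle_free x y z : orient x y z != 0 -> inside y -> sees y x -> sees y z ->
  forall a b c : R, 0 <= a -> 0 < b -> 0 <= c -> a + b + c = 1 ->
  ~ onH (a * x.1 + b * y.1 + c * z.1, a * x.2 + b * y.2 + c * z.2).
Proof.
move=> /barycentric[A [B [C [sum1 baryE AB [Ax Ay Az] [[Bx By Bz] [Cx Cy Cz]]]]]] iy yx yz.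
move=> a b c a0 b0 c0 abc ow.
have lE l : aff l (a * x.1 + b * y.1 + c * z.1, a * x.2 + b * y.2 + c * z.2) =
    a * aff l x + b * aff l y + c * aff l z.
  have -> : a = 1 - b - c by lra.
  by rewrite /aff /lin /=; ring.
have := @tri_free _ V E endp lmg x y z A B C sum1 baryE By AB iy 1 ler01 yz.
move=> /(_ _ _ ow)[].
- move=> w [s s01 ->]; rewrite !aff_lerp Ax Bx Ay By lerpC => ow' h.
  by apply: yx ow'; case: h; lra.
- by rewrite !lE Ax Ay Az Bx By Bz Cx Cy Cz; split; lra.
by left; rewrite lE Bx By Bz; lra.
Qed.

(** For every other edge, [sep_seg] gives a form that is nonpositive on that edge, nonnegative at
    the ends of [e] and positive at the shifted point. It stays positive on the way to an end of
    [e], up to that end. *)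
Lemma beside_small e t n : e \in E -> 0 < t < 1 -> cross (vec e.1 e.2) n != 0 ->
  small (fun h => let y := shift (lerp e.1 e.2 t) n h in
    [/\ ~ onH y, sees y e.1 & sees y e.2]).
Proof.
move=> eE t01 nn; set w := lerp _ _ _; have [pV qV] := endp eE.
have neq f : f \in E -> f.1 != f.2.
  by move=> /(sub_lex subH) /lexlt_neq.
suff sm f : f \in E -> small (fun h => forall s z, z = e.1 \/ z = e.2 -> 0 <= s < 1 ->
    ~ seg f.1 f.2 (lerp (shift w n h) z s)).
  apply: smallW (small_all sm) => h h0 H; split.
  - move=> [f fE sf]; apply: (H f fE 0 e.1 (or_introl erefl)); first lra.
    by rewrite lerp0.
  - by move=> s s01 [f fE sf]; apply: (H f fE s e.1 (or_introl erefl) s01).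
  - by move=> s s01 [f fE sf]; apply: (H f fE s e.2 (or_intror erefl) s01).
move=> fE; have [<-|ef] := eqVneq e f.
  apply: smallT => h h0 s z ze /andP[s0 s1] [u _ /esym zE].
  have := orient_lerp e.1 e.2 u; rewrite zE.
  have -> : orient e.1 e.2 (lerp (shift w n h) z s) = (1 - s) * (h * cross (vec e.1 e.2) n).
    by case: ze => ->; rewrite /w /orient /cross /=; ring.
  by move/eqP; rewrite !mulf_eq0 (negPf nn) !gt_eqF // subr_gt0.
have [l [lp lq la lb lw]] := sep_seg (neq _ eE) (neq _ fE) t01 nn (fun z ze zf =>
  sub_vertex subH eE (sub_meet subH eE fE ef ze zf) ze).
have sm : small (fun h => 0 < aff l (shift w n h)).
  case: lw => [l0|[l0 ln]].
    by apply: smallW (small_lin (lin l n) l0) => h _; rewrite aff_shift.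
  by apply: smallT => h h0; rewrite aff_shift l0 add0r mulr_gt0.
apply: smallW sm => h h0 hw s z ze /andP[s0 s1] /(seg_aff_le0 la lb); rewrite aff_lerp.
have z0 : 0 <= aff l z by case: ze => ->.
have : 0 < (1 - s) * aff l (shift w n h) by rewrite mulr_gt0 ?subr_gt0.
by have := mulr_ge0 s0 z0; lra.
Qed.

(** Just before the hit, the line of sight is at a point beside [e], which sees both ends;
    transitivity carries this back to [x]. *)
Lemma hit_sees x e t : inside x -> e \in E -> 0 < t < 1 -> ~ onH x ->
  sees x (lerp e.1 e.2 t) -> sees x e.1 /\ sees x e.2.
Proof.
move=> ix eE t01 nx xw; set w := lerp _ _ _ in xw; have [pV qV] := endp eE.
have ow : onH w by exists e => //; apply: seg_lerp; lra.
have o1 : onH e.1 by exists e => //; apply: segl.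
have o2 : onH e.2 by exists e => //; apply: segr.
have pq := lexlt_neq (sub_lex subH eE).
(* On the line of [e], the point [x] would lie on [e] itself or meet an end of [e] before [w]. *)
have nn : cross (vec e.1 e.2) (vec w x) != 0.
  apply/eqP => cr; have [s xE] : exists s, x = lerp e.1 e.2 s.
    by apply: orient0_lerp => //; rewrite -cr /w /orient /cross /=; ring.
  have [s0|s0] := ltP s 0.
    have d0 : 0 < t - s by lra.
    apply: (xw (- s / (t - s))); first by rewrite divr_ge0 ?ltr_pdivrMr //=; lra.
    suff -> : lerp x w (- s / (t - s)) = e.1 by [].
    by rewrite xE; apply: pt_eq; rewrite /=; field; rewrite gt_eqF.
  have [s1|s1] := ltP 1 s.
    have d0 : 0 < s - t by lra.
    apply: (xw ((s - 1) / (s - t))); first by rewrite divr_ge0 ?ltr_pdivrMr //=; lra.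
    suff -> : lerp x w ((s - 1) / (s - t)) = e.2 by [].
    by rewrite xE; apply: pt_eq; rewrite /=; field; rewrite gt_eqF.
  by apply: nx; exists e => //; exists s => //; lra.
have [h h0 [h1 [ny yp yq]]] := small_ex (smallI (small_lt ltr01) (beside_small eE t01 nn)).
have yE : shift w (vec w x) h = lerp x w (1 - h) by rewrite shift_vec lerpC.
rewrite yE in ny yp yq.
have xy : sees x (lerp x w (1 - h)) by apply: sees_sub => //; lra.
have iy : inside (lerp x w (1 - h)) by apply: inside_lerp; [|left|lra].
have yx := sees_sym ny xy.
by split; apply: (sees_trans iy).
Qed.

Lemma incident_edge e t : e \in E -> t \in V -> seg e.1 e.2 t ->
  exists2 s, adj t s & forall z, seg e.1 e.2 z -> seg t s z.
Proof.
move=> eE tV te; case: (sub_vertex subH eE tV te) => ->.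
  by exists e.2; [left; rewrite -surjective_pairing|].
by exists e.1; [right; rewrite -surjective_pairing|move=> z; apply: segC].
Qed.

(** The excluded cone contains the ray of [d1] but not that of [d2], matching the half-open segment
    in [sees]: the second point may lie on an edge. *)
Lemma sector_small t d1 d2 : t \in V -> cross d1 d2 != 0 ->
  (forall s, adj t s -> forall a b : R, 0 < a -> 0 <= b ->
     vec t s <> (a * d1.1 + b * d2.1, a * d1.2 + b * d2.2)) ->
  small (fun h => sees (shift t d1 h) (shift t d2 h)).
Proof.
move=> tV cr cone.
suff sm e : e \in E -> small (fun h => forall u, 0 <= u < 1 ->
    ~ seg e.1 e.2 (lerp (shift t d1 h) (shift t d2 h) u)).
  by apply: smallW (small_all sm) => h h0 H u u01 [e eE se]; apply: (H e eE u).
move=> eE; have [te|te] := EM (seg e.1 e.2 t); last first.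
  apply: smallW (far_small d1 d2 te) => h h0 far u u01 hu.
  apply: (far (1 - u) u); try lra.
  by congr seg: hu; apply: pt_eq; rewrite /=; ring.
have [s ts sub] := incident_edge eE tV te.
apply: smallT => h h0 u /andP[u0 u1] /sub[c c01 cE].
have [E1 E2] : (1 - u) * h * d1.1 + u * h * d2.1 = c * (vec t s).1 /\
    (1 - u) * h * d1.2 + u * h * d2.2 = c * (vec t s).2.
  by split; [move: cE => /(congr1 fst)|move: cE => /(congr1 snd)]; rewrite /=; lra.
have u2 : 0 < (1 - u) * h by rewrite mulr_gt0 ?subr_gt0.
have [c0|c0] := eqVneq c 0.
  have : (1 - u) * h * cross d1 d2 =
    ((1 - u) * h * d1.1 + u * h * d2.1) * d2.2 - ((1 - u) * h * d1.2 + u * h * d2.2) * d2.1.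
    by rewrite /cross; ring.
  by move/eqP; rewrite E1 E2 c0 !mul0r subr0 mulf_eq0 (negPf cr) orbF gt_eqF.
have c1 : 0 < c by rewrite lt_neqAle eq_sym c0; case/andP: c01.
have div (a b d d' x : R) : a * d + b * d' = c * x -> x = a / c * d + b / c * d'.
  by move=> eq; rewrite !(mulrAC _ _^-1) -mulrDl eq mulrAC divff // mul1r.
apply: (cone s ts ((1 - u) * h / c) (u * h / c)); first by rewrite divr_gt0.
  by rewrite divr_ge0 ?mulr_ge0 // ltW.
by apply: pt_eq; apply: div.
Qed.

Lemma ray_small t d : t \in V -> d != (0, 0) ->
  (forall s, adj t s -> forall a : R, 0 < a -> vec t s <> (a * d.1, a * d.2)) ->
  small (fun h => ~ onH (shift t d h)).
Proof.
move=> tV d0 nd.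
suff sm e : e \in E -> small (fun h => ~ seg e.1 e.2 (shift t d h)).
  by apply: smallW (small_all sm) => h h0 H [e eE se]; apply: (H e eE).
move=> eE; have [te|te] := EM (seg e.1 e.2 t); last exact: far_ray.
have [s ts sub] := incident_edge eE tV te.
apply: smallT => h h0 /sub[c c01 cE].
have [E1 E2] : h * d.1 = c * (vec t s).1 /\ h * d.2 = c * (vec t s).2.
  by split; [move: cE => /(congr1 fst)|move: cE => /(congr1 snd)]; rewrite /=; lra.
have [c0|c0] := eqVneq c 0.
  move: E1 E2; rewrite c0 !mul0r => /eqP + /eqP; rewrite !mulf_eq0 gt_eqF //= => /eqP E1 /eqP E2.
  by move/eqP: d0; apply; apply: pt_eq.
have c1 : 0 < c by rewrite lt_neqAle eq_sym c0; case/andP: c01.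
apply: (nd s ts (h / c)); first by rewrite divr_gt0.
by apply: pt_eq; rewrite /= mulrAC ?E1 ?E2 mulrAC divff // mul1r.
Qed.

(** Facts about the graph are mostly kept in terms of the point set [onH], which splitting an edge
    does not change. This reads an edge at [t] back from the point set. *)
Lemma small_adj t d : t \in V -> d != (0, 0) -> small (fun h => onH (shift t d h)) ->
  exists s (a : R), [/\ adj t s, 0 < a & vec t s = (a * d.1, a * d.2)].
Proof.
move=> tV d0 on; apply: contrapT => nex.
have /(smallI on)/small_ex[h h0 []//] : small (fun h => ~ onH (shift t d h)).
by apply: ray_small => // s ts a a0 e; apply: nex; exists s, a.
Qed.

Lemma star_small t d : t \in V -> d != (0, 0) ->
  (forall s, adj t s -> forall a : R, 0 < a -> vec t s <> (a * d.1, a * d.2)) ->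
  small (fun h => ~ onH (shift t d h) /\ sees (shift t d h) t).
Proof.
move=> tV d0 /(ray_small tV d0)[k k0 hk]; exists k => // h /andP[h0 h1]; split.
  by apply: hk; rewrite h0.
move=> u /andP[u0 u1].
have -> : lerp (shift t d h) t u = shift t d ((1 - u) * h) by apply: pt_eq; rewrite /=; ring.
by apply: hk; apply/andP; split; [rewrite mulr_gt0 // subr_gt0 | nra].
Qed.

End Visibility.

(** * Lexicographic order of points and directions *)

Section Lex.
Variable R : realFieldType.
Notation pt := (R * R)%type.
Implicit Types (d e f p q : pt).

Definition lexpos d : bool := (0 < d.1) || (d.1 == 0) && (0 < d.2).

Lemma lexposP d : reflect (0 < d.1 \/ d.1 = 0 /\ 0 < d.2) (lexpos d).
Proof.
apply: (iffP orP) => -[h|]; try by left.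
  by case/andP => /eqP; right.
by case=> -> ->; rewrite eqxx; right.
Qed.

Lemma lexlt_vec p q : lexlt p q = lexpos (vec p q).
Proof. by rewrite /lexlt /lexpos /= !subr_gt0 subr_eq0 eq_sym. Qed.

Lemma lexltP p q : reflect (p.1 < q.1 \/ p.1 = q.1 /\ p.2 < q.2) (lexlt p q).
Proof.
rewrite lexlt_vec; apply: (iffP (lexposP _)) => /=; rewrite !subr_gt0.
  by case=> [|[h1 h2]]; [left|right; split=> //; lra].
by case=> [|[h1 h2]]; [left|right; split=> //; lra].
Qed.

Lemma lexlt_total p q : p != q -> ~~ lexlt p q -> lexlt q p.
Proof.
move=> pq /lexltP h; apply/lexltP; have [h1|h1|h1] := ltgtP q.1 p.1; first by left.
  by case: h; left.
right; split=> //; have [h2|h2|h2] := ltgtP q.2 p.2 => //; first by case: h; right.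
by case/eqP: pq; apply: pt_eq.
Qed.

Lemma lexlt_trans p q r : lexlt p q -> lexlt q r -> lexlt p r.
Proof.
move=> /lexltP h1 /lexltP h2; apply/lexltP.
by case: h1 => [h1|[h1 h3]]; case: h2 => [h2|[h2 h4]]; try (left; lra); right; split; lra.
Qed.

Lemma lexlt_irr p : ~~ lexlt p p.
Proof. by rewrite /lexlt !ltxx andbF. Qed.

Lemma lexpos_comb (a b : R) d e : lexpos d -> lexpos e -> 0 <= a -> 0 < b ->
  lexpos (a * d.1 + b * e.1, a * d.2 + b * e.2).
Proof.
move=> /lexposP hd /lexposP he a0 b0; apply/lexposP => /=.
have d1 : 0 <= d.1 by case: hd => [/ltW//|[-> _]].
have h1 := mulr_ge0 a0 d1.
case: he => [he|[he1 he2]]; first by left; have := mulr_gt0 b0 he; lra.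
have h2 := mulr_gt0 b0 he2; rewrite he1 mulr0.
case: hd => [hd|[hd1 hd2]]; last first.
  by right; rewrite hd1 mulr0; split; [lra|have := mulr_ge0 a0 (ltW hd2); lra].
have [a1|a1] := eqVneq a 0; first by right; rewrite a1; split; lra.
by left; have : 0 < a * d.1; [rewrite mulr_gt0 // lt_neqAle eq_sym a1|lra].
Qed.

(** Within the half-plane [lexpos], a positive cross product compares slopes. The identity [id]
    replaces slopes, which vertical directions lack. *)
Lemma cross_trans d e f : lexpos d -> lexpos e -> lexpos f ->
  0 < cross d e -> 0 < cross e f -> 0 < cross d f.
Proof.
move=> /lexposP hd /lexposP he /lexposP hf c1 c2.
have d1 : 0 <= d.1 by case: hd => [/ltW//|[-> _]].
have f1 : 0 <= f.1 by case: hf => [/ltW//|[-> _]].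
have id : e.1 * cross d f = d.1 * cross e f + f.1 * cross d e by rewrite /cross; ring.
have h1 := mulr_ge0 d1 (ltW c2); have h2 := mulr_ge0 f1 (ltW c1).
case: he => [e1|[e1 e2]]; last first.
  by have := mulr_ge0 f1 (ltW e2); move: c2; rewrite /cross e1; lra.
rewrite -(pmulr_rgt0 _ e1) id; have [d0|d0] := eqVneq d.1 0.
  have [f0|f0] := eqVneq f.1 0.
    case: hd => [|[_ d2]]; first by rewrite d0 ltxx.
    by have := mulr_gt0 e1 d2; move: c1; rewrite /cross d0; lra.
  by have := mulr_gt0 (_ : 0 < f.1) c1; rewrite lt_neqAle eq_sym f0 f1 => /(_ isT); lra.
by have := mulr_gt0 (_ : 0 < d.1) c2; rewrite lt_neqAle eq_sym d0 d1 => /(_ isT); lra.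
Qed.

Lemma parallel d e : d != (0, 0) -> cross d e = 0 -> exists k, e = (k * d.1, k * d.2).
Proof.
move=> d0 c; have [] := @orient0_lerp _ (0, 0) d e; first by rewrite eq_sym.
  by move: c; rewrite /orient /cross /=; lra.
by move=> k ->; exists k; apply: pt_eq; rewrite /=; ring.
Qed.

End Lex.

(** * First point of the graph on a ray *)

Section FirstHit.
Variable R : realFieldType.
Notation pt := (R * R)%type.
Implicit Types (x p q r : pt).

(** A transversal segment meets the line of the ray only once. A parallel one meets the ray in an
    interval, which starts at [p] or [q] because the beginning of the ray is free. *)
Lemma seg_first x r p q : r != (0, 0) -> small (fun h => ~ seg p q (shift x r h)) ->
  (exists2 h : R, 0 < h & seg p q (shift x r h)) ->
  exists2 h : R, 0 < h /\ seg p q (shift x r h) &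
    forall k : R, 0 < k -> seg p q (shift x r k) -> h <= k.
Proof.
move=> r0 sm [h h0 sh]; have [c|c] := eqVneq (cross r (vec p q)) 0; last first.
  exists h => // k k0 sk; suff -> : k = h by [].
  have oE u : orient p q (shift x r u) = orient p q x - u * cross r (vec p q).
    by rewrite /orient /cross /=; ring.
  have on u : seg p q (shift x r u) -> orient p q (shift x r u) = 0.
    by case=> t _ ->; rewrite orient_lerp.
  have : (k - h) * cross r (vec p q) = 0 by have := on _ sh; have := on _ sk; rewrite !oE; lra.
  by move/eqP; rewrite mulf_eq0 (negPf c) orbF subr_eq0 => /eqP.
have [k kE] := parallel r0 c.
have [t t01 tE] := sh.
have [qE1 qE2] : q.1 = p.1 + k * r.1 /\ q.2 = p.2 + k * r.2.
  by move: kE => [] h1 h2; split; lra.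
have [pE1 pE2] : p.1 = x.1 + (h - t * k) * r.1 /\ p.2 = x.2 + (h - t * k) * r.2.
  by move: tE => []; rewrite qE1 qE2 => h1 h2; split; lra.
pose a := h - t * k.
have segE u : seg p q (shift x r u) <-> exists2 s, 0 <= s <= 1 & u = a + s * k.
  split=> -[s s01 e]; exists s => //.
    have d0 := dot_gt0 r0; apply: (mulIf (lt0r_neq0 d0)).
    have e1 : u * r.1 = (a + s * k) * r.1 by move: e => [+ _]; rewrite qE1 pE1 /a; lra.
    have e2 : u * r.2 = (a + s * k) * r.2 by move: e => [_ +]; rewrite qE2 pE2 /a; lra.
    by rewrite !mulrDr !mulrA e1 e2.
  by apply: pt_eq; rewrite /= ?qE1 ?qE2 ?pE1 ?pE2 e /a; ring.
have hE : h = a + t * k by rewrite /a; ring.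
(* If the segment reached back to [x] or beyond, it would cover the ray near [x]. *)
have npos m (sm01 : 0 <= m <= 1) : 0 < a + m * k.
  rewrite ltNge; apply/negP => am.
  have [u u0 [uh []]] := small_ex (smallI (small_lt h0) sm).
  have hm : 0 < h - (a + m * k) by lra.
  pose y := (u - (a + m * k)) / (h - (a + m * k)).
  have y01 : 0 <= y <= 1 by rewrite /y divr_ge0 ?ler_pdivrMr //=; lra.
  apply/segE; exists (m + y * (t - m)); first by apply/andP; split; nra.
  have yE : y * (h - (a + m * k)) = u - (a + m * k) by rewrite mulfVK // gt_eqF.
  by move: yE; rewrite {1}hE; lra.
have [k0|k0] := leP 0 k.
  exists a; first split.
  - by have := npos 0; rewrite mul0r addr0; apply; lra.
  - by apply/segE; exists 0; [lra|ring].
  by move=> u u0 /segE[s /andP[s0 _] ->]; have := mulr_ge0 s0 k0; lra.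
exists (a + k); first split.
- by have := npos 1; rewrite mul1r; apply; lra.
- by apply/segE; exists 1; [lra|ring].
move=> u u0 /segE[s /andP[_ s1] ->].
have : 0 <= (1 - s) * (- k) by rewrite mulr_ge0 ?subr_ge0 // oppr_ge0 ltW.
lra.
Qed.

Lemma first_hit (E : seq (pt * pt)) x r : r != (0, 0) ->
  small (fun h => ~ onH E (shift x r h)) ->
  (exists2 h : R, 0 < h & onH E (shift x r h)) ->
  exists2 h : R, 0 < h /\ onH E (shift x r h) &
    forall k : R, 0 < k < h -> ~ onH E (shift x r k).
Proof.
move=> r0; elim: E => [_ [h _ []//]|e E IH sm [h h0 oh]].
have sm1 : small (fun h => ~ seg e.1 e.2 (shift x r h)).
  by apply: smallW sm => u _ h1 h2; apply: h1; exists e => //; rewrite mem_head.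
have sm2 : small (fun h => ~ onH E (shift x r h)).
  apply: smallW sm => u _ h1 [f fE h2]; apply: h1; exists f => //.
  by rewrite inE fE orbT.
have cons u : onH (e :: E) (shift x r u) <->
    seg e.1 e.2 (shift x r u) \/ onH E (shift x r u).
  split=> [[f]|[h1|[f fE h1]]].
  - by rewrite inE => /orP[/eqP->|fE h1]; [left|right; exists f].
  - by exists e => //; rewrite mem_head.
  by exists f => //; rewrite inE fE orbT.
have [[h1 h10 s1]|n1] := EM (exists2 h : R, 0 < h & seg e.1 e.2 (shift x r h)).
  have {s1 h1 h10}[h1 [h10 s1] min1] := seg_first r0 sm1 (ex_intro2 _ _ h1 h10 s1).
  have [ex2|n2] := EM (exists2 h : R, 0 < h & onH E (shift x r h)).
    have [h2 [h20 o2] min2] := IH sm2 ex2.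
    have [h12|h12] := leP h1 h2.
      exists h1; first by split=> //; apply/cons; left.
      move=> k /andP[k0 kh] /cons[/(min1 k k0)|]; first by lra.
      by apply: min2; rewrite k0 /=; lra.
    exists h2; first by split=> //; apply/cons; right.
    move=> k /andP[k0 kh] /cons[/(min1 k k0)|]; first by lra.
    by apply: min2; rewrite k0.
  exists h1; first by split=> //; apply/cons; left.
  move=> k /andP[k0 kh] /cons[/(min1 k k0)|ok]; first by lra.
  by apply: n2; exists k.
have ex2 : exists2 h : R, 0 < h & onH E (shift x r h).
  by exists h => //; case/cons: oh => // s; case: n1; exists h.
have [h2 [h20 o2] min2] := IH sm2 ex2.
exists h2; first by split=> //; apply/cons; right.
move=> k /andP[k0 kh] /cons[sk|]; first by apply: n1; exists k.
by apply: min2; rewrite k0.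
Qed.

End FirstHit.

(** * The corner of a face at its least vertex *)

Section Cells.
Variable R : realFieldType.
Notation pt := (R * R)%type.
Implicit Types (p q a b x y z w v d n s t : pt) (l m : R * R * R).
Variables (V : seq pt) (E : seq (pt * pt)).
Notation onH := (onH E).
Notation adj := (adj E).
Notation sees := (sees E).
Notation inside := (inside V).
Hypothesis subH : subdivision V E.
Hypothesis lmg : local_max_global V E.
Let endp := sub_endp subH.

Lemma adj_onHl t s : adj t s -> onH t.
Proof. by move=> ts; apply: (adj_onH ts); apply: segl. Qed.

Lemma adj_onHr t s : adj t s -> onH s.
Proof. by move=> ts; apply: (adj_onH ts); apply: segr. Qed.

Lemma hit_vertex x w : inside x -> ~ onH x -> sees x w -> onH w ->
  exists2 v, v \in V & sees x v.
Proof.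
move=> ix nx xw [e eE [t t01 wE]]; have [pV qV] := endp eE.
have [t0|t0] := eqVneq t 0; first by exists e.1 => //; rewrite -(lerp0 e.1 e.2) -t0 -wE.
have [t1|t1] := eqVneq t 1; first by exists e.2 => //; rewrite -(lerp1 e.1 e.2) -t1 -wE.
rewrite wE in xw; have [|] := hit_sees subH lmg ix eE _ nx xw; last by exists e.1.
by rewrite !lt_neqAle eq_sym t0 t1.
Qed.

(** Aim at any vertex: the first hit is a vertex, or it is interior to an edge whose ends are then
    visible. *)
Lemma sees_vertex x : inside x -> ~ onH x -> exists2 v, v \in V & sees x v.
Proof.
move=> ix nx; have [|v vV _] := ix (1, 0, 0) (0, 1, 0).
  by rewrite /cross /=; apply/eqP; lra.
have [xv|xv] := EM (sees x v); first by exists v.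
have [xE|xv'] := eqVneq x v.
  by case: xv => u u01; rewrite xE (_ : lerp v v u = x) //; apply: pt_eq; rewrite xE /=; ring.
have [h [h0 oh] hmin] : exists2 h : R, 0 < h /\ onH (shift x (vec x v) h) &
    forall k : R, 0 < k < h -> ~ onH (shift x (vec x v) k).
  apply: first_hit; first exact: vec_neq0.
    have sm e : e \in E -> small (fun h => ~ seg e.1 e.2 (shift x (vec x v) h)).
      by move=> eE; apply: far_ray => se; apply: nx; exists e.
    by apply: smallW (small_all sm) => h h0 H [e eE se]; apply: (H e eE).
  apply: contrapT => nex; apply: xv => u /andP[u0 u1] ou.
  have [uE|un] := eqVneq u 0; first by apply: nx; rewrite uE lerp0 in ou.
  by apply: nex; exists u; rewrite // lt_neqAle eq_sym un.
apply: (hit_vertex ix nx _ oh) => u /andP[u0 u1].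
rewrite shift_vec lerp_lerp -shift_vec; have [->|un] := eqVneq u 0.
  by rewrite mulr0 shift_vec lerp0.
apply: hmin; have up : 0 < u by rewrite lt_neqAle eq_sym un.
by rewrite mulr_gt0 //= gtr_pMr.
Qed.

Definition empty_cone t d d' : Prop := forall s, adj t s ->
  forall a b : R, 0 < a -> 0 <= b -> vec t s <> (a * d.1 + b * d'.1, a * d.2 + b * d'.2).

(** An edge at [t] in the direction of [x] would pass through [x] or end between [t] and [x]. *)
Lemma sees_vertex_dir x t s (a : R) : ~ onH x -> sees x t -> adj t s -> 0 < a ->
  vec t s <> (a * (vec t x).1, a * (vec t x).2).
Proof.
move=> nx xt ts a0 e.
have [e1 e2] : s.1 = t.1 + a * (x.1 - t.1) /\ s.2 = t.2 + a * (x.2 - t.2).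
  by move: e => [] /= h1 h2; split; lra.
have an : a != 0 by rewrite gt_eqF.
have [a1|a1] := leP 1 a.
  apply: nx; apply: (adj_onH ts); exists a^-1.
    by rewrite invr_ge0 (ltW a0) /= invf_le1.
  by apply: pt_eq; rewrite /= ?e1 ?e2; field.
apply: (xt (1 - a)); first lra.
suff -> : lerp x t (1 - a) = s by apply: adj_onHr ts.
by apply: pt_eq; rewrite /= ?e1 ?e2; ring.
Qed.

(* [k = 1] and [k = -1] give the first edges at [t] met when turning left and right from the
   direction of [x]; had one of them a lexicographically smaller end, [x] would see it. *)
Lemma leftmost_corner x t (k : R) : k * k = 1 -> inside x -> ~ onH x -> t \in V ->
  sees x t -> (forall v, v \in V -> sees x v -> ~~ lexlt v t) ->
  exists s, [/\ adj t s, 0 < k * cross (vec t x) (vec t s), lexlt t s &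
    empty_cone t (vec t x) (vec t s)].
Proof.
move=> kk ix nx tV xt tmin; set d := vec t x.
have tx : t != x by apply/eqP => e; apply: nx; rewrite -e; apply: sub_onH subH _ tV.
have dpos := dot_gt0 (vec_neq0 tx); rewrite -/d in dpos.
(* Up to scaling, the components of [v - t] across and along [d]. In the order by [c] and then [g],
   the point [x] is above [t]. *)
pose c v := k * cross d (vec t v); pose g v := d.1 * (v.1 - t.1) + d.2 * (v.2 - t.2).
pose l := dotl (- k * d.2, k * d.1) t; pose m := dotl d t.
have lE v : aff l v = c v by rewrite aff_dotl /c /cross /=; ring.
have mE v : aff m v = g v by rewrite aff_dotl.
have indep : cross l.1 m.1 != 0.
  have -> : cross l.1 m.1 = - k * (d.1 * d.1 + d.2 * d.2) by rewrite /cross /=; ring.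
  rewrite mulNr oppr_eq0; apply: mulf_neq0; last by rewrite gt_eqF.
  by apply/eqP => k0; move: kk; rewrite k0; lra.
have ct : c t = 0 by rewrite /c /cross /=; ring.
have gt : g t = 0 by rewrite /g; ring.
have ndir s (a : R) : adj t s -> 0 < a -> vec t s <> (a * d.1, a * d.2).
  by move=> ts a0; apply: sees_vertex_dir nx xt ts a0.
(* As [x] is above [t] and some vertex is above [x], the vertex [t] is no global maximum and has a
   higher neighbour. That neighbour is not in the direction of [x], so it lies strictly on the
   wanted side. *)
have [s0 ts0 cs0] : exists2 s, adj t s & 0 < c s.
  have [[s [ts lt]]|nx'] := EM (exists s, adj t s /\ ltlex l m t s).
    exists s => //; case: lt; rewrite !lE ct // !mE gt => -[c0 g0]; exfalso.
    have [|j sE] := @parallel _ d (vec t s) (vec_neq0 tx).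
      move/esym/eqP: c0; rewrite /c mulf_eq0 => /orP[/eqP k0|/eqP//].
      by move: kk; rewrite k0; lra.
    apply: (ndir s j ts _ sE); rewrite -(pmulr_lgt0 _ dpos).
    by move: sE g0 => []; rewrite /g /= => -> ->; lra.
  have glob := lmg indep tV (fun w tw lt => nx' (ex_intro _ w (conj tw lt))).
  have [v vV xv] := ix l m indep.
  case: (glob v vV); apply: ltlex_trans xv; right; rewrite !lE !mE ct gt; split=> //.
  by rewrite /c -/d /cross; ring.
(* The cotangent of the angle from [d]; the largest one belongs to the edge met first. *)
pose r s := g s / c s.
have [s [sV [ts cs] smax]] := @exists_extremal _ V (fun s => adj t s /\ 0 < c s)
  (fun a b => r a < r b) (fun _ _ _ _ _ _ h1 h2 => lt_trans h1 h2)
  (fun a _ => elimF idP (ltxx (r a))) (ex_intro2 _ _ s0 (adjV endp ts0) (conj ts0 cs0)).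
have cone : empty_cone t d (vec t s).
  move=> s' ts' a b a0 b0 e.
  have [e1 e2] : s'.1 - t.1 = a * d.1 + b * (s.1 - t.1) /\ s'.2 - t.2 = a * d.2 + b * (s.2 - t.2).
    by move: e => [].
  have [bE|bn] := eqVneq b 0; first by apply: (ndir s' a ts' a0); rewrite e bE !mul0r !addr0.
  have bp : 0 < b by rewrite lt_neqAle eq_sym bn.
  have c' : c s' = b * c s by rewrite /c e /cross; cbn [fst snd]; ring.
  have g' : g s' = a * (d.1 * d.1 + d.2 * d.2) + b * g s by rewrite /g e1 e2; ring.
  apply: (smax s' (adjV endp ts')); first by split=> //; rewrite c' mulr_gt0.
  have csn : c s != 0 by rewrite gt_eqF.
  have -> : r s' = r s + a * (d.1 * d.1 + d.2 * d.2) / (b * c s).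
    by rewrite /r c' g'; field; rewrite bn csn.
  by rewrite ltrDl; apply: divr_gt0; apply: mulr_gt0.
exists s; split=> //; apply: contrapT => /negP nlt.
have st : s != t by apply/eqP => e; move: cs; rewrite e ct ltxx.
have {nlt} lst : lexlt s t by apply: lexlt_total nlt; rewrite eq_sym.
have crn : cross d (vec t s) != 0.
  by apply/eqP => e; move: cs; rewrite /c e mulr0 ltxx.
(* A point near [t] towards [x] sees a point in the relative interior of the edge [t s], hence by
   [hit_sees] the end [s]; then [x] sees [s], although [s] precedes [t]. *)
have [h h0 [h1 yw]] := small_ex (smallI (small_lt ltr01) (sector_small subH tV crn cone)).
have yE : shift t d h = lerp x t (1 - h) by rewrite shift_vec lerpC.
have ny : ~ onH (lerp x t (1 - h)) by apply: xt; lra.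
have xy : sees x (lerp x t (1 - h)) by apply: sees_sub => //; lra.
have iy : inside (lerp x t (1 - h)).
  by apply: (inside_lerp subH); [|left; apply: adj_onHl ts|lra].
rewrite yE shift_vec in yw.
suff ys : sees (lerp x t (1 - h)) s.
  have xs := sees_trans subH lmg iy nx (sees_sym ny xy) ys.
  by move: (tmin s (adjV endp ts) xs); rewrite lst.
case: ts yw => ts yw.
  by have [] := hit_sees subH lmg iy ts _ ny yw; first lra.
rewrite (lerpC t s) in yw.
by have [] := hit_sees subH lmg iy ts _ ny yw; first lra.
Qed.

End Cells.

(** * Number of pairwise separated points *)

Section CellBound.
Variable R : realType.
Notation pt := (R * R)%type.
Implicit Types (p q a b x y z w v d n s t : pt).
Variables (V : seq pt) (E : seq (pt * pt)).
Notation onH := (onH E).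
Notation adj := (adj E).
Notation sees := (sees E).
Notation inside := (inside V).
Hypothesis subH : subdivision V E.
Hypothesis lmg : local_max_global V E.
Let endp := sub_endp subH.

Lemma ltlex_coord p q : ltlex (1, 0, 0) (0, 1, 0) p q <-> lexlt p q.
Proof.
have xE r : aff (1, 0, 0) r = r.1 by rewrite /aff /lin /=; ring.
have yE r : aff (0, 1, 0) r = r.2 by rewrite /aff /lin /=; ring.
by rewrite /ltlex !xE !yE; split=> /lexltP.
Qed.

Lemma ltlex_coordN p q : ltlex (-1, 0, 0) (0, -1, 0) p q <-> lexlt q p.
Proof.
have xE r : aff (-1, 0, 0) r = - r.1 by rewrite /aff /lin /=; ring.
have yE r : aff (0, -1, 0) r = - r.2 by rewrite /aff /lin /=; ring.
rewrite /ltlex !xE !yE !ltrN2; split=> [|/lexltP].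
  by case=> [h|[/oppr_inj e h]]; apply/lexltP; [left|right].
by case=> [h|[-> h]]; [left|right].
Qed.

Lemma out_edge_lex t q : (t, q) \in E -> lexpos (vec t q).
Proof. by move=> /(sub_lex subH); rewrite lexlt_vec. Qed.

Lemma adj_out t s : adj t s -> lexlt t s -> (t, s) \in E.
Proof.
case=> // /(sub_lex subH) /= st ts; have := lexlt_irr t.
by rewrite (lexlt_trans ts st).
Qed.

Lemma exists_lexmin_vertex x : inside x -> ~ onH x ->
  exists t, [/\ t \in V, sees x t & forall v, v \in V -> sees x v -> ~~ lexlt v t].
Proof.
move=> ix nx; have [v0 v0V xv0] := sees_vertex subH lmg ix nx.
have [t [tV xt tmin]] := @exists_extremal _ V (fun v => sees x v) (fun a b => lexlt b a)
  (fun a b c _ _ _ h1 h2 => lexlt_trans h2 h1)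
  (fun a _ h => negP (lexlt_irr a) h) (ex_intro2 _ _ v0 v0V xv0).
by exists t; split=> // v vV xv; apply/negP; apply: tmin.
Qed.

(** The edge bounding the face of [x] from above at its least vertex. The last clause, a lower edge
    leaving the same vertex, ensures that it is not the lowest one there. *)
Definition upper_edge x (e : pt * pt) : Prop :=
  [/\ e \in E, sees x e.1, 0 < cross (vec e.1 x) (vec e.1 e.2),
    empty_cone E e.1 (vec e.1 x) (vec e.1 e.2) &
    exists2 q, (e.1, q) \in E & 0 < cross (vec e.1 q) (vec e.1 e.2)].

Lemma exists_upper_edge x : inside x -> ~ onH x -> exists e, upper_edge x e.
Proof.
move=> ix nx; have [t [tV xt tmin]] := exists_lexmin_vertex ix nx.
have [|s [ts cs lts cone]] := leftmost_corner (k := 1) subH lmg _ ix nx tV xt tmin.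
  by rewrite mulr1.
have [|q [tq cq ltq coneq]] := leftmost_corner (k := -1) subH lmg _ ix nx tV xt tmin.
  by rewrite mulrNN mulr1.
rewrite mul1r in cs; rewrite mulN1r oppr_gt0 in cq.
exists (t, s); split=> //=; first exact: adj_out.
exists q; first exact: adj_out.
rewrite lexlt_vec in lts; rewrite lexlt_vec in ltq.
have cqd : 0 < cross (vec t q) (vec t x) by move: cq; rewrite /cross; lra.
(* It remains to place [x] after [t], so that its direction lies in the half-plane of [s] and
   [q]. *)
apply: (cross_trans ltq _ lts cqd cs); rewrite -lexlt_vec; apply: contrapT => /negP nlt.
have tx : t != x by apply/eqP => e; apply: nx; rewrite -e; apply: sub_onH subH _ tV.
have xt' := lexlt_total tx nlt.
(* If [x] preceded [t], then by [lmg] in the reversed order so would a neighbour [e] of [t]. In the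
   basis of [vec t x] and the edge to [s] or [q] on the side of [e], the edge to [e] lies in an
   empty cone or contradicts the order. *)
have [[e [te le]]|nle] := EM (exists e, adj t e /\ lexlt e t); last first.
  have cr : cross ((-1, 0, 0) : R * R * R).1 ((0, -1, 0) : R * R * R).1 != 0.
    by rewrite /cross /=; apply/eqP; lra.
  have [v vV /ltlex_coordN vx] := ix _ _ cr.
  apply: (lmg cr tV _ vV); last by apply/ltlex_coordN; apply: lexlt_trans vx xt'.
  by move=> w tw /ltlex_coordN lw; apply: nle; exists w.
have contra (u : pt) : adj t u -> lexpos (vec t u) -> 
    cross (vec t x) (vec t e) * cross (vec t x) (vec t u) > 0 ->
    empty_cone E t (vec t x) (vec t u) -> False.
  move=> tu lu cc co; set cu := cross (vec t x) (vec t u) in cc.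
  have cun : cu != 0 by apply/eqP => h; rewrite h mulr0 ltxx in cc.
  have cu2 : 0 < cu * cu by rewrite -expr2 exprn_even_gt0.
  pose b := cross (vec t x) (vec t e) / cu; pose a := cross (vec t e) (vec t u) / cu.
  have b0 : 0 < b.
    have -> : b = cross (vec t x) (vec t e) * cu / (cu * cu) by rewrite /b; field.
    exact: divr_gt0.
  have eE : vec t e = (a * (vec t x).1 + b * (vec t u).1, a * (vec t x).2 + b * (vec t u).2).
    by rewrite /a /b /cu; move: cun; rewrite /cu /cross => cun; apply: pt_eq => /=; field; exact: cun.
  have [a0|a0] := ltP 0 a; first by apply: (co e te a b a0 (ltW b0) eE).
  have := lexpos_comb (a := - a) (b := 1) (d := vec x t) (e := vec e t).
  rewrite -!lexlt_vec => /(_ xt' le _ ltr01); rewrite oppr_ge0 => /(_ a0) h.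
  move: eE => [] /= e1 e2.
  by case/lexposP: (lexpos_comb h lu ler01 b0) => /= [|[_]]; lra.
have [h|h|h] := ltgtP (cross (vec t x) (vec t e)) 0.
- by apply: (contra q) => //; rewrite nmulr_rgt0.
- by apply: (contra s) => //; rewrite pmulr_rgt0.
have [k kE] := parallel (vec_neq0 tx) h.
have [k0|k0] := ltP 0 k; first exact: sees_vertex_dir nx xt te k0 kE.
have := lexpos_comb (a := - k) (b := 1) (d := vec x t) (e := vec e t).
rewrite -!lexlt_vec => /(_ xt' le _ ltr01); rewrite oppr_ge0 => /(_ k0) /lexposP /= h'.
by move: kE => [] /= e1 e2; case: h' => [|[_]]; lra.
Qed.

(** The cones of [x] and [y] both extend to the common edge, so there is no edge between the
    directions of [x] and [y]. Near the vertex [sector_small] joins the two faces, and transitivity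
    does the rest. *)
Lemma upper_edge_sees x y e : inside x -> inside y -> ~ onH x -> ~ onH y ->
  upper_edge x e -> upper_edge y e -> sees x y.
Proof.
wlog cxy : x y / 0 <= cross (vec e.1 x) (vec e.1 y).
  move=> W ix iy nx ny ux uy; have [c|c] := leP 0 (cross (vec e.1 x) (vec e.1 y)).
    exact: W.
  apply: sees_sym => //; apply: W => //; move: c; rewrite /cross; lra.
move=> ix iy nx ny [eE xt cx conex _] [_ yt cy coney _].
set t := e.1 in xt cx conex yt cy coney cxy; set s := e.2 in cx conex cy coney.
have tV : t \in V by have [] := endp eE.
have ts : adj t s by left; rewrite -surjective_pairing.
have ot : onH t := adj_onHl ts.
have tx : t != x by apply/eqP => h; apply: nx; rewrite -h.
have [c0|cn] := eqVneq (cross (vec t x) (vec t y)) 0.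
  have [k kE] := parallel (vec_neq0 tx) c0.
  have k0 : 0 < k.
    move: cy; rewrite kE (_ : cross _ _ = k * cross (vec t x) (vec t s)); last first.
      by rewrite /cross /=; ring.
    by rewrite pmulr_lgt0.
  have [y1 y2] : y.1 = t.1 + k * (x.1 - t.1) /\ y.2 = t.2 + k * (x.2 - t.2).
    by move: kE => [] /= h1 h2; split; lra.
  have kn : k != 0 by rewrite gt_eqF.
  have [k1|k1] := leP k 1.
    have -> : y = lerp x t (1 - k) by apply: pt_eq; rewrite /= ?y1 ?y2; ring.
    by apply: sees_sub => //; lra.
  have xE : x = lerp y t (1 - k^-1) by apply: pt_eq; rewrite /= ?y1 ?y2; field.
  apply: sees_sym => //; rewrite {1}xE; apply: sees_sub => //.
  have : 0 < k^-1 by rewrite invr_gt0.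
  have : k^-1 < 1 by rewrite invf_lt1.
  lra.
have cp : 0 < cross (vec t x) (vec t y) by rewrite lt_neqAle eq_sym cn.
have cone : empty_cone E t (vec t x) (vec t y).
  move=> u tu a b a0 b0 uE.
  set cs := cross (vec t x) (vec t s) in cx; have csn : cs != 0 by rewrite gt_eqF.
  apply: (conex u tu (a + b * (cross (vec t y) (vec t s) / cs))
    (b * (cross (vec t x) (vec t y) / cs))).
  - by rewrite ltr_wpDr // mulr_ge0 // divr_ge0 // ltW.
  - by rewrite mulr_ge0 // divr_ge0 // ltW.
  rewrite uE /cs; move: csn; rewrite /cs /cross => csn.
  by apply: pt_eq => /=; field; exact: csn.
have [h h0 [h1 hs]] := small_ex (smallI (small_lt ltr01) (sector_small subH tV cn cone)).
have h01 : 0 <= 1 - h < 1 by lra.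
rewrite !shift_vec lerpC (lerpC t y) in hs.
have xs := sees_sub (ltac:(lra) : 0 <= 1 - h <= 1) xt.
have ys := sees_sub (ltac:(lra) : 0 <= 1 - h <= 1) yt.
set x' := lerp x t (1 - h) in hs xs; set y' := lerp y t (1 - h) in hs ys.
have nx' : ~ onH x' by apply: xt.
have ny' : ~ onH y' by apply: yt.
have ix' : inside x' by apply: (inside_lerp subH) => //; left.
have iy' : inside y' by apply: (inside_lerp subH) => //; left.
have xy' : sees x y' by apply: (sees_trans subH lmg ix') => //; apply: sees_sym.
by apply: (sees_trans subH lmg iy') => //; apply: sees_sym.
Qed.

Lemma lowest_out_edge t q0 : (t, q0) \in E ->
  exists2 q, (t, q) \in E & forall q', (t, q') \in E -> ~ 0 < cross (vec t q') (vec t q).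
Proof.
move=> q0E; have irr (a : pt) : ~ 0 < cross (vec t a) (vec t a).
  by rewrite /cross mulrC subrr ltxx.
have [q [qV qE qmin]] := @exists_extremal _ V (fun q => (t, q) \in E)
  (fun a b => 0 < cross (vec t b) (vec t a))
  (fun a b c ha hb hc h1 h2 => cross_trans (out_edge_lex hc) (out_edge_lex hb)
     (out_edge_lex ha) h2 h1)
  (fun a _ => @irr a)
  (ex_intro2 _ _ q0 (proj2 (endp q0E)) q0E).
by exists q => // q' q'E; apply: qmin (q'E); have [] := endp q'E.
Qed.

(* The points of [X] are charged to distinct edges, none of them the lowest edge leaving a vertex
   to the right, and all vertices but the last have such an edge. *)
Lemma cell_bound (X : seq pt) : uniq V -> uniq X ->
  (forall x, x \in X -> inside x /\ ~ onH x) ->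
  (forall x y, x \in X -> y \in X -> x != y -> ~ sees x y) ->
  (size X + size V <= size E + 1)%N.
Proof.
move=> uV uX Xin Xsep.
have [f fP] : {f : pt -> pt * pt & forall x, x \in X -> upper_edge x (f x)}.
  apply: (@choice pt (pt * pt) (fun x e => x \in X -> upper_edge x e)) => x.
  have [xX|nX] := boolP (x \in X); last by exists (x, x).
  have [ix nx] := Xin x xX; have [e eP] := exists_upper_edge ix nx.
  by exists e.
pose low t q := (t, q) \in E /\ forall q', (t, q') \in E -> ~ 0 < cross (vec t q') (vec t q).
have [g gP] : {g : pt -> pt & forall t, has (fun e => e.1 == t) E -> low t (g t)}.
  apply: (@choice pt pt (fun t q => has (fun e : pt * pt => e.1 == t) E -> low t q)) => t.
  have [/hasP[[t' q] tq /eqP/= tE]|h] := boolP (has (fun e : pt * pt => e.1 == t) E); last first.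
    by exists t.
  rewrite tE in tq; have [q' q'E qmin] := lowest_out_edge tq.
  by exists q'.
pose W := [seq t <- V | has (fun e => e.1 == t) E].
have sW : (size V <= size W + 1)%N.
  rewrite size_filter -(count_predC (fun t => has (fun e : pt * pt => e.1 == t) E)) leq_add2l.
  rewrite -size_filter; set Z := filter _ _.
  have uZ : uniq Z by apply: filter_uniq.
  have Zmax t : t \in Z -> t \in V /\ forall w, w \in V -> ~~ lexlt t w.
    rewrite mem_filter /= => /andP[nt tV]; split=> // w wV; apply/negP => tw.
    have cr : cross ((1, 0, 0) : R * R * R).1 ((0, 1, 0) : R * R * R).1 != 0.
      by rewrite /cross /=; apply/eqP; lra.
    apply: (lmg cr tV _ wV); last exact/ltlex_coord.
    move=> u tu /ltlex_coord ltu; case/negP: nt; apply/hasP.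
    by exists (t, u) => //=; apply: adj_out.
  (* Two vertices without an outgoing edge would both be last in the order. *)
  case: Z uZ Zmax => [|a [|b Z]] //= /andP[]; rewrite inE negb_or => /andP[ab _] _ Zmax.
  have [aV amax] := Zmax a (mem_head _ _).
  have [|bV bmax] := Zmax b; first by rewrite !inE eqxx orbT.
  by case/negP: (bmax a aV); apply: lexlt_total ab (amax b bV).
suff : (size (map f X ++ map (fun t => (t, g t)) W) <= size E)%N.
  rewrite size_cat !size_map => h; apply: leq_trans (_ : size X + (size W + 1) <= _)%N.
    by rewrite leq_add2l.
  by rewrite addnA leq_add2r.
apply: uniq_leq_size; last first.
  move=> e; rewrite mem_cat => /orP[/mapP[x xX ->]|/mapP[t]]; first by have [] := fP x xX.
  by rewrite mem_filter => /andP[/gP[tE _] _] ->.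
rewrite cat_uniq; apply/and3P; split.
- rewrite map_inj_in_uniq // => x y xX yX fxy; apply/eqP; apply: contrapT => /negP xy.
  have [ix nx] := Xin x xX; have [iy ny] := Xin y yX.
  apply: (Xsep x y xX yX xy); apply: upper_edge_sees (fP x xX) _ => //.
  by rewrite fxy; apply: fP.
- apply/hasPn => e /mapP[t]; rewrite mem_filter => /andP[/gP[tE gmin] _] ->.
  apply/negP => /mapP[x xX fx]; have [_ _ _ _] := fP x xX; rewrite -fx /= => -[q qE].
  exact: gmin qE.
rewrite map_inj_in_uniq ?filter_uniq // => t t' _ _.
by case.
Qed.

End CellBound.

(** * Extending edges until all faces are convex *)

Section Refine.
Variable R : realFieldType.

(** On an edge split at parameter [s], the first part has parameters [s * a] and the second
    [s + b * (1 - s)]; they share only the splitting point. *)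
Lemma subinterval_meet (s a b : R) : 0 < s < 1 -> 0 <= a <= 1 -> 0 <= b <= 1 ->
  s * a = s + b * (1 - s) -> b = 0.
Proof.
move=> s01 a01 b01 e; have h1 : 0 <= s * (1 - a) by apply: mulr_ge0; lra.
have h2 : b * (1 - s) = 0.
  by apply/eqP; rewrite eq_le (_ : b * (1 - s) <= 0) ?mulr_ge0 //; lra.
by move/eqP: h2; rewrite mulf_eq0 => /orP[/eqP//|/eqP]; lra.
Qed.

Lemma subinterval_lt1 (s a : R) : 0 < s < 1 -> 0 <= a <= 1 -> 1 = s * a -> False.
Proof. move=> s01 a01; have : 0 <= s * (1 - a) by (apply: mulr_ge0; lra). lra. Qed.

Lemma subinterval_gt0 (s a : R) : 0 < s < 1 -> 0 <= a <= 1 -> 0 = s + a * (1 - s) -> False.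
Proof. move=> s01 a01; have : 0 <= a * (1 - s) by (apply: mulr_ge0; lra). lra. Qed.

Notation pt := (R * R)%type.
Implicit Types (p q x z w v d r t u : pt) (E : seq (pt * pt)) (V : seq pt).

(** The graph continues from [v] in two opposite directions, so no angle at [v] exceeds a half-turn.
    In terms of [onH] this persists when edges are split or added. *)
Definition straight E v : Prop := exists d, [/\ d != (0, 0),
  small (fun h => onH E (shift v d h)) & small (fun h => onH E (shift v (- d.1, - d.2) h))].

Lemma straight_mono E E' v : (forall z, onH E z -> onH E' z) -> straight E v -> straight E' v.
Proof.
by move=> h [d [d0 s1 s2]]; exists d; split=> //; [move: s1|move: s2];
  apply: smallW => k _; apply: h.
Qed.

Lemma lerp_inj p q (a b : R) : p != q -> lerp p q a = lerp p q b -> a = b.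
Proof.
move=> /dist_gt0 d0 [] h1 h2; apply: (mulIf (lt0r_neq0 d0)).
have e1 : a * (q.1 - p.1) = b * (q.1 - p.1) by lra.
have e2 : a * (q.2 - p.2) = b * (q.2 - p.2) by lra.
by rewrite !mulrDr !mulrA e1 e2.
Qed.

Lemma lexlt_lerp p q (s : R) : lexlt p q -> 0 < s < 1 ->
  lexlt p (lerp p q s) /\ lexlt (lerp p q s) q.
Proof.
move=> /lexltP h s01; have [s0 s1] := andP s01; have s2 : 0 < 1 - s by lra.
case: h => [h|[h1 h2]].
  have e := mulr_gt0 s0 (_ : 0 < q.1 - p.1); have e' := mulr_gt0 s2 (_ : 0 < q.1 - p.1).
  have h' : 0 < q.1 - p.1 by lra.
  move: (e h') (e' h') => f f'.
  by split; apply/lexltP; left => /=; lra.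
have e := mulr_gt0 s0 (_ : 0 < q.2 - p.2); have e' := mulr_gt0 s2 (_ : 0 < q.2 - p.2).
have h' : 0 < q.2 - p.2 by lra.
move: (e h') (e' h') => f f'.
by split; apply/lexltP; right; rewrite /= h1; split; lra.
Qed.

Lemma onH_cat e E z : onH (e :: E) z <-> seg e.1 e.2 z \/ onH E z.
Proof.
split=> [[f]|[h|[f fE h]]].
- by rewrite inE => /orP[/eqP->|fE h]; [left|right; exists f].
- by exists e => //; rewrite mem_head.
by exists f => //; rewrite inE fE orbT.
Qed.

Lemma lerp_midr p q (s u : R) : lerp (lerp p q s) q u = lerp p q (s + u * (1 - s)).
Proof. by apply: pt_eq; rewrite /=; ring. Qed.

Definition sort_pair v t : pt * pt := if lexlt v t then (v, t) else (t, v).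

Lemma seg_sort_pair v t z : seg (sort_pair v t).1 (sort_pair v t).2 z <-> seg v t z.
Proof. by rewrite /sort_pair; case: ifP => _ /=; split=> // /segC. Qed.

Lemma add_edge V E v t : subdivision V E -> v \in V -> t \in V -> v != t ->
  (forall k : R, 0 < k < 1 -> ~ onH E (lerp v t k)) ->
  subdivision V (sort_pair v t :: E).
Proof.
move=> sH vV tV vt free; set e := sort_pair v t.
have ends z : onH E z -> seg e.1 e.2 z -> z = v \/ z = t.
  move=> oz /seg_sort_pair[k k01 zE].
  have [k0|k0] := eqVneq k 0; first by left; rewrite zE k0 lerp0.
  have [k1|k1] := eqVneq k 1; first by right; rewrite zE k1 lerp1.
  by case: (free k); rewrite -?zE // !lt_neqAle eq_sym k0 k1.
have eV : e.1 \in V /\ e.2 \in V by rewrite /e /sort_pair; case: ifP.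
split.
- by move=> f; rewrite inE => /orP[/eqP->|/(sub_endp sH)].
- move=> f; rewrite inE => /orP[/eqP->|/(sub_lex sH)//].
  rewrite /e /sort_pair; case: ifP => // /negbT nl.
  exact: lexlt_total nl.
- move=> f u; rewrite inE => /orP[/eqP->|fE] uV; last exact: sub_vertex sH _ _ fE uV.
  move=> /ends; move=> /(_ (sub_onH sH uV)).
  by rewrite /e /sort_pair; case: ifP => _ /= [->|->]; [left|right|right|left].
- move=> f g z; rewrite !inE => /orP[/eqP->|fE] /orP[/eqP->|gE] // fg.
  + by rewrite eqxx in fg.
  + by move=> ez gz; have [] := ends z (ex_intro2 _ _ g gE gz) ez => ->.
  + by move=> fz ez; have [] := ends z (ex_intro2 _ _ f fE fz) ez => ->.
  exact: sub_meet sH _ _ _ fE gE fg.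
by move=> u /(sub_onH sH) ou; apply/onH_cat; right.
Qed.

(** The last clause records that old vertices get no new edge directions, which later limits where
    samples around them must be taken. *)
Lemma split_edge V E t : subdivision V E -> onH E t -> t \notin V -> exists E',
  [/\ subdivision (t :: V) E', forall z, onH E z <-> onH E' z, (size E' <= size E + 1)%N,
      straight E t &
      forall u s, u \in V -> adj E' u s -> exists2 s0, adj E u s0 & cross (vec u s0) (vec u s) = 0].
Proof.
move=> sH [[p q] eE /= [s s01 tE]] tV.
have [pV qV] := sub_endp sH eE; rewrite /= in pV qV.
have lpq := sub_lex sH eE; rewrite /= in lpq.
have pq := lexlt_neq lpq.
have s0 : s != 0 by apply: contraNneq tV => s0; rewrite tE s0 lerp0.
have s1 : s != 1 by apply: contraNneq tV => s1; rewrite tE s1 lerp1.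
have {s0 s1}s01 : 0 < s < 1 by rewrite !lt_neqAle eq_sym s0 s1.
have [lpt ltq] := lexlt_lerp lpq s01; rewrite -tE in lpt ltq.
have tpq : seg p q t by rewrite tE; apply: seg_lerp; lra.
pose F := [seq f <- E | f != (p, q)].
have subF f : f \in F -> f \in E /\ (p, q) != f.
  by rewrite mem_filter => /andP[fpq ->]; rewrite eq_sym.
pose E' := (p, t) :: (t, q) :: F.
have iff z : onH E z <-> onH E' z.
  split=> [[f fE fz]|/onH_cat[/= h|/onH_cat[/= h|[f /subF[fE _] fz]]]].
  - have [fe|fe] := eqVneq f (p, q); last first.
      by apply/onH_cat; right; apply/onH_cat; right; exists f; rewrite // mem_filter fe.
    move: fz; rewrite fe /= => -[k k01 zE].
    have [ks|ks] := leP k s.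
      apply/onH_cat; left => /=; exists (k / s); first by rewrite divr_ge0 ?ler_pdivrMr; lra.
      by rewrite zE tE lerp_lerp mulrC divfK //; apply/eqP; lra.
    apply/onH_cat; right; apply/onH_cat; left => /=.
    have d0 : 0 < 1 - s by lra.
    exists ((k - s) / (1 - s)); first by rewrite divr_ge0 ?ler_pdivrMr; lra.
    by rewrite zE tE lerp_midr; congr lerp; field; rewrite gt_eqF.
  - by exists (p, q) => //=; apply: seg_sub tpq h; apply: segl.
  - by exists (p, q) => //=; apply: seg_sub tpq _ h; apply: segr.
  by exists f.
have subs f z : f = (p, t) \/ f = (t, q) -> seg f.1 f.2 z -> seg p q z.
  by case=> -> /= h; [apply: seg_sub tpq h; apply: segl|apply: seg_sub tpq _ h; apply: segr].
have pt_tq z : seg p t z -> seg t q z -> z = t.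
  move=> [a a01 zE] [b b01]; rewrite zE tE lerp_lerp lerp_midr.
  move=> /(lerp_inj pq) h.
  by rewrite h (subinterval_meet s01 a01 b01 h) mul0r addr0.
have nqpt : ~ seg p t q.
  move=> [a a01]; rewrite tE lerp_lerp -{1}(lerp1 p q) => /(lerp_inj pq).
  exact: subinterval_lt1.
have nptq : ~ seg t q p.
  move=> [a a01]; rewrite tE lerp_midr -{1}(lerp0 p q) => /(lerp_inj pq).
  exact: subinterval_gt0.
exists E'; split=> //.
- split.
  + move=> f; rewrite !inE => /or3P[/eqP->|/eqP->|/subF[/(sub_endp sH)[h1 h2] _]] /=;
      by rewrite ?eqxx ?pV ?qV ?h1 ?h2 ?orbT.
  + by move=> f; rewrite !inE => /or3P[/eqP->|/eqP->|/subF[/(sub_lex sH)]].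
  + move=> f u fE'; rewrite inE => /orP[/eqP-> | uV].
      move: fE'; rewrite !inE => /or3P[/eqP->|/eqP->|/subF[fE nf] ft] /=; [by right|by left|].
      by case/negP: tV; apply: sub_meet sH _ _ _ eE fE nf tpq ft.
    move: fE'; rewrite !inE => /or3P[/eqP->|/eqP->|/subF[fE nf] fu] /=.
    - move=> h; have [] := sub_vertex sH eE uV (seg_sub (segl p q) tpq h); first by left.
      by move=> /= uq; case: nqpt; rewrite -uq.
    - move=> h; have [] := sub_vertex sH eE uV (seg_sub tpq (segr p q) h); last by right.
      by move=> /= up; case: nptq; rewrite -up.
    exact: sub_vertex sH _ _ fE uV fu.
  + have old f g z : f = (p, t) \/ f = (t, q) -> g \in F -> seg f.1 f.2 z -> seg g.1 g.2 z ->
        z \in t :: V.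
      move=> hf /subF[gE ng] fz gz; rewrite inE; apply/orP; right.
      by apply: sub_meet sH _ _ _ eE gE ng _ gz; apply: subs fz.
    move=> f g z; rewrite !inE => /or3P[/eqP->|/eqP->|fF] /or3P[/eqP->|/eqP->|gF] fg.
    * by rewrite eqxx in fg.
    * by move=> /= h1 h2; rewrite (pt_tq z h1 h2) eqxx.
    * by move=> fz gz; have := old (p, t) g z (or_introl erefl) gF fz gz; rewrite inE.
    * by move=> /= h1 h2; rewrite (pt_tq z h2 h1) eqxx.
    * by rewrite eqxx in fg.
    * by move=> fz gz; have := old (t, q) g z (or_intror erefl) gF fz gz; rewrite inE.
    * by move=> fz gz; have := old (p, t) f z (or_introl erefl) fF gz fz; rewrite inE.
    * by move=> fz gz; have := old (t, q) f z (or_intror erefl) fF gz fz; rewrite inE.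
    have [fE _] := subF f fF; have [gE _] := subF g gF.
    by move=> fz gz; rewrite (sub_meet sH fE gE fg fz gz) orbT.
  move=> u; rewrite inE => /orP[/eqP->|uV]; apply/iff; first by exists (p, q).
  exact: sub_onH sH _ uV.
- rewrite /= size_filter addn1 !ltnS.
  have := count_predC (pred1 (p, q)) E => <-.
  have -> : count (fun f => f != (p, q)) E = count (predC (pred1 (p, q))) E by [].
  by rewrite -add1n leq_add2r -has_count; apply/hasP; exists (p, q) => /=.
- exists (vec p q); split; first exact: vec_neq0.
    have s2 : 0 < 1 - s by lra.
    apply: smallW (small_lt s2) => h h0 h1; exists (p, q) => //=.
    by exists (s + h); [lra|rewrite tE; apply: pt_eq; rewrite /=; ring].
  have s0 : 0 < s by lra.
  apply: smallW (small_lt s0) => h h0 h1; exists (p, q) => //=.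
  by exists (s - h); [lra|rewrite tE; apply: pt_eq; rewrite /=; ring].
move=> u s' uV [|]; rewrite !inE => /or3P[/eqP[uE sE]|/eqP[uE sE]|/subF[fE _]].
- exists q; first by left; rewrite uE.
  by rewrite uE sE tE /cross /=; ring.
- by rewrite -uE uV in tV.
- by exists s'; [left|rewrite /cross; ring].
- by rewrite -sE uV in tV.
- exists p; first by right; rewrite sE.
  by rewrite uE sE tE /cross /=; ring.
by exists s'; [right|rewrite /cross; ring].
Qed.

End Refine.

Section Extend.
Variable R : realFieldType.
Notation pt := (R * R)%type.
Implicit Types (p q x z w v d r t u s : pt) (E : seq (pt * pt)) (V : seq pt).

(** By the size clause the excess of edges over vertices grows by at most one: splitting the edge
    that is hit adds an edge and a vertex, the new segment adds an edge. *)
Lemma extend V E v r : subdivision V E -> uniq V -> v \in V -> r != (0, 0) ->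
  ~ small (fun h => onH E (shift v r h)) -> (exists2 h : R, 0 < h & onH E (shift v r h)) ->
  exists V' E' t,
  [/\ subdivision V' E', uniq V', forall u, u \in V' -> u \in V \/ u = t,
      {subset V <= V'} & (size E' + size V <= size E + size V' + 1)%N] /\
  [/\ exists2 h : R, 0 < h & t = shift v r h, onH E t,
      forall z, onH E' z <-> onH E z \/ seg v t z, t \in V \/ straight E' t &
      forall u s, u \in V -> adj E' u s ->
        [\/ exists2 s0, adj E u s0 & cross (vec u s0) (vec u s) = 0, u = v /\ s = t | u = t]].
Proof.
move=> sH uV vV r0 nsm ex.
have ndir s (a : R) : adj E v s -> 0 < a -> vec v s <> (a * r.1, a * r.2).
  move=> vs a0 e; apply: nsm.
  apply: smallW (small_lt a0) => h h0 ha; apply: (adj_onH vs).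
  exists (h / a); first by rewrite divr_ge0 ?(ltW h0) ?(ltW a0) //= ler_pdivrMr // mul1r ltW.
  by rewrite -shift_vec e; apply: pt_eq; rewrite /=; field; rewrite gt_eqF.
have [h [h0 ot] hmin] := first_hit r0 (ray_small sH vV r0 (fun s vs a => @ndir s a vs)) ex.
set t := shift v r h in ot.
have vt : v != t.
  apply/eqP => e; case/eqP: r0; have e1 : h * r.1 = 0 by move/(congr1 fst): e; rewrite /t /=; lra.
  have e2 : h * r.2 = 0 by move/(congr1 snd): e; rewrite /t /=; lra.
  move/eqP: e1; move/eqP: e2; rewrite !mulf_eq0 gt_eqF //= => /eqP e2 /eqP e1.
  exact: pt_eq.
have free (k : R) : 0 < k < 1 -> ~ onH E (lerp v t k).
  move=> /andP[k0 k1]; have -> : lerp v t k = shift v r (k * h).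
    by apply: pt_eq; rewrite /t /=; ring.
  by apply: hmin; rewrite mulr_gt0 //= gtr_pMl.
have add V1 E1 : subdivision V1 E1 -> {subset V <= V1} -> t \in V1 ->
    (forall z, onH E z <-> onH E1 z) ->
    (forall u s, u \in V -> adj E1 u s ->
       exists2 s0, adj E u s0 & cross (vec u s0) (vec u s) = 0) ->
    let E' := sort_pair v t :: E1 in
    [/\ subdivision V1 E', forall z, onH E' z <-> onH E z \/ seg v t z &
      forall u s, u \in V -> adj E' u s ->
        [\/ exists2 s0, adj E u s0 & cross (vec u s0) (vec u s) = 0, u = v /\ s = t | u = t]].
  move=> sH1 V1s tV1 iff adj1 E'; split.
  - apply: add_edge => //; first exact: V1s.
    by move=> k k01 /iff; apply: free.
  - move=> z; split=> [/onH_cat[/seg_sort_pair|]|[|]]; first by right.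
    + by move/iff; left.
    + by move/iff => oz; apply/onH_cat; right.
    by move=> vz; apply/onH_cat; left; apply/seg_sort_pair.
  move=> u s uV' us; have [us1|] := EM (adj E1 u s).
    by constructor 1; apply: adj1.
  move: us; rewrite /adj /E' !inE => -[]/orP[/eqP e|h1] h2; try by case: h2; auto.
    by move: e; rewrite /sort_pair; case: ifP => _ [-> ->]; [constructor 2|constructor 3].
  by move: e; rewrite /sort_pair; case: ifP => _ [-> ->]; [constructor 3|constructor 2].
have [tV|tV] := boolP (t \in V).
  have adj0 u s : u \in V -> adj E u s -> exists2 s0, adj E u s0 & cross (vec u s0) (vec u s) = 0.
    by move=> _ us; exists s => //; rewrite /cross; ring.
  have [h1 h2 h3] := add V E sH (fun _ => id) tV (fun z => iff_refl _) adj0.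
  exists V, (sort_pair v t :: E), t; split; split=> //; try by left.
    by rewrite /=; lia.
  by exists h.
have [E1 [sH1 iff sz st adj1]] := split_edge sH ot tV.
have Vs : {subset V <= t :: V} by move=> u uV'; rewrite inE uV' orbT.
have [h1 h2 h3] := add (t :: V) E1 sH1 Vs (mem_head _ _) iff adj1.
exists (t :: V), (sort_pair v t :: E1), t; split; split=> //.
- by rewrite /= tV.
- by move=> u; rewrite inE => /orP[/eqP->|]; [right|left].
- by rewrite /=; lia.
- by exists h.
right; apply: straight_mono st => z oz; apply/h2; by left.
Qed.

End Extend.

(** * The enclosing triangle *)

Section Box.
Variable R : realFieldType.
Notation pt := (R * R)%type.
Implicit Types (p q x z w v d r t u s : pt) (E : seq (pt * pt)) (V : seq pt).
Variable L : R.
Hypothesis L0 : 0 < L.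

(** The triangle given by [- L <= x], [- L <= y] and [x + y <= 2 * L]. Its three vertices and three
    edges do not change the excess of edges over vertices. *)
Definition corner1 : pt := (- L, - L).
Definition corner2 : pt := (3 * L, - L).
Definition corner3 : pt := (- L, 3 * L).
Definition corners : seq pt := [:: corner1; corner2; corner3].
Definition box_edges : seq (pt * pt) :=
  [:: (corner1, corner2); (corner1, corner3); (corner3, corner2)].
Definition inbox z : Prop := [/\ 0 <= z.1 + L, 0 <= z.2 + L & 0 <= 2 * L - z.1 - z.2].
Definition instrict z : Prop := [/\ 0 < z.1 + L, 0 < z.2 + L & 0 < 2 * L - z.1 - z.2].

Lemma instrictW z : instrict z -> inbox z.
Proof. by case=> *; split; apply: ltW. Qed.

Lemma box_boundaryP z : inbox z ->
  [\/ z.1 + L = 0, z.2 + L = 0 | 2 * L - z.1 - z.2 = 0] -> onH box_edges z.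
Proof.
have d0 : 0 < 4 * L by rewrite mulr_gt0.
have dn : 4 * L != 0 by rewrite gt_eqF.
have Ln : L != 0 by rewrite gt_eqF.
case=> h1 h2 h3 [] h.
- exists (corner1, corner3); first by rewrite !inE eqxx !orbT.
  exists ((z.2 + L) / (4 * L)); first by rewrite divr_ge0 ?ler_pdivrMr //=; lra.
  by apply: pt_eq; rewrite /=; [rewrite subrr mulr0; lra|field].
- exists (corner1, corner2); first by rewrite !inE eqxx.
  exists ((z.1 + L) / (4 * L)); first by rewrite divr_ge0 ?ler_pdivrMr //=; lra.
  by apply: pt_eq; rewrite /=; [field|rewrite subrr mulr0; lra].
exists (corner3, corner2); first by rewrite !inE eqxx !orbT.
exists ((z.1 + L) / (4 * L)); first by rewrite divr_ge0 ?ler_pdivrMr //=; lra.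
have -> : z = (z.1, 2 * L - z.1) by apply: pt_eq => //=; lra.
by apply: pt_eq; rewrite /=; field.
Qed.

Lemma box_edgeP e z : e \in box_edges -> seg e.1 e.2 z -> inbox z /\
  [\/ e = (corner1, corner2) /\ z.2 + L = 0, e = (corner1, corner3) /\ z.1 + L = 0 |
      e = (corner3, corner2) /\ 2 * L - z.1 - z.2 = 0].
Proof.
rewrite !inE => /or3P[]/eqP-> [t /andP[t0 t1] -> /=]; have h := mulr_ge0 t0 (ltW L0);
  have h' : 0 <= (1 - t) * L by (rewrite mulr_ge0 ?subr_ge0 // ltW).
all: split; first by split=> /=; lra.
- by constructor 1; split=> //; lra.
- by constructor 2; split=> //; lra.
by constructor 3; split=> //; lra.
Qed.

Lemma box_exit v r : instrict v -> r != (0, 0) ->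
  exists2 h : R, 0 < h & onH box_edges (shift v r h).
Proof.
move=> [v1 v2 v3] r0.
pose f i : R := nth 0 [:: v.1 + L; v.2 + L; 2 * L - v.1 - v.2] i.
pose g i : R := nth 0 [:: r.1; r.2; - r.1 - r.2] i.
have [i i3 gi] : exists2 i, (i < 3)%N & g i < 0.
  apply: contrapT => nex; case/eqP: r0.
  have ge i : (i < 3)%N -> 0 <= g i.
    by move=> i3; rewrite leNgt; apply/negP => gi; apply: nex; exists i.
  have := ge 0%N isT; have := ge 1%N isT; have := ge 2%N isT; rewrite /g /=.
  by move=> *; apply: pt_eq => /=; lra.
have fpos j : (j < 3)%N -> 0 < f j by case: j => [|[|[|]]].
(* One unit past the zero of the decreasing form [f i], so that [exit_time] applies to the ray up to
   time [K]. *)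
pose K := f i / (- g i) + 1.
have ng : 0 < - g i by rewrite oppr_gt0.
have K0 : 0 < K by rewrite ltr_wpDl // divr_ge0 ?ltW // fpos.
have Ki : f i + K * g i < 0.
  have -> : f i + K * g i = g i by rewrite /K; field; rewrite lt_eqF.
  exact: gi.
have [||t [t01 pos [u us [un u0]]]] := @exit_time _ [seq (f j, f j + K * g j) | j <- iota 0 3].
- by move=> u /mapP[j]; rewrite mem_iota => /andP[_ j3] ->; apply/ltW/fpos.
- exists (f i, f i + K * g i) => //; apply/mapP; exists i => //.
  by rewrite mem_iota.
have t0 : t != 0.
  apply/eqP => t0; move: us u0 => /mapP[j]; rewrite mem_iota => /andP[_ j3] -> /=.
  by have := fpos j j3; rewrite t0; lra.
have tK j : f j + t * (f j + K * g j - f j) = f j + t * K * g j by ring.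
have pos' j : (j < 3)%N -> 0 <= f j + t * K * g j.
  by move=> j3; rewrite -tK; apply: (pos (f j, _)); apply/mapP; exists j; rewrite ?mem_iota.
have zero : exists2 j, (j < 3)%N & f j + t * K * g j = 0.
  move: us u0 => /mapP[j]; rewrite mem_iota => /andP[_ j3] -> /=; rewrite tK => e.
  by exists j.
exists (t * K); first by rewrite mulr_gt0 // lt_neqAle eq_sym t0; case/andP: t01.
have h1 := pos' 0%N isT; have h2 := pos' 1%N isT; have h3 := pos' 2%N isT.
rewrite /f /g /= in h1 h2 h3; apply: box_boundaryP; first by split=> /=; lra.
case: zero => -[|[|[|//]]] _; rewrite /f /g /= => h; [constructor 1|constructor 2|constructor 3];
  rewrite /=; lra.
Qed.

Lemma lex_comb l m v a b w (x y : R) : 0 <= x -> 0 <= y ->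
  (forall k, aff k w = aff k v + x * (aff k a - aff k v) + y * (aff k b - aff k v)) ->
  ~ ltlex l m v a -> ~ ltlex l m v b -> ~ ltlex l m v w.
Proof.
move=> x0 y0 E /nltlex ha /nltlex hb; rewrite /ltlex !E.
have key (h : R) (f : R) : 0 <= h -> f <= 0 -> h * f <= 0 by move=> *; apply: mulr_ge0_le0.
have la : aff l a - aff l v <= 0 by lra.
have lb : aff l b - aff l v <= 0 by lra.
have k1 := key _ _ x0 la; have k2 := key _ _ y0 lb.
case=> [|[e]]; first by lra.
have : x * (aff m a - aff m v) <= 0.
  have : x * (aff l a - aff l v) = 0 by lra.
  move/eqP; rewrite mulf_eq0 => /orP[/eqP->|/eqP e']; first by rewrite mul0r.
  by apply: key => //; lra.
have : y * (aff m b - aff m v) <= 0.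
  have : y * (aff l b - aff l v) = 0 by lra.
  move/eqP; rewrite mulf_eq0 => /orP[/eqP->|/eqP e']; first by rewrite mul0r.
  by apply: key => //; lra.
lra.
Qed.

Lemma aff_box k z : aff k z = (2 * L - z.1 - z.2) / (4 * L) * aff k corner1 +
  (z.1 + L) / (4 * L) * aff k corner2 + (z.2 + L) / (4 * L) * aff k corner3.
Proof. by rewrite /aff /lin /=; field; rewrite gt_eqF. Qed.

(** A point of the box is a convex combination of the corners. The permutation covers the three
    choices of [v] at once. *)
Lemma corner_max l m v a b w : inbox w -> perm_eq [:: v; a; b] corners ->
  ~ ltlex l m v a -> ~ ltlex l m v b -> ~ ltlex l m v w.
Proof.
move=> [h1 h2 h3] pe; have Lp := L0; have d0 : 0 < 4 * L by lra.
have dn : 4 * L != 0 by rewrite gt_eqF.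
pose c z := if z == corner1 then (2 * L - w.1 - w.2) / (4 * L) else
  if z == corner2 then (w.1 + L) / (4 * L) else (w.2 + L) / (4 * L).
have c0 z : 0 <= c z by rewrite /c; do 2?case: ifP => _; rewrite divr_ge0 ?(ltW d0).
have n12 : (corner2 == corner1) = false by apply/eqP => -[]; lra.
have n13 : (corner3 == corner1) = false by apply/eqP => -[]; lra.
have n23 : (corner3 == corner2) = false by apply/eqP => -[]; lra.
have c1 : c corner1 = (2 * L - w.1 - w.2) / (4 * L) by rewrite /c eqxx.
have c2 : c corner2 = (w.1 + L) / (4 * L) by rewrite /c n12 eqxx.
have c3 : c corner3 = (w.2 + L) / (4 * L) by rewrite /c n13 n23.
have csum : c v + c a + c b = 1.
  have : \sum_(z <- [:: v; a; b]) c z = 1.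
    by rewrite (perm_big _ pe) !big_cons big_nil c1 c2 c3 /=; field; rewrite gt_eqF.
  by rewrite !big_cons big_nil; lra.
apply: (lex_comb (c0 a) (c0 b)) => k.
have : \sum_(z <- [:: v; a; b]) c z * aff k z = aff k w.
  by rewrite (perm_big _ pe) !big_cons big_nil c1 c2 c3 (aff_box k w) /=; ring.
rewrite !big_cons big_nil => <-; have -> : c v = 1 - c a - c b by lra.
ring.
Qed.

(** All barycentric coordinates of [z] are positive, so a form exceeding its value at [z] on no
    corner is constant. If no corner is above [z], this holds for [l] and then for [m], against
    their independence. *)
Lemma instrict_inside V z : {subset corners <= V} -> instrict z -> inside V z.
Proof.
move=> cV [h1 h2 h3] l m lm; have Lp := L0; apply: contrapT => nex.
have d0 : 0 < 4 * L by rewrite mulr_gt0.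
have nlt c : c \in corners -> ~ ltlex l m z c.
  by move=> cc lt; apply: nex; exists c => //; apply: cV.
have n1 := nltlex (nlt corner1 (mem_head _ _)).
have n2 : aff l corner2 < aff l z \/ aff l corner2 = aff l z /\ aff m corner2 <= aff m z.
  by apply/nltlex/nlt; rewrite !inE eqxx orbT.
have n3 : aff l corner3 < aff l z \/ aff l corner3 = aff l z /\ aff m corner3 <= aff m z.
  by apply/nltlex/nlt; rewrite !inE eqxx !orbT.
pose u := (2 * L - z.1 - z.2) / (4 * L); pose v := (z.1 + L) / (4 * L).
pose w := (z.2 + L) / (4 * L).
have u0 : 0 < u by rewrite divr_gt0.
have v0 : 0 < v by rewrite divr_gt0.
have w0 : 0 < w by rewrite divr_gt0.
have uvw : u + v + w = 1 by rewrite /u /v /w; field; rewrite gt_eqF.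
have eq k : aff k corner1 <= aff k z -> aff k corner2 <= aff k z -> aff k corner3 <= aff k z ->
    [/\ aff k corner1 = aff k z, aff k corner2 = aff k z & aff k corner3 = aff k z].
  move=> k1 k2 k3; have := aff_box k z; rewrite -/u -/v -/w => e.
  have e1 : u * (aff k z - aff k corner1) + v * (aff k z - aff k corner2) +
      w * (aff k z - aff k corner3) = 0.
    rewrite (_ : _ + _ = (u + v + w) * aff k z - (u * aff k corner1 + v * aff k corner2 +
      w * aff k corner3)); last by ring.
    by rewrite uvw -e; ring.
  have p1 : 0 <= u * (aff k z - aff k corner1) by rewrite mulr_ge0 ?subr_ge0 // ltW.
  have p2 : 0 <= v * (aff k z - aff k corner2) by rewrite mulr_ge0 ?subr_ge0 // ltW.
  have p3 : 0 <= w * (aff k z - aff k corner3) by rewrite mulr_ge0 ?subr_ge0 // ltW.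
  have z0 (x y : R) : 0 < x -> x * y = 0 -> y = 0.
    by move=> x0 /eqP; rewrite mulf_eq0 gt_eqF //= => /eqP.
  by split; apply/eqP; rewrite eq_sym -subr_eq0; apply/eqP;
    [apply: (z0 u)|apply: (z0 v)|apply: (z0 w)] => //; lra.
have [l1 l2 l3] : [/\ aff l corner1 = aff l z, aff l corner2 = aff l z & aff l corner3 = aff l z].
  by apply: eq; lra.
have [m1 m2 m3] : [/\ aff m corner1 = aff m z, aff m corner2 = aff m z & aff m corner3 = aff m z].
  by apply: eq; lra.
case/eqP: lm; have lx : l.1.1 * (4 * L) = 0 by rewrite -(subrr (aff l z)) -{1}l2 -l1 /aff /lin /=; ring.
have mx : m.1.1 * (4 * L) = 0 by rewrite -(subrr (aff m z)) -{1}m2 -m1 /aff /lin /=; ring.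
move/eqP: lx; rewrite mulf_eq0 (gt_eqF d0) orbF => /eqP lx.
move/eqP: mx; rewrite mulf_eq0 (gt_eqF d0) orbF => /eqP mx.
by rewrite /cross mx lx; ring.
Qed.

End Box.

(** * Extending the vertices one at a time *)

Section Build.
Variable R : realFieldType.
Notation pt := (R * R)%type.
Implicit Types (p q x z w v d r t u s o : pt) (E OE : seq (pt * pt)) (V O Q : seq pt).
(** To be applied with [O] and [OE] the nonisolated vertices and the edges of [G + M], and [Q] the
    isolated vertices. The vertex [o] is extended away from its neighbour [nb o]. *)
Variables (L : R) (O : seq pt) (OE : seq (pt * pt)) (nb : pt -> pt) (Q : seq pt).
Hypothesis L0 : 0 < L.
Hypothesis uO : uniq O.
Hypothesis Oin : forall o, o \in O -> instrict L o.
Hypothesis Qin : forall q, q \in Q -> instrict L q.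
Hypothesis OEend : forall e, e \in OE -> e.1 \in O /\ e.2 \in O.
Hypothesis OElex : forall e, e \in OE -> lexlt e.1 e.2.
Hypothesis OEvert : forall e o, e \in OE -> o \in O -> seg e.1 e.2 o -> o = e.1 \/ o = e.2.
Hypothesis OEmeet : forall e f z, e \in OE -> f \in OE -> e != f ->
  seg e.1 e.2 z -> seg f.1 f.2 z -> z \in O.
Hypothesis OEQ : forall q, q \in Q -> ~ onH OE q.
Hypothesis nbP : forall o, o \in O -> adj OE o (nb o).
Hypothesis gpO : forall o o', o \in O -> o' \in O -> orient o (nb o) o' = 0 -> o' = o \/ o' = nb o.
Hypothesis gpQ : forall o q, o \in O -> q \in Q -> orient o (nb o) q <> 0.

Local Notation corners := (corners L).
Local Notation box_edges := (box_edges L).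

(* [S] lists the vertices that have not been extended yet. *)
Record partial V E S : Prop := Partial {
  pa_sub : subdivision V E;
  pa_uniq : uniq V;
  pa_box : forall v, v \in V -> inbox L v;
  pa_O : {subset O <= V};
  pa_C : {subset corners <= V};
  pa_OE : forall z, onH OE z -> onH E z;
  pa_BE : forall z, onH box_edges z -> onH E z;
  pa_Q : forall q, q \in Q -> ~ onH E q;
  pa_par : forall o s, o \in O -> adj E o s ->
    exists2 s0, adj OE o s0 & cross (vec o s0) (vec o s) = 0;
  pa_straight : forall v, v \in V -> [\/ v \in S, v \in corners | straight E v];
  pa_ext : forall o, o \in O -> o \notin S -> small (fun h => onH E (shift o (vec (nb o) o) h));
  pa_size : (size E + size S <= size V + size OE)%N }.

Lemma OE_instrict z : onH OE z -> instrict L z.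
Proof.
move=> [e eE [t /andP[t0 t1] ->]]; have [/Oin[a1 a2 a3] /Oin[b1 b2 b3]] := OEend eE.
have key (a b : R) : 0 < a -> 0 < b -> 0 < (1 - t) * a + t * b.
  move=> a0 b0; have [->|tn] := eqVneq t 0; first by lra.
  rewrite ltr_wpDl ?mulr_ge0 ?subr_ge0 ?(ltW a0) // mulr_gt0 //.
  by rewrite lt_neqAle eq_sym tn.
have := key _ _ a1 b1; have := key _ _ a2 b2; have := key _ _ a3 b3.
by split=> /=; lra.
Qed.

Lemma box_edge_boundary e z : e \in box_edges -> seg e.1 e.2 z -> ~ instrict L z.
Proof.
move=> eB /(box_edgeP L0 eB)[_ h] [z1 z2 z3]; move: z1 z2 z3.
by case: h => -[_ ->]; rewrite ltxx.
Qed.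

Lemma corner_notin c : c \in corners -> ~ instrict L c.
Proof.
by rewrite !inE => /or3P[]/eqP-> [] /=; rewrite ?addNr ?ltxx // => _ _; lra.
Qed.

Lemma partial_init : partial (O ++ corners) (OE ++ box_edges) O.
Proof.
have Lp := L0.
have cB e : e \in box_edges -> e.1 \in corners /\ e.2 \in corners.
  by rewrite !inE => /or3P[]/eqP-> /=; rewrite ?eqxx ?orbT.
have iff z : onH (OE ++ box_edges) z <-> onH OE z \/ onH box_edges z.
  split=> [[e]|[[e eE h]|[e eE h]]].
  - by rewrite mem_cat => /orP[eE h|eE h]; [left|right]; exists e.
  - by exists e; rewrite // mem_cat eE.
  by exists e; rewrite // mem_cat eE orbT.
have n12 : corner1 L == corner2 L = false by apply/eqP => -[]; lra.
have n13 : corner1 L == corner3 L = false by apply/eqP => -[]; lra.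
have n23 : corner2 L == corner3 L = false by apply/eqP => -[]; lra.
split.
- split.
  + move=> e; rewrite !mem_cat => /orP[/OEend[-> ->]//|/cB[-> ->]]; by rewrite !orbT.
  + move=> e; rewrite mem_cat => /orP[/OElex//|].
    rewrite !inE => /or3P[]/eqP->; apply/lexltP => /=; [left; lra|right; split; lra|left; lra].
  + move=> e v; rewrite !mem_cat => /orP[eE|eB] /orP[vO|vC] h.
    * exact: OEvert.
    * by case: (corner_notin vC); apply: OE_instrict; exists e.
    * by case: (box_edge_boundary eB h); apply: Oin.
    have [_] := box_edgeP L0 eB h; move: vC; rewrite !inE.
    by case/or3P => /eqP-> [] [-> /=] ?; try (by left); try (by right); exfalso; lra.
  + move=> e f z; rewrite !mem_cat => /orP[eE|eB] /orP[fE|fB] ef h1 h2.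
    * by rewrite (OEmeet eE fE ef h1 h2).
    * by case: (box_edge_boundary fB h2); apply: OE_instrict; exists e.
    * by case: (box_edge_boundary eB h1); apply: OE_instrict; exists f.
    have [_ k1] := box_edgeP L0 eB h1; have [_ k2] := box_edgeP L0 fB h2.
    suff -> : z \in corners by rewrite orbT.
    have z1 : z.1 + L = 0 -> z.2 + L = 0 -> z = corner1 L by move=> *; apply: pt_eq => /=; lra.
    have z2 : z.2 + L = 0 -> 2 * L - z.1 - z.2 = 0 -> z = corner2 L.
      by move=> *; apply: pt_eq => /=; lra.
    have z3 : z.1 + L = 0 -> 2 * L - z.1 - z.2 = 0 -> z = corner3 L.
      by move=> *; apply: pt_eq => /=; lra.
    case: k1 => -[ee e0]; case: k2 => -[fe f0]; first [by rewrite ee fe eqxx in ef |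
      by rewrite z1 // !inE eqxx ?orbT | by rewrite z2 // !inE eqxx ?orbT |
      by rewrite z3 // !inE eqxx ?orbT].
  move=> v; rewrite mem_cat => /orP[vO|vC]; apply/iff; [left|right].
    exact: adj_onHl (nbP vO).
  move: vC; rewrite !inE => /or3P[]/eqP->.
  * by exists (corner1 L, corner2 L); [rewrite !inE eqxx|apply: segl].
  * by exists (corner1 L, corner2 L); [rewrite !inE eqxx|apply: segr].
  by exists (corner1 L, corner3 L); [rewrite !inE eqxx !orbT|apply: segr].
- rewrite cat_uniq uO; apply/and3P; split=> //; last by rewrite /= !inE n12 n13 n23.
  by apply/hasPn => c cC; apply/negP => /Oin; apply: corner_notin.
- move=> v; rewrite mem_cat => /orP[/Oin/instrictW//|].
  by rewrite !inE => /or3P[]/eqP->; split=> /=; lra.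
- by move=> o oO; rewrite mem_cat oO.
- by move=> c cC; rewrite mem_cat cC orbT.
- by move=> z oz; apply/iff; left.
- by move=> z oz; apply/iff; right.
- move=> q qQ /iff[]; first exact: OEQ.
  by move=> [e eB h]; apply: (box_edge_boundary eB h); apply: Qin.
- move=> o s oO; rewrite /adj !mem_cat => os; exists s; last by rewrite /cross; ring.
  have nc e : e \in box_edges -> e.1 != o /\ e.2 != o.
    by move=> /cB[h1 h2]; split; apply/eqP => eo;
      [apply: (corner_notin h1)|apply: (corner_notin h2)]; rewrite eo; apply: Oin.
  case: os => /orP[|/nc[/= n1 n2]]; first by left.
  - by rewrite eqxx in n1.
  - by right.
  by rewrite eqxx in n2.
- by move=> v; rewrite mem_cat => /orP[vO|vC]; [constructor 1|constructor 2].
- by move=> o ->.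
by rewrite !size_cat /=; lia.
Qed.

Lemma nb_neq o : o \in O -> nb o != o.
Proof.
by move=> /nbP[] /OElex /= /lexlt_neq //; rewrite eq_sym.
Qed.

Lemma partial_step V E v S : v \in O -> partial V E (v :: S) ->
  exists V' E', partial V' E' S.
Proof.
move=> vO pa; have sH := pa_sub pa; have vV := pa_O pa vO.
set r := vec (nb v) v; have r0 : r != (0, 0) by apply/vec_neq0/nb_neq.
have rback E' : (forall z, onH OE z -> onH E' z) -> small (fun h => onH E' (shift v (- r.1, - r.2) h)).
  move=> mono; apply: smallW (small_lt ltr01) => h h0 h1; apply: mono.
  apply: (adj_onH (nbP vO)); exists h; first by rewrite !ltW.
  by apply: pt_eq; rewrite /=; ring.
have [sm|nsm] := EM (small (fun h => onH E (shift v r h))).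
  exists V, E; case: (pa) => *; split=> //.
  - move=> u /(pa_straight pa)[|uC|us]; [|by constructor 2|by constructor 3].
    rewrite inE => /orP[/eqP->|uS]; last by constructor 1.
    by constructor 3; exists r; split=> //; apply: rback.
  - move=> o oO oS; have [->//|ov] := eqVneq o v.
    by apply: (pa_ext pa); rewrite // inE negb_or ov.
  by have := pa_size pa; rewrite /=; lia.
have ex : exists2 h : R, 0 < h & onH E (shift v r h).
  by have [h h0 /(pa_BE pa)] := box_exit L0 (Oin vO) r0; exists h.
have [V' [E' [t [[sH' uV' V'V VV' sz] [[h h0 tE] ot iff st adj']]]]] :=
  extend sH (pa_uniq pa) vV r0 nsm ex.
have vt z : seg v t z -> orient v (nb v) z = 0.
  by move=> [k _ ->]; rewrite tE /r /orient /cross /=; ring.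
(* By general position only [v] and [nb v] are original vertices on this line, and both are behind
   the hit point. So no other original vertex gets a new edge direction. *)
have tO : t \notin O.
  apply/negP => tO; have [e|e] := gpO vO tO (vt t (segr v t)).
    case/eqP: r0; have e1 : h * r.1 = 0 by move/(congr1 fst): e; rewrite tE /=; lra.
    have e2 : h * r.2 = 0 by move/(congr1 snd): e; rewrite tE /=; lra.
    move/eqP: e1; move/eqP: e2; rewrite !mulf_eq0 gt_eqF //= => /eqP e2 /eqP e1.
    exact: pt_eq.
  case/eqP: r0; have e1 : (h + 1) * r.1 = 0 by move/(congr1 fst): e; rewrite tE /=; lra.
  have e2 : (h + 1) * r.2 = 0 by move/(congr1 snd): e; rewrite tE /=; lra.
  have h1 : h + 1 != 0 by apply/eqP; lra.
  move/eqP: e1; move/eqP: e2; rewrite !mulf_eq0 (negPf h1) //= => /eqP e2 /eqP e1.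
  exact: pt_eq.
have mono z : onH E z -> onH E' z by move=> oz; apply/iff; left.
have seg_t (k : R) : 0 <= k <= h -> seg v t (shift v r k).
  move=> kh; exists (k / h); first by rewrite divr_ge0 ?ler_pdivrMr; lra.
  by rewrite tE; apply: pt_eq; rewrite /=; field; rewrite gt_eqF.
have sm : small (fun k => onH E' (shift v r k)).
  apply: smallW (small_lt h0) => k k0 kh; apply/iff; right; apply: seg_t.
  by rewrite !ltW.
have tbox : inbox L t.
  have [e [eE /(pa_box pa) p1 /(pa_box pa) p2]] := onH_vertex sH ot.
  case: p1 p2 => a1 a2 a3 [b1 b2 b3] [k k01 ->].
  have := conv_ge0 k01 a1 b1; have := conv_ge0 k01 a2 b2; have := conv_ge0 k01 a3 b3.
  by split=> /=; lra.
exists V', E'; split=> //.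
- by move=> u /V'V[/(pa_box pa)//|->].
- by move=> o /(pa_O pa)/VV'.
- by move=> c /(pa_C pa)/VV'.
- by move=> z /(pa_OE pa)/mono.
- by move=> z /(pa_BE pa)/mono.
- move=> q qQ /iff[]; first exact: pa_Q pa _ qQ.
  by move=> /vt; apply: gpQ.
- move=> o s oO /(adj' o s (pa_O pa oO))[[s0 os0 c]|[-> ->]|ot'].
  + have [s1 os1 c1] := pa_par pa oO os0; exists s1 => //.
    have s0o : vec o s0 != (0, 0).
      apply: vec_neq0; case: os0 => /(sub_lex sH)/lexlt_neq //=.
      by rewrite eq_sym.
    have [k ->] := parallel s0o c.
    by move: c1; rewrite /cross /= => c1; rewrite !mulrA ![_ * k]mulrC -!mulrA -mulrBr c1 mulr0.
  + exists (nb v); first exact: nbP.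
    by have := vt t (segr v t); rewrite /orient.
  by case/negP: tO; rewrite -ot'.
- move=> u /V'V[|->]; last first.
    case: st => [/(pa_straight pa)[||]|].
    + by rewrite inE => /orP[/eqP tv|tS]; [rewrite tv vO in tO|constructor 1].
    + by constructor 2.
    + by move=> /(straight_mono mono); constructor 3.
    by constructor 3.
  move=> /(pa_straight pa)[||/(straight_mono mono)]; [|by constructor 2|by constructor 3].
  rewrite inE => /orP[/eqP->|uS]; last by constructor 1.
  constructor 3; exists r; split=> //; apply: rback => z /(pa_OE pa); exact: mono.
- move=> o oO oS; have [->//|ov] := eqVneq o v.
  have := pa_ext pa oO; rewrite inE negb_or ov => /(_ oS).
  by apply: smallW => k _; apply: mono.
(* The excess of edges over vertices may grow by one; the removal of [v] from the list of pending
   vertices pays for it. *)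
by have := pa_size pa; move: sz; rewrite /=; lia.
Qed.

Lemma partial_final : exists V E, partial V E [::].
Proof.
have H : forall S, {subset S <= O} -> (exists V E, partial V E S) -> exists V E, partial V E [::].
  elim=> // v S IH sub [V [E pa]].
  have [V' [E' pa']] := partial_step (sub v (mem_head _ _)) pa.
  by apply: IH; [move=> u uS; apply: sub; rewrite inE uS orbT|exists V', E'].
by apply: (H O) => //; exists (O ++ corners), (OE ++ box_edges); apply: partial_init.
Qed.

(** At a straight vertex, a local maximum would make both forms vanish on the same direction. So a
    local maximum is a corner, and comparison along its two box edges already decides it for the
    whole box. *)
Lemma partial_lmg V E : partial V E [::] -> local_max_global V E.
Proof.
move=> pa l m lm v vV loc w wV; have sH := pa_sub pa; have Lp := L0.
have dir d : d != (0, 0) -> small (fun h => onH E (shift v d h)) ->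
    lin l d <= 0 /\ (lin l d = 0 -> lin m d <= 0).
  move=> d0 sm; have [s [a [vs a0 e]]] := small_adj sH vV d0 sm.
  have := nltlex (loc s vs).
  have sE k : aff k s = aff k v + a * lin k d.
    have <- : shift v d a = s by move: e => [] e1 e2; apply: pt_eq => /=; lra.
    exact: aff_shift.
  rewrite !sE; case=> [h|[h1 h2]].
    have h' : a * lin l d < 0 by lra.
    by rewrite pmulr_rlt0 // in h'; split=> [|h3]; lra.
  have h1' : a * lin l d = 0 by lra.
  move/eqP: h1'; rewrite mulf_eq0 gt_eqF //= => /eqP h3.
  have h2' : a * lin m d <= 0 by lra.
  by rewrite pmulr_rle0 // in h2'; rewrite h3; split.
have corner a : (v, a) \in box_edges \/ (a, v) \in box_edges -> v != a -> ~ ltlex l m v a.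
  move=> va nva.
  have sm : small (fun h => onH E (shift v (vec v a) h)).
    apply: smallW (small_lt ltr01) => h h0 h1; apply: (pa_BE pa).
    by apply: (adj_onH va); exists h; rewrite ?shift_vec //; apply/andP; split; apply: ltW.
  have [h1 h2] := dir _ (vec_neq0 nva) sm; rewrite !aff_vec in h1 h2.
  by move=> [|[e]]; [lra|]; have := h2 ltac:(lra); lra.
have wb := pa_box pa wV.
have n12 : corner1 L != corner2 L by apply/eqP => -[]; lra.
have n13 : corner1 L != corner3 L by apply/eqP => -[]; lra.
have n23 : corner2 L != corner3 L by apply/eqP => -[]; lra.
case: (pa_straight pa vV) => // [|[d [d0 s1 s2]]]; last first.
  have nd0 : (- d.1, - d.2) != (0, 0).
    by move: d0; case: d {s1 s2} => a b; rewrite !xpair_eqE !oppr_eq0.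
  have [a1 a2] := dir _ d0 s1; have [b1 b2] := dir _ nd0 s2.
  have linN k : lin k (- d.1, - d.2) = - lin k d by rewrite /lin /=; ring.
  rewrite !linN in b1 b2; have l0 : lin l d = 0 by lra.
  have m0 : lin m d = 0 by have := a2 l0; have := b2; rewrite l0 oppr0 => /(_ erefl); lra.
  exfalso; case/eqP: d0; move/eqP: lm; rewrite /cross; move: l0 m0; rewrite /lin => l0 m0 lm.
  have h1 : d.1 * (l.1.1 * m.1.2 - l.1.2 * m.1.1) = 0.
    rewrite (_ : _ * _ = (l.1.1 * d.1 + l.1.2 * d.2) * m.1.2 -
      (m.1.1 * d.1 + m.1.2 * d.2) * l.1.2); last by ring.
    by rewrite l0 m0; ring.
  have h2 : d.2 * (l.1.1 * m.1.2 - l.1.2 * m.1.1) = 0.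
    rewrite (_ : _ * _ = (m.1.1 * d.1 + m.1.2 * d.2) * l.1.1 -
      (l.1.1 * d.1 + l.1.2 * d.2) * m.1.1); last by ring.
    by rewrite l0 m0; ring.
  move/eqP: h1; move/eqP: h2; rewrite !mulf_eq0 => /orP[/eqP h2|/eqP//] /orP[/eqP h1|/eqP//].
  exact: pt_eq.
rewrite !inE => /or3P[]/eqP vE; rewrite vE in corner *.
- apply: (@corner_max _ L L0 l m (corner1 L) (corner2 L) (corner3 L) w wb (perm_refl _)).
    by apply: corner n12; left; rewrite !inE eqxx.
  by apply: corner n13; left; rewrite !inE eqxx !orbT.
- apply: (@corner_max _ L L0 l m (corner2 L) (corner1 L) (corner3 L) w wb).
  + by apply/permP => a /=; lia.
  + by apply: corner; [right; rewrite !inE eqxx|rewrite eq_sym].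
  by apply: corner n23; right; rewrite !inE eqxx !orbT.
apply: (@corner_max _ L L0 l m (corner3 L) (corner1 L) (corner2 L) w wb).
+ by apply/permP => a /=; lia.
+ by apply: corner; [right; rewrite !inE eqxx !orbT|rewrite eq_sym].
by apply: corner; [left; rewrite !inE eqxx !orbT|rewrite eq_sym].
Qed.

Theorem extension_graph : exists V E,
  [/\ subdivision V E, local_max_global V E, uniq V, (size E <= size V + size OE)%N &
      forall z, instrict L z -> inside V z] /\
  [/\ {subset O <= V}, forall z, onH OE z -> onH E z, forall q, q \in Q -> ~ onH E q,
      forall o s, o \in O -> adj E o s ->
        exists2 s0, adj OE o s0 & cross (vec o s0) (vec o s) = 0 &
      forall o, o \in O -> small (fun h => onH E (shift o (vec (nb o) o) h))].
Proof.
have [V [E pa]] := partial_final; exists V, E; split; split.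
- exact: pa_sub pa.
- exact: partial_lmg.
- exact: pa_uniq pa.
- by have := pa_size pa; rewrite addn0.
- by move=> z; apply: instrict_inside => //; apply: pa_C pa.
- exact: pa_O pa.
- exact: pa_OE pa.
- exact: pa_Q pa.
- exact: pa_par pa.
by move=> o oO; apply: pa_ext pa _ oO _.
Qed.

End Build.

(** * What is visible from within one face *)

Section Faces.
Variable R : realFieldType.
Notation pt := (R * R)%type.
Implicit Types (p q x y z w v d r t u s : pt).
Variables (V : seq pt) (E : seq (pt * pt)).
Hypothesis subH : subdivision V E.
Hypothesis lmg : local_max_global V E.
Notation onH := (onH E).
Notation adj := (adj E).
Notation sees := (sees E).
Notation inside := (inside V).

(** One of the two segments leaving [w] enters the triangle [x u v], which [triangle_free] keeps
    clear. If [x] is on the line [u v], then [w] or one of [u], [v] is in the way. *)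
Lemma crossing_blocks x u v (s : R) c c' : inside x -> ~ onH x -> sees x u -> sees x v ->
  onH u -> onH v -> 0 < s < 1 -> orient u v c * orient u v c' < 0 ->
  (forall z, seg (lerp u v s) c z -> onH z) -> (forall z, seg (lerp u v s) c' z -> onH z) ->
  False.
Proof.
move=> ix nx xu xv ou ov s01; set w := lerp u v s.
wlog side : c c' / 0 < orient u v x * orient u v c \/ orient u v x = 0.
  move=> W cc oc oc'; have [D0|D0] := eqVneq (orient u v x) 0.
    by apply: (W c c') => //; right.
  have [h|h] := ltP 0 (orient u v x * orient u v c); first by apply: (W c c') => //; left.
  apply: (W c' c) => //; last by rewrite mulrC.
  left; have D2 : 0 < orient u v x * orient u v x by rewrite -expr2 exprn_even_gt0.
  rewrite ltNge; apply/negP => h'.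
  have : 0 <= (orient u v x * orient u v c) * (orient u v x * orient u v c').
    exact: mulr_le0.
  rewrite mulrACA pmulr_rge0 //; lra.
move=> cc oc _; have ow : onH w by apply: oc; apply: segl.
have uv : u != v.
  by apply/eqP => e; move: cc; rewrite e /orient /cross /=; lra.
have [D0|D0] := eqVneq (orient u v x) 0.
  have [k kE] := orient0_lerp uv D0.
  have [k0|k0] := ltP k 0.
    have d0 : 0 < 1 - k by lra.
    apply: (xv (- k / (1 - k))); first by rewrite divr_ge0 ?ltr_pdivrMr //=; lra.
    suff -> : lerp x v (- k / (1 - k)) = u by [].
    by rewrite kE; apply: pt_eq; rewrite /=; field; rewrite gt_eqF.
  have [k1|k1] := ltP 1 k.
    have d0 : 0 < k by lra.
    apply: (xu ((k - 1) / k)); first by rewrite divr_ge0 ?ltr_pdivrMr //=; lra.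
    suff -> : lerp x u ((k - 1) / k) = v by [].
    by rewrite kE; apply: pt_eq; rewrite /=; field; rewrite gt_eqF.
  have [sk|sk] := ltP s k.
    have d0 : 0 < k by lra.
    apply: (xu ((k - s) / k)); first by rewrite divr_ge0 ?ltr_pdivrMr //=; lra.
    suff -> : lerp x u ((k - s) / k) = w by [].
    by rewrite kE /w; apply: pt_eq; rewrite /=; field; rewrite gt_eqF.
  have d0 : 0 < 1 - k by lra.
  apply: (xv ((s - k) / (1 - k))); first by rewrite divr_ge0 ?ltr_pdivrMr //=; lra.
  suff -> : lerp x v ((s - k) / (1 - k)) = w by [].
  by rewrite kE /w; apply: pt_eq; rewrite /=; field; rewrite gt_eqF.
case: side => [side|/eqP]; last by rewrite (negPf D0).
have D1 : orient u x v != 0.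
  by rewrite (_ : orient u x v = - orient u v x) ?oppr_eq0 // /orient /cross /=; ring.
have free := triangle_free subH lmg D1 ix xu xv.
have [A [B [C [sum1 baryE AB [Ax Ay Az] [[Bx By Bz] [Cx Cy Cz]]]]]] := barycentric D1.
have Aw : aff A w = 1 - s by rewrite aff_lerp Ax Az; ring.
have Bw : aff B w = 0 by rewrite aff_lerp Bx Bz; ring.
have Cw : aff C w = s by rewrite aff_lerp Cx Cz; ring.
have BE z : orient u v x * aff B z = orient u v z.
  have [e1 e2] := baryE z; have e3 := sum1 z.
  have eA : aff A z = 1 - aff B z - aff C z by lra.
  by rewrite /orient /cross /= e1 e2 eA; ring.
have Bc : 0 < aff B c.
  have D2 : 0 < orient u v x * orient u v x by rewrite -expr2 exprn_even_gt0.
  by rewrite -(pmulr_rgt0 _ D2) -mulrA BE.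
have A0 : 0 < aff A w by rewrite Aw; lra.
have C0 : 0 < aff C w by rewrite Cw; lra.
have [h h0 [h1 [hA hC]]] := small_ex (smallI (small_lt ltr01)
  (smallI (small_lin (aff A c - aff A w) A0) (small_lin (aff C c - aff C w) C0))).
set z := lerp w c h.
have Az' : aff A z = aff A w + h * (aff A c - aff A w) by rewrite aff_lerp; ring.
have Cz' : aff C z = aff C w + h * (aff C c - aff C w) by rewrite aff_lerp; ring.
have Bz' : 0 < aff B z by rewrite aff_lerp Bw mulr0 add0r mulr_gt0.
have oz : onH z by apply: oc; apply: seg_lerp; lra.
have [e1 e2] := baryE z.
apply: (free (aff A z) (aff B z) (aff C z)) => //; try by rewrite ?Az' ?Cz' ltW.
by rewrite -e1 -e2 -surjective_pairing.
Qed.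

(** Otherwise the side [b c] separates [x] from [a], or one of [b], [c] lies in the free part of the
    triangle spanned by [x] and the other two corners. *)
Lemma bary_pos a b c x (k l m : R) : inside x -> ~ onH x -> sees x a -> sees x b -> sees x c ->
  onH a -> onH b -> onH c -> orient a b c != 0 ->
  (forall z, seg b c z -> onH z) -> k + l + m = 1 ->
  x = (k * a.1 + l * b.1 + m * c.1, k * a.2 + l * b.2 + m * c.2) -> 0 < k.
Proof.
move=> ix nx xa xb xc oa ob oc D0 bc klm xE; rewrite ltNge; apply/negP => k0.
have corner p q r (f g h : R) : sees x p -> sees x q -> onH r -> orient p q r != 0 ->
    f <= 0 -> g <= 0 -> 0 < h -> f + g + h = 1 ->
    x = (f * p.1 + g * q.1 + h * r.1, f * p.2 + g * q.2 + h * r.2) -> False.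
  move=> xp xq or D f0 g0 h0 fgh xE'.
  have hn : h != 0 by rewrite gt_eqF.
  have D1 : orient p x q != 0.
    have -> : orient p x q = - h * orient p q r.
      have fE : f = 1 - g - h by lra.
      by rewrite xE' fE /orient /cross /=; ring.
    by rewrite mulf_neq0 // oppr_eq0.
  apply: (triangle_free subH lmg D1 ix xp xq (a := - f / h) (b := h^-1) (c := - g / h)).
  - by rewrite divr_ge0 ?oppr_ge0 // ltW.
  - by rewrite invr_gt0.
  - by rewrite divr_ge0 ?oppr_ge0 // ltW.
  - have fE : f = 1 - g - h by lra.
    by rewrite fE; field.
  suff -> : (- f / h * p.1 + h^-1 * x.1 + - g / h * q.1,
             - f / h * p.2 + h^-1 * x.2 + - g / h * q.2) = r by [].
  by rewrite xE'; apply: pt_eq; rewrite /=; field.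
have [l0|l0] := ltP l 0.
  apply: (corner a b c k l m) => //; [exact: ltW|lra].
have [m0|m0] := ltP m 0.
  apply: (corner a c b k m l) => //; [|exact: ltW|lra|lra|].
    by rewrite (_ : orient a c b = - orient a b c) ?oppr_eq0 // /orient /cross /=; ring.
  by rewrite xE; apply: pt_eq; rewrite /=; ring.
have k1 : 0 < 1 - k by lra.
have kn : 1 - k != 0 by rewrite gt_eqF.
apply: (xa (- k / (1 - k))); first by rewrite divr_ge0 ?ltr_pdivrMr //=; lra.
apply: bc; exists (m / (1 - k)); first by rewrite divr_ge0 ?ler_pdivrMr //; lra.
have lE : l = 1 - k - m by lra.
by rewrite xE lE; apply: pt_eq; rewrite /=; field.
Qed.

(** Both points lie within the triangle by [bary_pos], and the subtriangles with apex [x] are clear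
    by [triangle_free]. *)
Lemma triangle_one_cell a b c x y : inside x -> inside y -> ~ onH x -> ~ onH y ->
  orient a b c != 0 -> sees x a -> sees x b -> sees x c ->
  sees y a -> sees y b -> sees y c ->
  (forall z, seg a b z -> onH z) -> (forall z, seg b c z -> onH z) ->
  (forall z, seg c a z -> onH z) -> sees x y.
Proof.
move=> ix iy nx ny D0 xa xb xc ya yb yc ab bc ca.
have oa : onH a by apply: ab; apply: segl.
have ob : onH b by apply: ab; apply: segr.
have oc : onH c by apply: bc; apply: segr.
have D1 : orient b c a != 0.
  by rewrite (_ : orient b c a = orient a b c) // /orient /cross /=; ring.
have D2 : orient c a b != 0.
  by rewrite (_ : orient c a b = orient a b c) // /orient /cross /=; ring.
have [A [B [C [sum1 baryE AB _ _]]]] := barycentric D0.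
have pos z : inside z -> ~ onH z -> sees z a -> sees z b -> sees z c ->
    [/\ 0 < aff A z, 0 < aff B z & 0 < aff C z].
  move=> iz nz za zb zc; have [e1 e2] := baryE z; have s1 := sum1 z; split.
  - apply: (bary_pos (a := a) (b := b) (c := c) iz nz) bc s1 _ => //.
    exact: pt_eq.
  - apply: (bary_pos (a := b) (b := c) (c := a) (l := aff C z) (m := aff A z) iz nz) ca _ _ => //.
      by lra.
    by apply: pt_eq; rewrite ?e1 ?e2 /=; ring.
  apply: (bary_pos (a := c) (b := a) (c := b) (l := aff A z) (m := aff B z) iz nz) ab _ _ => //.
    by lra.
  by apply: pt_eq; rewrite ?e1 ?e2 /=; ring.
have [ax bx cx] := pos x ix nx xa xb xc; have [ay by_ cy] := pos y iy ny ya yb yc.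
(* [y] lies in the subtriangle spanned by [x] and the side opposite to the vertex whose
   coordinate ratio is smallest. *)
have key p q r (f g h f' g' h' : R) : sees x q -> sees x r -> orient p q r != 0 ->
    0 < f -> 0 < g -> 0 < h -> 0 < f' -> f' / f <= g' / g -> f' / f <= h' / h ->
    f + g + h = 1 -> f' + g' + h' = 1 ->
    x = (f * p.1 + g * q.1 + h * r.1, f * p.2 + g * q.2 + h * r.2) ->
    y = (f' * p.1 + g' * q.1 + h' * r.1, f' * p.2 + g' * q.2 + h' * r.2) -> sees x y.
  move=> xq xr D f0 g0 h0 f1 fg fh s1 s2 xE yE t /andP[t0 t1].
  pose k := f' / f; have k0 : 0 < k by rewrite divr_gt0.
  have kf : k * f = f' by rewrite /k divfK // gt_eqF.
  have kg : 0 <= g' - k * g by move: fg; rewrite ler_pdivlMr // -/k; lra.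
  have kh : 0 <= h' - k * h by move: fh; rewrite ler_pdivlMr // -/k; lra.
  have D3 : orient q x r != 0.
    have -> : orient q x r = - f * orient p q r.
      have gE : g = 1 - f - h by lra.
      by rewrite xE gE /orient /cross /=; ring.
    by rewrite mulf_neq0 // oppr_eq0 gt_eqF.
  have := triangle_free subH lmg D3 ix xq xr (a := t * (g' - k * g)) (b := 1 - t + t * k)
    (c := t * (h' - k * h)).
  have b0 : 0 < 1 - t + t * k by rewrite ltr_wpDr ?subr_gt0 // mulr_ge0 // ltW.
  move=> /(_ (mulr_ge0 t0 kg) b0 (mulr_ge0 t0 kh)).
  have e : t * (g' - k * g) + (1 - t + t * k) + t * (h' - k * h) = 1.
    have -> : g' = 1 - f' - h' by lra.
    have -> : g = 1 - f - h by lra.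
    by rewrite -kf; ring.
  move=> /(_ e); congr (~ onH _).
  by rewrite {2}xE yE; apply: pt_eq; rewrite /= xE -kf /=; ring.
have [e1 e2] := baryE x; have [e3 e4] := baryE y; have s1 := sum1 x; have s2 := sum1 y.
have xE : x = (aff A x * a.1 + aff B x * b.1 + aff C x * c.1,
  aff A x * a.2 + aff B x * b.2 + aff C x * c.2) by apply: pt_eq.
have yE : y = (aff A y * a.1 + aff B y * b.1 + aff C y * c.1,
  aff A y * a.2 + aff B y * b.2 + aff C y * c.2) by apply: pt_eq.
have [h1|h1] := leP (aff A y / aff A x) (aff B y / aff B x);
  have [h2|h2] := leP (aff A y / aff A x) (aff C y / aff C x).
- exact: (key a b c) s1 s2 xE yE.
- apply: (key c a b (aff C x) (aff A x) (aff B x) (aff C y) (aff A y) (aff B y)) => //;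
    first [by apply: pt_eq; rewrite ?e1 ?e2 ?e3 ?e4 /=; ring | lra].
- apply: (key b c a (aff B x) (aff C x) (aff A x) (aff B y) (aff C y) (aff A y)) => //;
    first [by apply: pt_eq; rewrite ?e1 ?e2 ?e3 ?e4 /=; ring | lra].
have [h3|h3] := leP (aff B y / aff B x) (aff C y / aff C x).
  apply: (key b c a (aff B x) (aff C x) (aff A x) (aff B y) (aff C y) (aff A y)) => //;
    first [by apply: pt_eq; rewrite ?e1 ?e2 ?e3 ?e4 /=; ring | lra].
apply: (key c a b (aff C x) (aff A x) (aff B x) (aff C y) (aff A y) (aff B y)) => //;
    first [by apply: pt_eq; rewrite ?e1 ?e2 ?e3 ?e4 /=; ring | lra].
Qed.

End Faces.

(** * Sample points in the faces around a vertex *)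

Section Samples.
Variable R : realFieldType.
Notation pt := (R * R)%type.
Implicit Types (p q x y z w v d r t u s : pt).
Variables (V : seq pt) (E : seq (pt * pt)) (L : R).
Hypothesis subH : subdivision V E.

(** Represents the incidence of [t] with the face that contains [x]. *)
Definition sample t x : Prop := [/\ instrict L x, ~ onH E x & sees E x t].

Lemma instrict_small t d : instrict L t -> small (fun h => instrict L (shift t d h)).
Proof.
move=> [t1 t2 t3].
apply: smallW (smallI (small_lin d.1 t1) (smallI (small_lin d.2 t2)
  (small_lin (- d.1 - d.2) t3))) => h h0 [h1 [h2 h3]].
by split=> /=; lra.
Qed.

Lemma sample_small t d : t \in V -> instrict L t -> d != (0, 0) ->
  (forall s, adj E t s -> cross d (vec t s) <> 0) ->
  small (fun h => sample t (shift t d h)).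
Proof.
move=> tV tL d0 nd; have nd' s : adj E t s -> forall a : R, 0 < a -> vec t s <> (a * d.1, a * d.2).
  by move=> ts a _ e; apply: (nd s ts); rewrite e /cross /=; ring.
apply: smallW (smallI (instrict_small d tL) (star_small subH tV d0 nd')).
by move=> h _ [? []].
Qed.

(** All edges at [t] lie on one line. The samples are taken along both normals, with [t] itself
    between them. *)
Lemma two_samples t d : t \in V -> instrict L t -> d != (0, 0) ->
  (forall s, adj E t s -> cross d (vec t s) = 0) ->
  exists f : bool -> pt, (forall b, sample t (f b)) /\
    (forall b b', b != b' -> ~ sees E (f b) (f b')).
Proof.
move=> tV tL d0 par; pose e : pt := (- d.2, d.1); pose e' : pt := (d.2, - d.1).
have dd := dot_gt0 d0.
have e0 : e != (0, 0) by apply: contraNneq d0 => -[/eqP]; rewrite oppr_eq0 => /eqP h1 h2; apply/eqP/pt_eq.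
have e'0 : e' != (0, 0) by apply: contraNneq d0 => -[h1 /eqP]; rewrite oppr_eq0 => /eqP h2; apply/eqP/pt_eq.
have nb s : adj E t s -> vec t s != (0, 0).
  by case=> /(sub_lex subH) /lexlt_neq /= h; apply: vec_neq0; rewrite // eq_sym.
have ne s : adj E t s -> cross e (vec t s) <> 0.
  move=> ts; have [k kE] := parallel d0 (par s ts).
  have kn : k != 0 by apply: contraNneq (nb s ts) => k0; rewrite kE k0 !mul0r.
  have -> : cross e (vec t s) = - k * (d.1 * d.1 + d.2 * d.2) by rewrite kE /cross /=; ring.
  by apply/eqP; rewrite mulf_neq0 ?oppr_eq0 // gt_eqF.
have ne' s : adj E t s -> cross e' (vec t s) <> 0.
  by move=> /ne h1 h2; apply: h1; move: h2; rewrite /cross /=; lra.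
have [h h0 [s1 s2]] := small_ex (smallI (sample_small tV tL e0 ne) (sample_small tV tL e'0 ne')).
exists (fun b : bool => shift t (if b then e else e') h); split; first by case.
have mid b : lerp (shift t (if b then e else e') h) (shift t (if ~~ b then e else e') h) (1 / 2) = t.
  by case: b; apply: pt_eq; rewrite /=; field.
move=> b b' bb' sb; apply: (sb (1 / 2)); first by lra.
have -> : b' = ~~ b by case: b b' bb' {sb} => -[].
by rewrite mid; apply: sub_onH subH _ tV.
Qed.

Lemma three_samples t d1 d2 : t \in V -> instrict L t -> cross d1 d2 != 0 ->
  (forall s, adj E t s -> cross d1 (vec t s) = 0 \/ cross d2 (vec t s) = 0) ->
  small (fun h => onH E (shift t d1 h)) -> small (fun h => onH E (shift t d2 h)) ->
  small (fun h => onH E (shift t (- d1.1, - d1.2) h)) ->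
  exists f : 'I_3 -> pt, (forall b, sample t (f b)) /\
    (forall b b', b != b' -> ~ sees E (f b) (f b')).
Proof.
move=> tV tL c12 par o1 o2 o3.
have nb s : adj E t s -> vec t s != (0, 0).
  by case=> /(sub_lex subH) /lexlt_neq /= h; apply: vec_neq0; rewrite // eq_sym.
have nz d : cross d1 d != 0 \/ cross d d2 != 0 -> d != (0, 0).
  by move=> h; apply/eqP => d0; move: h; rewrite d0 /cross /= !mulr0 !mul0r subrr eqxx => -[].
have smp (a b : R) : a != 0 -> b != 0 ->
    let d := (a * d1.1 + b * d2.1, a * d1.2 + b * d2.2) in
    small (fun h => sample t (shift t d h)).
  move=> a0 b0 d; have e1 : cross d1 d = b * cross d1 d2 by rewrite /cross /=; ring.
  have e2 : cross d d2 = a * cross d1 d2 by rewrite /cross /=; ring.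
  have d1n : d1 != (0, 0) by apply: nz; right.
  have d2n : d2 != (0, 0) by apply: nz; left.
  apply: sample_small => //; first by apply: nz; left; rewrite e1 mulf_neq0.
  move=> s ts c; case: (par s ts) => c'.
    have [k kE] := parallel d1n c'.
    have kn : k != 0 by apply: contraNneq (nb s ts) => k0; rewrite kE k0 !mul0r.
    have : k * (b * cross d1 d2) = 0 by rewrite -e1; move: c; rewrite kE /cross /=; lra.
    by apply/eqP; rewrite !mulf_neq0.
  have [k kE] := parallel d2n c'.
  have kn : k != 0 by apply: contraNneq (nb s ts) => k0; rewrite kE k0 !mul0r.
  have : k * (a * cross d1 d2) = 0 by rewrite -e2; move: c; rewrite kE /cross /=; lra.
  by apply/eqP; rewrite !mulf_neq0.
have n1 : (1 : R) != 0 by exact: oner_neq0.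
have nN1 : (-1 : R) != 0 by rewrite oppr_eq0.
have n2 : (-2 : R) != 0 by apply/eqP; lra.
have h2 : (0 : R) < 1 / 2 by lra.
(* The directions [d1 + d2], [d2 - 2 d1] and [d1 - d2] point into the three sectors cut out by the
   rays of [d1], [d2] and [- d1], and each segment joining two of the samples crosses one of these
   rays. *)
have [h h0 [[sa [sb sc]] [p1 [p2 p3]]]] := small_ex (smallI (smallI (smp 1 1 n1 n1) (smallI
  (smp (-2) 1 n2 n1) (smp 1 (-1) n1 nN1))) (smallI o1 (smallI o2 (small_scale h2 o3)))).
move: sa sb sc; set xa := shift t _ h => sa; set xb := shift t _ h => sb; set xc := shift t _ h => sc.
exists (fun i : 'I_3 => nth t [:: xa; xb; xc] i); split.
  by case=> -[|[|[|//]]] ?.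
have [_ na _] := sa; have [_ nbb _] := sb; have [_ nc _] := sc.
have ab : ~ sees E xa xb.
  move=> h1; apply: (h1 (1 / 3)); first by lra.
  suff -> : lerp xa xb (1 / 3) = shift t d2 h by [].
  by apply: pt_eq; rewrite /=; field.
have ac : ~ sees E xa xc.
  move=> h1; apply: (h1 (1 / 2)); first by lra.
  suff -> : lerp xa xc (1 / 2) = shift t d1 h by [].
  by apply: pt_eq; rewrite /=; field.
have bc : ~ sees E xb xc.
  move=> h1; apply: (h1 (1 / 2)); first by lra.
  suff -> : lerp xb xc (1 / 2) = shift t (- d1.1, - d1.2) (h * (1 / 2)) by [].
  by apply: pt_eq; rewrite /=; field.
have sym x y : ~ onH E y -> ~ sees E y x -> ~ sees E x y by move=> ny h1 /(sees_sym ny).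
by case=> -[|[|[|//]]] ? [] [|[|[|//]]] ? //= _; apply: sym.
Qed.

End Samples.

(** * Maximal compatible matchings *)

Section FromDefs.
Variables (R : realType) (n : nat) (G : geometric_graph R n).
Notation pt := (R * R)%type.
Implicit Types (i j k u v a b w : 'I_n) (e f : edge n) (x : 'rV[R]_2) (z : pt).

Definition toP x : pt := (x 0 0, x 0 1).
Definition vpos i : pt := toP (pos G i).
Notation P := vpos.

Lemma toP_inj : injective toP.
Proof.
move=> x y [h0 h1]; apply/rowP => j; case: j => -[|[|//]] p.
  by move: h0; congr (x _ _ = y _ _); apply: val_inj.
by move: h1; congr (x _ _ = y _ _); apply: val_inj.
Qed.

Lemma toP_lerp x y (t : R) : toP ((1 - t) *: x + t *: y) = lerp (toP x) (toP y) t.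
Proof. by apply: pt_eq; rewrite /= !mxE; ring. Qed.

Lemma P_inj : injective P.
Proof. by move=> i j /toP_inj /pos_inj. Qed.

Lemma set2_eq (T : finType) (p q r s : T) : [set p; q] = [set r; s] ->
  (p = r /\ q = s) \/ (p = s /\ q = r).
Proof.
move=> h; have hp : p \in [set r; s] by rewrite -h set21.
have hq : q \in [set r; s] by rewrite -h set22.
have hr : r \in [set p; q] by rewrite h set21.
have hs : s \in [set p; q] by rewrite h set22.
move: hp hq hr hs; rewrite !inE.
by do 4?[case/orP => /eqP ?]; subst; auto.
Qed.

Lemma edge_ends e : exists u v, u != v /\ val e = [set u; v].
Proof. by have /cards2P[u [v [uv ->]]] := valP e; exists u, v. Qed.

Lemma edge_of u v : u != v -> exists e, val e = [set u; v].
Proof.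
by move=> uv; have c : #|[set u; v]| == 2%N; [rewrite cards2 uv|exists (exist _ [set u; v] c)].
Qed.

Lemma on_segmentP e x u v : val e = [set u; v] -> on_segment G e x <-> seg (P u) (P v) (toP x).
Proof.
move=> eE; split=> [[u' [v' [t [eE' t01 ->]]]]|[t t01 xE]]; last first.
  by exists u, v, t; split=> //; apply: toP_inj; rewrite toP_lerp.
rewrite toP_lerp; rewrite eE in eE'; case: (set2_eq eE') => -[-> ->]; first exact: seg_lerp.
by apply: segC; apply: seg_lerp.
Qed.

Hypothesis gp : general_position G.

Lemma orientP i j k : uniq [:: i; j; k] -> orient (P i) (P j) (P k) != 0.
Proof.
move=> un; apply/eqP => o; apply: (gp un); have ij : i != j.
  by move: un; rewrite /= inE negb_or => /andP[/andP[]].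
exists (pos G i), (pos G j - pos G i); split.
  by rewrite subr_eq0; apply: contra ij => /eqP/pos_inj->.
have ijP : P i != P j by apply: contra ij => /eqP/P_inj->.
have [t tE] := orient0_lerp ijP o.
move=> y; rewrite !inE => /or3P[]/eqP->.
- by exists 0; rewrite scale0r addr0.
- by exists 1; rewrite scale1r addrC subrK.
exists t; apply: toP_inj; rewrite -/(P k) tE -toP_lerp; congr toP.
by rewrite scalerBr scalerBl scale1r addrAC addrA.
Qed.

Lemma orient0_ends i j k : i != j -> orient (P i) (P j) (P k) = 0 -> k = i \/ k = j.
Proof.
move=> ij o; have [->|ki] := eqVneq k i; first by left.
have [->|kj] := eqVneq k j; first by right.
have : uniq [:: i; j; k] by rewrite /= !inE negb_or ij eq_sym ki eq_sym kj.
by move/orientP; rewrite o eqxx.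
Qed.

Lemma seg_ends i j k : i != j -> seg (P i) (P j) (P k) -> k = i \/ k = j.
Proof. by move=> ij [t _ kE]; apply: orient0_ends ij _; rewrite kE orient_lerp. Qed.

Lemma relint_vertex e w : ~ in_relint G e (pos G w).
Proof.
move=> [a [b [t [eE t01 xE]]]]; have ab : a != b.
  by have : #|val e| == 2%N := valP e; rewrite eE cards2; case: (a != b).
have wE : P w = lerp (P a) (P b) t by rewrite -toP_lerp -xE.
have abP : P a != P b by apply: contra ab => /eqP/P_inj->.
have [] := orient0_ends ab (_ : orient (P a) (P b) (P w) = 0).
- by rewrite wE orient_lerp.
- move=> wa; have := @lerp_inj _ (P a) (P b) 0 t abP; rewrite lerp0 -wE wa => /(_ erefl); lra.
move=> wb; have := @lerp_inj _ (P a) (P b) 1 t abP; rewrite lerp1 -wE wb => /(_ erefl); lra.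
Qed.

(** In general position a line through two vertices contains no third one. So a common point that is
    an end of one edge is an end of both, and two edges with a common end meet nowhere else. *)
Lemma seg_meet_cases u v a b z : u != v -> a != b -> [set u; v] != [set a; b] ->
  seg (P u) (P v) z -> seg (P a) (P b) z ->
  (exists w, [/\ w \in [set u; v], w \in [set a; b] & z = P w]) \/
  [/\ [/\ a != u, a != v, b != u & b != v] &
      exists s t, [/\ 0 < s < 1, 0 < t < 1, z = lerp (P u) (P v) s & z = lerp (P a) (P b) t]].
Proof.
have share i j k y : uniq [:: i; j; k] -> seg (P i) (P j) y -> seg (P i) (P k) y -> y = P i.
  move=> /orientP o [s _ yE] [t _ yE'].
  have : orient (P i) (P j) y = 0 by rewrite yE orient_lerp.
  rewrite yE' (_ : orient _ _ _ = t * orient (P i) (P j) (P k)); last first.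
    by rewrite /orient /cross /=; ring.
  by move/eqP; rewrite mulf_eq0 (negPf o) orbF => /eqP->; rewrite lerp0.
move=> uv ab ne zuv zab.
have u3 i j k : i != j -> i != k -> j != k -> uniq [:: i; j; k].
  by move=> h1 h2 h3; rewrite /= !inE negb_or h1 h2 h3.
have [au|au] := eqVneq a u.
  left; exists u; rewrite !inE au eqxx; split=> //; apply: (share u v b) => //.
    apply: u3 => //; first by rewrite -au.
    by apply: contraNneq ne => ->; rewrite au.
  by rewrite -au.
have [av|av] := eqVneq a v.
  left; exists v; rewrite !inE av eqxx orbT; split=> //; apply: (share v u b) (segC zuv) _ => //.
    apply: u3; [by rewrite eq_sym|by rewrite -av|].
    by apply: contraNneq ne => ->; rewrite av setUC.
  by rewrite -av.
have [bu|bu] := eqVneq b u.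
  left; exists u; rewrite !inE bu eqxx orbT; split=> //; apply: (share u v a) => //.
    by apply: u3; rewrite // eq_sym.
  by apply: segC; rewrite -bu.
have [bv|bv] := eqVneq b v.
  left; exists v; rewrite !inE bv eqxx !orbT; split=> //; apply: (share v u a) (segC zuv) _ => //.
    by apply: u3; rewrite eq_sym.
  by apply: segC; rewrite -bv.
right; split=> //; case: (zuv) => s s01 zs; case: (zab) => t t01 zt; exists s, t; split=> //.
- rewrite !lt_neqAle; case/andP: (s01) => -> ->; rewrite !andbT; apply/andP; split; apply/eqP => h.
    by move: zab; rewrite zs -h lerp0 => /(seg_ends ab)[] e; [move: au|move: bu]; rewrite e eqxx.
  by move: zab; rewrite zs h lerp1 => /(seg_ends ab)[] e; [move: av|move: bv]; rewrite e eqxx.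
rewrite !lt_neqAle; case/andP: (t01) => -> ->; rewrite !andbT; apply/andP; split; apply/eqP => h.
  by move: zuv; rewrite zt -h lerp0 => /(seg_ends uv)[] e; [move: au|move: av]; rewrite e eqxx.
by move: zuv; rewrite zt h lerp1 => /(seg_ends uv)[] e; [move: bu|move: bv]; rewrite e eqxx.
Qed.

End FromDefs.

Section MaximalMatching.
Variables (R : realType) (n : nat) (G : geometric_graph R n).
Notation pt := (R * R)%type.
Notation P := (vpos G).
Implicit Types (i j k u v a b w : 'I_n) (e f : edge n) (x : 'rV[R]_2) (z : pt).
Hypothesis gp : general_position G.
Variable M : {set edge n}.
Hypothesis maxM : maximal_compatible_matching G M.

Definition unmatched u : bool := [forall e in M, u \notin val e].
Definition gadj i j : bool := [exists e in edges G, val e == [set i; j]].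
Definition eadj i j : bool := [exists e in edges G :|: M, val e == [set i; j]].

Lemma eadjP i j : reflect (exists2 e, e \in edges G :|: M & val e = [set i; j]) (eadj i j).
Proof.
apply: (iffP existsP) => [[e /andP[eA /eqP eE]]|[e eA eE]]; exists e => //.
by rewrite eA eE eqxx.
Qed.

Lemma gadjP i j : reflect (exists2 e, e \in edges G & val e = [set i; j]) (gadj i j).
Proof.
apply: (iffP existsP) => [[e /andP[eA /eqP eE]]|[e eA eE]]; exists e => //.
by rewrite eA eE eqxx.
Qed.

Lemma eadj_sym i j : eadj i j = eadj j i.
Proof. by apply/eadjP/eadjP => -[e eA eE]; exists e; rewrite // setUC. Qed.

Lemma edge_neq e i j : val e = [set i; j] -> i != j.
Proof.
by move=> eE; have : #|val e| == 2%N := valP e; rewrite eE cards2; case: (i != j).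
Qed.

Lemma eadj_neq i j : eadj i j -> i != j.
Proof. by move=> /eadjP[e _] /edge_neq. Qed.

Lemma gadj_eadj i j : gadj i j -> eadj i j.
Proof. by move=> /gadjP[e eG eE]; apply/eadjP; exists e; rewrite // inE eG. Qed.

Lemma unmatchedP u e : unmatched u -> e \in M -> u \notin val e.
Proof. by move=> /forallP/(_ e) /implyP. Qed.

Lemma eadj_unmatched u v : unmatched u -> eadj u v -> gadj u v.
Proof.
move=> uU /eadjP[e]; rewrite inE => /orP[eG eE|eM eE]; first by apply/gadjP; exists e.
by have := unmatchedP uU eM; rewrite eE set21.
Qed.

(* Otherwise the segment [u v] could be added to [M]. *)
Lemma unmatched_blocked u v : unmatched u -> unmatched v -> u != v -> ~~ gadj u v ->
  exists a b s t, [/\ eadj a b, 0 < s < 1, 0 < t < 1, uniq [:: u; v; a] /\ uniq [:: u; v; b] &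
    lerp (P u) (P v) s = lerp (P a) (P b) t :> pt].
Proof.
move=> uU vU uv nuv; have [[mM dM [_ ncM]] nex] := maxM; rewrite /= in ncM.
apply: contrapT => nb; apply: nex; have [e eE] := edge_of uv.
have eG : e \notin edges G by apply: contra nuv => eG; apply/gadjP; exists e.
have eM : e \notin M.
  by apply/negP => eM; have := unmatchedP uU eM; rewrite eE set21.
have euM f : f \in M -> [disjoint val e & val f].
  move=> fM; rewrite eE disjoints_subset; apply/subsetP => w; rewrite !inE.
  by case/orP => /eqP->; apply: unmatchedP.
have ends f : exists a b, [/\ a != b & val f = [set a; b]].
  by have [a [b [ab fE]]] := edge_ends f; exists a, b.
have new f x : f != e -> f \in edges G :|: M -> on_segment G e x -> on_segment G f x ->
    exists w, [/\ w \in val e, w \in val f & x = pos G w].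
  move=> fe fA xe xf; have [a [b [ab fE]]] := ends f.
  have ne : [set u; v] != [set a; b].
    by apply: contra fe => /eqP h; apply/eqP/val_inj; rewrite eE fE.
  have := seg_meet_cases gp uv ab ne (proj1 (on_segmentP G x eE) xe) (proj1 (on_segmentP G x fE) xf).
  case=> [[w [w1 w2 /toP_inj xw]]|[[n1 n2 n3 n4] [s [t [s01 t01 z1 z2]]]]].
    by exists w; rewrite eE fE.
  case: nb; exists a, b, s, t; split=> //; first by apply/eadjP; exists f.
    by rewrite /= !inE !negb_or uv ![_ == a]eq_sym ![_ == b]eq_sym n1 n2 n3 n4.
  by rewrite -z1 z2.
exists (e |: M); split; last by rewrite properUr // sub1set.
split.
- move=> f g; rewrite !inE => /orP[/eqP->|fM] /orP[/eqP->|gM] fg.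
  + by rewrite eqxx in fg.
  + exact: euM.
  + by rewrite disjoint_sym; apply: euM.
  exact: mM.
- by rewrite disjoints_subset subUset sub1set inE eG -disjoints_subset.
split.
  by move=> f w _; apply: (relint_vertex gp).
have inA f : f \in edges (add_edges G (e |: M)) -> f != e -> f \in edges G :|: M.
  by rewrite /= !inE => /or3P[->//|->//|->]; rewrite orbT.
move=> f g fA gA fg x xf xg.
have [fe|fe] := eqVneq f e.
  have ge : g != e by rewrite -fe eq_sym.
  rewrite fe in xf *; exact: new ge (inA g gA ge) xf xg.
have [ge|ge] := eqVneq g e.
  rewrite ge in xg *; have [w [w1 w2 w3]] := new f x fe (inA f fA fe) xg xf.
  by exists w.
exact: ncM f g (inA f fA fe) (inA g gA ge) fg x xf xg.
Qed.

Definition nonisolated i : bool := [exists j, eadj i j].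

Lemma box_exists : exists2 L : R, 0 < L & forall i, instrict L (P i).
Proof.
pose L := 1 + \sum_i (`|(P i).1| + `|(P i).2|) : R.
have s0 : 0 <= \sum_i (`|(P i).1| + `|(P i).2|).
  by apply: sumr_ge0 => i _; rewrite addr_ge0.
exists L; first by rewrite /L; lra.
move=> i; have : `|(P i).1| + `|(P i).2| <= \sum_i (`|(P i).1| + `|(P i).2|).
  by rewrite (bigD1 i) //= lerDl sumr_ge0 // => j _; rewrite addr_ge0.
have := ler_norm (P i).1; have := ler_norm (- (P i).1); rewrite normrN.
have := ler_norm (P i).2; have := ler_norm (- (P i).2); rewrite normrN.
have := normr_ge0 (P i).1; have := normr_ge0 (P i).2.
by rewrite /L => *; split; lra.
Qed.

Lemma convex_extension : exists (L : R) V E,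
  [/\ subdivision V E, local_max_global V E, uniq V,
      (size E <= size V + #|edges G :|: M|)%N & forall z, instrict L z -> inside V z] /\
  [/\ forall i, instrict L (P i), forall i, nonisolated i -> P i \in V,
      forall i j z, eadj i j -> seg (P i) (P j) z -> onH E z,
      forall i, ~~ nonisolated i -> ~ onH E (P i) &
      forall i, nonisolated i ->
        (forall s, adj E (P i) s -> exists2 j, eadj i j & cross (vec (P i) (P j)) (vec (P i) s) = 0) /\
        (exists2 j, eadj i j & small (fun h => onH E (shift (P i) (vec (P j) (P i)) h)))].
Proof.
have [L L0 inL] := box_exists.
have [f fP] : {f : edge n -> 'I_n * 'I_n & forall e, val e = [set (f e).1; (f e).2]}.
  apply: (@choice _ _ (fun e (p : 'I_n * 'I_n) => val e = [set p.1; p.2])) => e.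
  by have [u [v [_ ->]]] := edge_ends e; exists (u, v).
have fneq e : (f e).1 != (f e).2 := edge_neq (fP e).
pose ep e := sort_pair (P (f e).1) (P (f e).2).
pose OE := [seq ep e | e <- enum (edges G :|: M)].
pose O := [seq P i | i <- enum nonisolated].
pose Q := [seq P i | i <- enum (predC nonisolated)].
(* The neighbour must be a function of the point, not of the index; this is consistent because [P]
   is injective. *)
have [g gP] : {g : pt -> pt & forall i, nonisolated i -> exists2 j, eadj i j & g (P i) = P j}.
  suff [g gP] : {g : pt -> pt & forall z i, z = P i -> nonisolated i ->
      exists2 j, eadj i j & g z = P j} by exists g => i; apply: gP.
  apply: (@choice _ _ (fun z y => forall i, z = P i -> nonisolated i ->
    exists2 j, eadj i j & y = P j)) => z.
  have [[i [zi ni]]|nz] := EM (exists i, z = P i /\ nonisolated i); last first.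
    by exists z => i zi ni; case: nz; exists i.
  have /existsP[j ij] := ni; exists (P j) => i' zi' _; exists j => //.
  by rewrite -(P_inj (etrans (esym zi) zi')).
have OP i : (P i \in O) = nonisolated i.
  by rewrite mem_map ?mem_enum //; apply: P_inj.
have nonl i j : eadj i j -> nonisolated i by move=> ij; apply/existsP; exists j.
have nonr i j : eadj i j -> nonisolated j by rewrite eadj_sym => /nonl.
have OEP c : c \in OE -> exists i j, [/\ eadj i j, c = (P i, P j) & lexlt (P i) (P j)].
  move=> /mapP[d]; rewrite mem_enum => dA ->; rewrite /ep /sort_pair.
  have dd : eadj (f d).1 (f d).2 by apply/eadjP; exists d.
  case: ifP => [lt|/negbT nlt]; first by exists (f d).1, (f d).2.
  exists (f d).2, (f d).1; rewrite eadj_sym; split=> //; apply: lexlt_total nlt.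
  by apply: contra (fneq d) => /eqP/P_inj->.
have OEadj i j : eadj i j -> adj OE (P i) (P j).
  move=> /eadjP[d dA dE]; have : ep d \in OE by apply/mapP; exists d; rewrite ?mem_enum.
  rewrite /adj /ep /sort_pair; have := fP d; rewrite dE => /set2_eq.
  by case=> -[-> ->]; case: ifP => _ h; auto.
have adjOE i s : adj OE (P i) s -> exists2 j, eadj i j & s = P j.
  case=> /OEP[a [b [ab c _]]].
    by exists b; [rewrite (P_inj (congr1 fst c))|exact (congr1 snd c)].
  by exists a; [rewrite (P_inj (congr1 snd c)) eadj_sym|exact (congr1 fst c)].
have OEseg i j z : eadj i j -> seg (P i) (P j) z -> onH OE z.
  by move=> /OEadj; apply: adj_onH.
have ncA : forall d d' x, d \in edges G :|: M -> d' \in edges G :|: M -> d != d' ->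
    on_segment G d x -> on_segment G d' x -> exists w, [/\ w \in val d, w \in val d' & x = pos G w].
  by case: maxM => -[_ _ [_ nc]] _ d d' x dA d'A dd; apply: nc.
have OEmeet d d' z : d \in OE -> d' \in OE -> d != d' ->
    seg d.1 d.2 z -> seg d'.1 d'.2 z -> z \in O.
  move=> /mapP[c cA ->] /mapP[c' c'A ->] ne /seg_sort_pair s1 /seg_sort_pair s2.
  rewrite !mem_enum in cA c'A.
  have [x xz] : exists x, toP x = z.
    exists (\row_j (if j == 0 then z.1 else z.2)); apply: pt_eq; rewrite /= !mxE //.
  have cc : c != c' by apply: contra ne => /eqP->.
  have [w [wc _ xw]] : exists w, [/\ w \in val c, w \in val c' & x = pos G w].
    by apply: (ncA c c' x) => //; apply/(on_segmentP G _ (fP _)); rewrite xz.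
  rewrite -xz xw OP; move: wc; rewrite fP !inE.
  have c12 : eadj (f c).1 (f c).2 by apply/eadjP; exists c.
  by case/orP => /eqP->; [apply: nonl c12|apply: nonr c12].
(* The arguments discharge the hypotheses of [extension_graph] in order; those about points on edges
   and on lines come from general position. *)
have [V [E [[h1 h2 h3 h4 h5] [k1 k2 k3 k4 k5]]]] := @extension_graph R L O OE g Q L0
  (etrans (map_inj_uniq (@P_inj _ _ G) _) (enum_uniq _))
  (fun o => ltac:(by move=> /mapP[i _ ->])) (fun q => ltac:(by move=> /mapP[i _ ->]))
  (fun c => ltac:(by move=> /OEP[i [j [ij -> _]]]; rewrite /= !OP (nonl _ _ ij) (nonr _ _ ij)))
  (fun c => ltac:(by move=> /OEP[i [j [_ -> ?]]]))
  (fun c o => ltac:(by move=> /OEP[i [j [ij -> _]]] /mapP[k _ ->] /= /(seg_ends gp (eadj_neq ij))[] ->;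
     [left|right]))
  OEmeet
  (fun q => ltac:(by move=> /mapP[k]; rewrite mem_enum => nk -> [c /OEP[i [j [ij -> _]]] /=
     /(seg_ends gp (eadj_neq ij))[] ki]; case/negP: nk; rewrite ki; [apply: nonl ij|apply: nonr ij]))
  (fun o => ltac:(by move=> /mapP[i]; rewrite mem_enum => ni ->; have [j ij ->] := gP i ni;
     apply: OEadj))
  (fun o o' => ltac:(by move=> /mapP[i]; rewrite mem_enum => ni -> /mapP[k _ ->];
     have [j ij ->] := gP i ni; move/(orient0_ends gp (eadj_neq ij)) => [] ->; [left|right]))
  (fun o q => ltac:(by move=> /mapP[i]; rewrite mem_enum => ni -> /mapP[k];
     rewrite mem_enum => nk ->; have [j ij ->] := gP i ni;
     move/(orient0_ends gp (eadj_neq ij)) => [] ki; case/negP: nk; rewrite ki;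
     [apply: nonl ij|apply: nonr ij])).
exists L, V, E; split; split=> //.
- by rewrite size_map -cardE in h4.
- by move=> i ni; apply: k1; rewrite OP.
- by move=> i j z ij h; apply: k2; apply: OEseg ij h.
- by move=> i ni; apply: k3; apply/mapP; exists i; rewrite ?mem_enum.
move=> i ni; split.
  move=> s; have oi : P i \in O by rewrite OP.
  move=> /(k4 _ _ oi)[s0 /adjOE[j ij ->] c]; by exists j.
have [j ij gE] := gP i ni; exists j => //; rewrite -gE; apply: k5; by rewrite OP.
Qed.

End MaximalMatching.

(** * Incidences of unmatched vertices and faces *)

Section Counting.

Lemma opposite_signs (R : realFieldType) (t p q : R) : p != 0 -> 0 < t < 1 ->
  (1 - t) * p + t * q = 0 -> p * q < 0.
Proof.
move=> p0 /andP[t0 t1] pq; have p2 : 0 < p * p by rewrite -expr2 exprn_even_gt0.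
have h : 0 < (1 - t) * (p * p) by rewrite mulr_gt0 ?subr_gt0.
rewrite -(pmulr_rlt0 _ t0).
have : p * ((1 - t) * p + t * q) = 0 by rewrite pq mulr0.
lra.
Qed.

Lemma sum_bool_le1 (T : finType) (A : {set T}) (p : pred T) :
  (forall x y, x \in A -> y \in A -> p x -> p y -> x = y) ->
  (\sum_(x in A) p x <= 1)%N.
Proof.
move=> h; have [/existsP[x /andP[xA px]]|/existsPn n] := boolP [exists x in A, p x].
  rewrite (bigD1 x) //= px big1 ?addn0 // => y /andP[yA yx].
  by case: (boolP (p y)) => // py; case/eqP: yx; apply: h.
by rewrite big1 // => x xA; have := n x; rewrite xA /=; case: (p x).
Qed.

Variables (R : realType) (n : nat) (G : geometric_graph R n).
Notation pt := (R * R)%type.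
Notation P := (vpos G).
Implicit Types (u v a b w : 'I_n) (e f : edge n) (z : pt).

Lemma sum_edges (A : {set edge n}) : (\sum_i \sum_(e in A) (i \in val e) = 2 * #|A|)%N.
Proof.
rewrite exchange_big /= (eq_bigr (fun=> 2%N)) => [|e _].
  by rewrite sum_nat_const mulnC.
rewrite -[RHS](eqP (valP e)) -sum1_card [RHS]big_mkcond /=.
by apply: eq_bigr => i _; case: (_ \in _).
Qed.

Lemma handshake d : regular G d -> (n * d = 2 * #|edges G|)%N.
Proof.
move=> reg; rewrite -sum_edges -{1}(card_ord n) -sum_nat_const; apply: eq_bigr => i _.
by rewrite -(reg i) /degree -sum1dep_card big_mkcondr.
Qed.

Definition nbrs u : {set 'I_n} := [set v | gadj G u v].

Lemma card_nbrs u : #|nbrs u| = degree G u.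
Proof.
pose other e := odflt u [pick v in val e :\ u].
have otherE e v : val e = [set u; v] -> other e = v.
  move=> eE; have uv := edge_neq eE; rewrite /other; case: pickP => [w|/(_ v)].
    by rewrite eE !inE => /andP[/negPf->] /= /eqP.
  by rewrite eE !inE eqxx orbT andbT eq_sym uv.
have ends e : u \in val e -> exists v, val e = [set u; v].
  have [a [b [_ eE]]] := edge_ends e; rewrite eE !inE => /orP[]/eqP->; first by exists b.
  by exists a; rewrite setUC.
rewrite /degree -(card_in_imset (f := other) (D := mem [set e in edges G | u \in val e])).
  apply: eq_card => v; rewrite inE; apply/gadjP/imsetP => [[e eG eE]|[e]].
    by exists e; rewrite ?inE ?eG ?eE ?set21 // (otherE e v).
  rewrite inE => /andP[eG /ends[w eE]] ->; exists e => //.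
  by rewrite (otherE e w).
move=> e f; rewrite !inE => /andP[_ /ends[v eE]] /andP[_ /ends[w fE]].
by rewrite (otherE e v) // (otherE f w) // => vw; apply: val_inj; rewrite /= eE fE vw.
Qed.

Hypothesis gp : general_position G.
Variable M : {set edge n}.
Hypothesis maxM : maximal_compatible_matching G M.

Lemma card_unmatched : (#|[set u | unmatched M u]| + 2 * #|M| = n)%N.
Proof.
have [[mM _ _] _] := maxM.
have -> : #|[set u | unmatched M u]| = (\sum_u unmatched M u)%N.
  by rewrite -sum1_card big_mkcond; apply: eq_bigr => i _; rewrite inE; case: (unmatched M i).
rewrite -sum_edges -big_split /= -[RHS]card_ord -sum1_card; apply: eq_bigr => i _.
have le1 : (\sum_(e in M) (i \in val e) <= 1)%N.
  apply: sum_bool_le1 => e f eM fM ie jf; apply/eqP; apply: contrapT => /negP ef.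
  have := mM e f eM fM ef; rewrite disjoints_subset => /subsetP/(_ i ie).
  by rewrite inE jf.
have [un|/forallPn[e]] := boolP (unmatched M i).
  by rewrite big1 // => e eM; rewrite (negPf (unmatchedP un eM)).
rewrite negb_imply negbK => /andP[eM ie]; move: le1.
by rewrite (bigD1 e) //= ie; lia.
Qed.

Lemma cardA : #|edges G :|: M| = (#|edges G| + #|M|)%N.
Proof.
have [[_ dM _] _] := maxM; rewrite cardsU (_ : _ :&: _ = set0) ?cards0 ?subn0 //.
by apply/eqP; rewrite setI_eq0 disjoint_sym.
Qed.

(** Unmatched vertices are isolated here and pairwise blocked by edges of [M], so they serve
    themselves as separated points; [cell_bound] allows [#|M| + 1] of them. *)
Lemma bound_0_regular : regular G 0 -> (n <= 3 * #|M| + 1)%N.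
Proof.
move=> reg; have [L [V [E [[h1 h2 h3 h4 h5] [k1 k2 k3 k4 k5]]]]] := convex_extension gp maxM.
have e0 : #|edges G| = 0%N by have := handshake reg; rewrite muln0; lia.
have ng u v : ~~ gadj G u v.
  apply/negP => /gadjP[e eG _]; move: e0; rewrite (cardD1 e) eG; lia.
pose X := [seq P u | u <- enum [set u | unmatched M u]].
have niso u : unmatched M u -> ~~ nonisolated G M u.
  by move=> un; apply/negP => /existsP[v /(eadj_unmatched un)]; apply/negP.
have := cell_bound h1 h2 (X := X) h3; rewrite map_inj_uniq ?enum_uniq; last exact: P_inj.
rewrite size_map -cardE => /(_ isT) cb.
have {cb} : (#|[set u | unmatched M u]| + size V <= size E + 1)%N.
  apply: cb => [x|x y] /mapP[u]; rewrite mem_enum inE => un ->.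
    by split; [apply: h5|apply: k4; apply: niso].
  move=> /mapP[v]; rewrite mem_enum inE => vn -> uv.
  have uv' : u != v by apply: contra uv => /eqP->.
  have [a [b [s [t [ab s01 t01 _ st]]]]] := unmatched_blocked gp maxM un vn uv' (ng u v).
  move=> /(_ s); rewrite st; apply; first by lra.
  by apply: k3 ab _; apply: seg_lerp; lra.
have := card_unmatched; move: h4; rewrite cardA e0; lia.
Qed.

Section Classes.
Variables (L : R) (V : seq pt) (E : seq (pt * pt)).
Hypothesis subH : subdivision V E.
Hypothesis lmg : local_max_global V E.
Hypothesis uV : uniq V.
Hypothesis sizeE : (size E <= size V + #|edges G :|: M|)%N.
Hypothesis insL : forall z, instrict L z -> inside V z.
Hypothesis onE : forall i j z, eadj G M i j -> seg (P i) (P j) z -> onH E z.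
(** An index is an incidence: [o i] is an unmatched vertex and [x i] a sample in one of the faces
    around it. *)
Variables (I : finType) (o : I -> 'I_n) (x : I -> pt).
Hypothesis un : forall i, unmatched M (o i).
Hypothesis niso : forall i, nonisolated G M (o i).
Hypothesis smp : forall i, sample E L (P (o i)) (x i).
Hypothesis sepx : forall i j, i != j -> o i = o j -> ~ sees E (x i) (x j).

Definition same_cell (i j : I) : bool := (i == j) || `[< sees E (x i) (x j) >].

Lemma sample_off i : ~ onH E (x i). Proof. by case: (smp i). Qed.
Lemma sample_in i : inside V (x i). Proof. by apply: insL; case: (smp i). Qed.

Lemma same_cell_equiv : {in [set: I] & &, equivalence_rel same_cell}.
Proof.
have sym i j : same_cell i j -> same_cell j i.
  rewrite /same_cell eq_sym => /orP[->//|/asboolP h]; apply/orP; right; apply/asboolP.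
  by apply: sees_sym h; apply: sample_off.
have tr i j k : same_cell i j -> same_cell j k -> same_cell i k.
  rewrite /same_cell => /orP[/eqP->//|/asboolP ij] /orP[/eqP<-|/asboolP jk].
    by apply/orP; right; apply/asboolP.
  apply/orP; right; apply/asboolP.
  by have := sees_trans subH lmg (sample_in j) (@sample_off i) (sees_sym (@sample_off j) ij) jk.
move=> i j k _ _ _; split; first by rewrite /same_cell eqxx.
by move=> ij; apply/idP/idP; apply: tr => //; apply: sym.
Qed.

Definition cells : {set {set I}} := equivalence_partition same_cell [set: I].

Lemma cells_partition : partition cells [set: I].
Proof. exact: equivalence_partitionP same_cell_equiv. Qed.

Lemma cells_same K i j : K \in cells -> i \in K -> (j \in K) = same_cell i j.
Proof.
move=> KP iK; have /and3P[_ tr _] := cells_partition.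
rewrite -(def_pblock tr KP iK); apply: pblock_equivalence_partition => //.
exact: same_cell_equiv.
Qed.

(** A transversal of the cells consists of points that do not see each other. *)
Lemma card_cells : (#|cells| <= #|edges G :|: M| + 1)%N.
Proof.
have tr := transversalP cells_partition.
rewrite -(card_transversal tr); set Tr := transversal _ _ in tr *.
have sep i j : i \in Tr -> j \in Tr -> i != j -> ~ sees E (x i) (x j).
  move=> iT jT ij sij; case/eqP: ij.
  apply: (pblock_inj tr) => //; apply/esym/eqP.
  have /and3P[cv tI n0] := cells_partition.
  rewrite eq_pblock // ?(eqP cv) // pblock_equivalence_partition //; last exact: same_cell_equiv.
  by rewrite /same_cell; apply/orP; right; apply/asboolP; apply: sees_sym sij; apply: sample_off.
have xinj : {in Tr &, injective x}.
  move=> i j iT jT xij; apply/eqP; apply: contrapT => /negP ij.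
  apply: (sep i j iT jT ij) => t _; rewrite xij.
  have -> : lerp (x j) (x j) t = x j by apply: pt_eq; rewrite /=; ring.
  exact: sample_off.
have := cell_bound subH lmg (X := [seq x i | i <- enum Tr]) uV.
rewrite map_inj_in_uniq ?enum_uniq; last by move=> i j; rewrite !mem_enum; apply: xinj.
rewrite size_map -cardE => /(_ isT) cb.
suff : (#|Tr| + size V <= size E + 1)%N by move: sizeE; lia.
apply: cb => [y|y y'] /mapP[i]; rewrite mem_enum => iT ->.
  by split; [apply: sample_in|apply: sample_off].
move=> /mapP[j]; rewrite mem_enum => jT -> xij; apply: sep => //.
by apply: contra xij => /eqP->.
Qed.

Lemma cell_sees K i j : K \in cells -> i \in K -> j \in K -> sees E (x i) (P (o j)).
Proof.
move=> KP iK; rewrite (cells_same _ KP iK) => /orP[/eqP<-|/asboolP ij]; first by case: (smp i).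
have [_ nj jP] := smp j.
exact: (sees_trans subH lmg (sample_in j) (@sample_off i) (sees_sym nj ij) jP).
Qed.

(** For nonadjacent vertices, maximality provides an edge crossing the segment between them. As
    [x i] sees both vertices, [crossing_blocks] forbids this. *)
Lemma cell_gadj K i j : K \in cells -> i \in K -> j \in K -> o i != o j -> gadj G (o i) (o j).
Proof.
move=> KP iK jK oij; apply: contrapT => /negP ng.
have [a [b [s [t [ab s01 t01 [u1 u2] st]]]]] := unmatched_blocked gp maxM (un i) (un j) oij ng.
have on k : onH E (P (o k)).
  by have /existsP[l kl] := niso k; apply: onE kl _; apply: segl.
have o1 := orientP gp u1; have o2 := orientP gp u2.
have t01' : 0 <= t <= 1 by lra.
apply: (crossing_blocks subH lmg (c := P a) (c' := P b) (sample_in i) (@sample_off i)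
  (cell_sees KP iK iK) (cell_sees KP iK jK) (on i) (on j) s01).
- set p := orient _ _ (P a) in o1 *; set q := orient _ _ (P b) in o2 *.
  have : (1 - t) * p + t * q = 0.
    have := orient_lerp (P (o i)) (P (o j)) s; rewrite st -aff_orientl aff_lerp !aff_orientl.
    by rewrite /p /q => <-.
  exact: opposite_signs.
- move=> z h; apply: onE ab _; apply: seg_sub h; last exact: segl.
  by rewrite st; apply: seg_lerp.
move=> z h; apply: onE ab _; apply: seg_sub h; last exact: segr.
by rewrite st; apply: seg_lerp.
Qed.

Lemma cell_inj K : K \in cells -> {in K &, injective o}.
Proof.
move=> KP i j iK jK oij; apply/eqP; apply: contrapT => /negP ij.
move: jK; rewrite (cells_same _ KP iK) /same_cell (negPf ij) => /asboolP.
exact: sepx.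
Qed.

Lemma cell_clique K u : K \in cells -> u \in o @: K -> o @: K \subset u |: nbrs u.
Proof.
move=> KP /imsetP[i iK ->]; apply/subsetP => v /imsetP[j jK ->].
rewrite !inE; case: eqVneq => //= ji; apply: (cell_gadj KP iK jK).
by rewrite eq_sym.
Qed.

Lemma card_cell d K : regular G d -> K \in cells -> (#|K| <= d.+1)%N.
Proof.
move=> reg KP; rewrite -(card_in_imset (cell_inj KP)).
have [->|[u uK]] := set_0Vmem (o @: K); first by rewrite cards0.
apply: leq_trans (subset_leq_card (cell_clique KP uK)) _.
by rewrite (leq_trans (leq_card_setU _ _)) // cards1 card_nbrs reg.
Qed.

(** A cell with three vertices exhausts the closed neighbourhood of each of them. Two such cells at
    [u] therefore have the same three vertices, which form a triangle of [G], and
    [triangle_one_cell] merges them. *)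
Lemma triangle_cell_unique K K' u : regular G 2 -> K \in cells -> K' \in cells ->
  #|K| = 3%N -> #|K'| = 3%N -> u \in o @: K -> u \in o @: K' -> K = K'.
Proof.
move=> reg KP KP' cK cK' uK uK'.
have full C : C \in cells -> #|C| = 3%N -> u \in o @: C -> o @: C = u |: nbrs u.
  move=> CP cC uC; apply/eqP; rewrite eqEcard cell_clique // (card_in_imset (cell_inj CP)) cC.
  by rewrite (leq_trans (leq_card_setU _ _)) // cards1 card_nbrs reg.
have eK := full K KP cK uK; have eK' := full K' KP' cK' uK'.
have /cards2P[b [c [bc nE]]] : #|nbrs u| == 2%N by rewrite card_nbrs reg.
have /gadj_eadj-/(_ M) ub : gadj G u b by have := set21 b c; rewrite -nE inE.
have /gadj_eadj-/(_ M) uc : gadj G u c by have := set22 b c; rewrite -nE inE.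
have mem (C : {set I}) : o @: C = u |: nbrs u -> [/\ u \in o @: C, b \in o @: C & c \in o @: C].
  by move=> ->; rewrite nE !inE !eqxx !orbT.
have [/imsetP[i iK uE] /imsetP[j jK bE] /imsetP[k kK cE]] := mem K eK.
have [/imsetP[i' iK' uE'] /imsetP[j' jK' bE'] /imsetP[k' kK' cE']] := mem K' eK'.
have bce : eadj G M b c.
  by apply: gadj_eadj; rewrite bE cE; apply: (cell_gadj KP jK kK); rewrite -bE -cE.
have un3 : uniq [:: u; b; c] by rewrite /= !inE negb_or (eadj_neq ub) (eadj_neq uc) bc.
have cu : eadj G M c u by rewrite eadj_sym.
have s : sees E (x i) (x i').
  apply: (triangle_one_cell subH lmg (sample_in i) (sample_in i') (@sample_off i) (@sample_off i')
    (orientP gp un3)).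
  - by rewrite uE; apply: (cell_sees KP iK iK).
  - by rewrite bE; apply: (cell_sees KP iK jK).
  - by rewrite cE; apply: (cell_sees KP iK kK).
  - by rewrite uE'; apply: (cell_sees KP' iK' iK').
  - by rewrite bE'; apply: (cell_sees KP' iK' jK').
  - by rewrite cE'; apply: (cell_sees KP' iK' kK').
  - by move=> z; apply: onE ub.
  - by move=> z; apply: onE bce.
  by move=> z; apply: onE cu.
have i'K : i' \in K.
  by rewrite (cells_same _ KP iK) /same_cell; apply/orP; right; apply/asboolP.
have /and3P[_ tr _] := cells_partition.
by rewrite -(def_pblock tr KP i'K) (def_pblock tr KP' iK').
Qed.

End Classes.

(** Common frame for the 1-regular and the 2-regular case, with [J] indexing the faces around an
    unmatched vertex; only the samples and the arithmetic are left to each case. *)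
Lemma sampled_cells (J : finType) : (forall u, unmatched M u -> nonisolated G M u) ->
  (forall (L : R) V E u, subdivision V E -> instrict L (P u) -> P u \in V -> unmatched M u ->
     (forall j z, eadj G M u j -> seg (P u) (P j) z -> onH E z) ->
     (forall s, adj E (P u) s ->
        exists2 j, eadj G M u j & cross (vec (P u) (P j)) (vec (P u) s) = 0) ->
     (exists2 j, eadj G M u j & small (fun h => onH E (shift (P u) (vec (P j) (P u)) h))) ->
     exists f : J -> pt, (forall b : J, sample E L (P u) (f b)) /\
       (forall b b' : J, b != b' -> ~ sees E (f b) (f b'))) ->
  exists C : {set {set ({u | unmatched M u} * J)}},
  [/\ partition C setT, (#|C| <= #|edges G :|: M| + 1)%N,
      forall K d, regular G d -> K \in C -> (#|K| <= d.+1)%N,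
      forall K, K \in C -> {in K &, injective (fun i => val i.1)} &
      forall K K' u, regular G 2 -> K \in C -> K' \in C -> #|K| = 3%N -> #|K'| = 3%N ->
        u \in [set val i.1 | i in K] -> u \in [set val i.1 | i in K'] -> K = K'].
Proof.
move=> iso samples; have [L [V [E [[h1 h2 h3 h4 h5] [k1 k2 k3 k4 k5]]]]] := convex_extension gp maxM.
have [f fP] : {f : {u | unmatched M u} -> J -> pt & forall c,
    (forall b : J, sample E L (P (val c)) (f c b)) /\
    (forall b b' : J, b != b' -> ~ sees E (f c b) (f c b'))}.
  apply: (@choice _ _ (fun (c : {u | unmatched M u}) (g : J -> pt) =>
    (forall b : J, sample E L (P (val c)) (g b)) /\
    (forall b b' : J, b != b' -> ~ sees E (g b) (g b')))) => -[u un] /=.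
  have ni := iso u un; have [a b] := k5 u ni.
  by apply: (samples L V E u) => //; [apply: k2|move=> j z; apply: k3].
pose o (i : {u | unmatched M u} * J) := val i.1; pose x (i : {u | unmatched M u} * J) := f i.1 i.2.
have un i : unmatched M (o i) by apply: (valP i.1).
have ni i : nonisolated G M (o i) by apply: iso.
have smp i : sample E L (P (o i)) (x i) by apply: (proj1 (fP i.1)).
have sepx i j : i != j -> o i = o j -> ~ sees E (x i) (x j).
  case: i j => [u b] [v c] /= ij /val_inj/= uv; rewrite /x /= -uv.
  apply: (proj2 (fP u)); apply: contra ij => /eqP->; by rewrite uv.
exists (cells E x); split.
- exact: (cells_partition h1 h2 h5 smp).
- exact: (card_cells h1 h2 h3 h4 h5 smp).
- by move=> K d reg KP; apply: (card_cell h1 h2 h5 k3 un ni smp sepx reg KP).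
- by move=> K KP; apply: (cell_inj h1 h2 h5 smp sepx KP).
by move=> K K' u; apply: (triangle_cell_unique h1 h2 h5 k3 un ni smp sepx).
Qed.

Lemma eadj_nbrs u v : unmatched M u -> eadj G M u v -> v \in nbrs u.
Proof. by move=> un /(eadj_unmatched un); rewrite inE. Qed.

Lemma regular_nonisolated d u : regular G d.+1 -> nonisolated G M u.
Proof.
move=> reg; have : (0 < #|nbrs u|)%N by rewrite card_nbrs reg.
by move=> /card_gt0P[v]; rewrite inE => /gadj_eadj uv; apply/existsP; exists v.
Qed.

Lemma card_sub_unmatched : #|{: {u | unmatched M u}}| = #|[set u | unmatched M u]|.
Proof. by rewrite card_sig; apply: eq_card => u; rewrite !inE. Qed.

(** With [u] unmatched vertices, two samples each and at most two in a cell give [u <= #|C|]. Here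
    [#|C| <= n / 2 + #|M| + 1] and [u = n - 2 #|M|]. *)
Lemma bound_1_regular : regular G 1 -> (n <= 6 * #|M| + 2)%N.
Proof.
move=> reg; have [||C [pC cC szC _ _]] := @sampled_cells bool.
- by move=> u _; apply: regular_nonisolated reg.
- move=> L V E u h1 inL uV un on par _.
  have /cards1P[v vE] : #|nbrs u| == 1%N by rewrite card_nbrs reg.
  have uv : u != v by have : v \in nbrs u; [rewrite vE set11|rewrite inE => /gadj_eadj-/(_ M)/eadj_neq].
  apply: (two_samples (d := vec (P u) (P v)) h1 uV inL).
    by apply: vec_neq0; apply: contra uv => /eqP/P_inj->.
  move=> s /par[j /(eadj_nbrs un)]; rewrite vE inE => /eqP->.
  done.
have := card_unmatched; have := handshake reg; rewrite cardA in cC.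
have : (#|{: {u | unmatched M u} * bool}| <= 2 * #|C|)%N.
  rewrite -cardsT (card_partition pC) mulnC -sum_nat_const; apply: leq_sum => K.
  exact: szC.
by rewrite card_prod card_bool card_sub_unmatched muln1; move: cC; lia.
Qed.

(** With [u] unmatched vertices and [t] cells of size three, [3 u <= 2 #|C| + t] and [3 t <= u] give
    [4 u <= 3 #|C|]. Here [#|C| <= n + #|M| + 1] and [u = n - 2 #|M|]. *)
Lemma bound_2_regular : regular G 2 -> (n <= 11 * #|M| + 3)%N.
Proof.
move=> reg; have [||C [pC cC szC inj tri]] := @sampled_cells 'I_3.
- by move=> u _; apply: regular_nonisolated reg.
- move=> L V E u h1 inL uV un on par [v uv sv].
  have /cards2P[a [b [ab nE]]] : #|nbrs u| == 2%N by rewrite card_nbrs reg.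
  have [w [vw uw nE']] : exists w, [/\ v != w, eadj G M u w & nbrs u = [set v; w]].
    have ua : eadj G M u a by apply: gadj_eadj; have := set21 a b; rewrite -nE inE.
    have ub : eadj G M u b by apply: gadj_eadj; have := set22 a b; rewrite -nE inE.
    have := eadj_nbrs un uv; rewrite nE !inE => /orP[]/eqP->; first by exists b.
    by exists a; rewrite eq_sym setUC.
  have un3 : uniq [:: u; v; w] by rewrite /= !inE negb_or (eadj_neq uv) (eadj_neq uw) vw.
  have near k : eadj G M u k -> small (fun h => onH E (shift (P u) (vec (P u) (P k)) h)).
    move=> uk; apply: smallW (small_lt ltr01) => h h0 h1'; apply: on uk _.
    by exists h; rewrite // !ltW.
  apply: (three_samples (d1 := vec (P u) (P v)) (d2 := vec (P u) (P w)) h1 uV inL).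
  - exact: (orientP gp un3).
  - move=> s /par[j /(eadj_nbrs un)]; rewrite nE' !inE => /orP[]/eqP-> c; [by left|by right].
  - exact: near.
  - exact: near.
  apply: smallW sv => h _; congr onH; apply: pt_eq; rewrite /=; ring.
have := card_unmatched; have := handshake reg; rewrite cardA in cC.
pose T := [set K in C | #|K| == 3%N].
have c1 : (#|{: {u | unmatched M u} * 'I_3}| <= 2 * #|C| + #|T|)%N.
  rewrite -cardsT (card_partition pC) (_ : #|T| = \sum_(K in C) (#|K| == 3%N))%N; last first.
    by rewrite -sum1dep_card big_mkcondr; apply: eq_bigr => K _; case: eqP.
  rewrite mulnC -sum_nat_const -big_split /=; apply: leq_sum => K KC.
  by have := szC K 2%N reg KC; case: eqP => /=; lia.
(* Double counting: an unmatched vertex belongs to at most one cell of size three. *)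
have c2 : (3 * #|T| <= #|[set u | unmatched M u]|)%N.
  have -> : (3 * #|T| = \sum_(K in T) \sum_(u in [set u | unmatched M u])
      (u \in [set val i.1 | i in K]))%N.
    rewrite mulnC -sum_nat_const; apply: eq_bigr => K.
    rewrite inE => /andP[KC /eqP K3].
    transitivity #|[set val i.1 | i in K]|; first by rewrite (card_in_imset (inj K KC)).
    rewrite -sum1_card big_mkcond [RHS]big_mkcond /=; apply: eq_bigr => u _.
    case: (boolP (u \in [set val i.1 | i in K])) => [/imsetP[i iK ->]|_]; last by case: ifP.
    by rewrite inE (valP i.1).
  rewrite exchange_big /= -sum1_card; apply: leq_sum => u _; apply: sum_bool_le1 => K K'.
  by rewrite !inE => /andP[KC /eqP K3] /andP[KC' /eqP K3']; apply: tri.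
by move: c1; rewrite card_prod card_ord card_sub_unmatched; move: c2 cC; lia.
Qed.

End Counting.

(** * Tight examples *)

Section Configurations.
Variable R : realFieldType.
Notation pt := (R * R)%type.

Definition crossing (u v a b : pt) : bool :=
  (orient u v a * orient u v b < 0) && (orient a b u * orient a b v < 0).
(** For four points in general position, the segments [a b] and [c e] are disjoint exactly when one
    of them stays on one side of the line of the other. Strict inequalities make the condition
    stable. *)
Definition apart (a b c e : pt) : bool :=
  (0 < orient a b c * orient a b e) || (0 < orient c e a * orient c e b).

(** The part of an example that does not depend on the drawing: [g] becomes the graph and [m] the
    matching, with [k] edges. *)
Record pattern (d k : nat) (T : finType) (g m : rel T) : Prop := Pattern {
  pat_gsym : symmetric g; pat_girr : irreflexive g;
  pat_msym : symmetric m; pat_mirr : irreflexive m;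
  pat_mone : forall x y z, m x y -> m x z -> y = z;
  pat_disj : forall x y, g x y -> ~~ m x y;
  pat_deg : forall x, #|[set y | g x y]| = d;
  pat_matched : #|[set x | [exists y, m x y]]| = (2 * k)%N }.

Definition free_vertex (T : finType) (m : rel T) x : bool := ~~ [exists y, m x y].

(** Noncrossing and maximality of the matching as strict inequalities. Collinear or even coinciding
    points are permitted and are resolved by the perturbation at the end. *)
Record placed (T : finType) (g m : rel T) (p : T -> pt) : Prop := Placed {
  placed_apart : forall a b c e, g a b || m a b -> g c e || m c e ->
    uniq [:: a; b; c; e] -> apart (p a) (p b) (p c) (p e);
  placed_block : forall u v, u != v -> free_vertex m u -> free_vertex m v ->
    g u v \/ exists a b, g a b || m a b /\ crossing (p u) (p v) (p a) (p b) }.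

(* The origin stands for an arbitrary configuration drawn in a small neighbourhood of it. *)
Record ring_gadget (T : finType) (g m : rel T) (p : T -> pt) : Prop := RingGadget {
  ring_placed : placed g m p;
  ring_avoid : forall a b, g a b || m a b -> orient (p a) (p b) (0, 0) != 0;
  ring_shield : forall u, free_vertex m u ->
    exists a b, g a b || m a b /\ crossing (p u) (0, 0) (p a) (p b) }.

Definition generic (T : finType) (p : T -> pt) : Prop :=
  forall i j k, uniq [:: i; j; k] -> orient (p i) (p j) (p k) != 0.

(** Asymmetric on purpose: where [x] vanishes, [y] is unconstrained, so that a perturbation may
    resolve degeneracies. *)
Definition same_sign (x y : R) : Prop := x != 0 -> 0 < x * y.

Lemma same_sign_lt0 (x x' y y' : R) : same_sign x x' -> same_sign y y' ->
  x * y < 0 -> x' * y' < 0.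
Proof.
move=> hx hy xy; have x0 : x != 0 by apply: contraTneq xy => ->; rewrite mul0r ltxx.
have y0 : y != 0 by apply: contraTneq xy => ->; rewrite mulr0 ltxx.
have := mulr_gt0 (hx x0) (hy y0); rewrite mulrACA nmulr_rgt0 //.
Qed.

Lemma same_sign_gt0 (x x' y y' : R) : same_sign x x' -> same_sign y y' ->
  0 < x * y -> 0 < x' * y'.
Proof.
move=> hx hy xy; have x0 : x != 0 by apply: contraTneq xy => ->; rewrite mul0r ltxx.
have y0 : y != 0 by apply: contraTneq xy => ->; rewrite mulr0 ltxx.
have := mulr_gt0 (hx x0) (hy y0); rewrite mulrACA pmulr_rgt0 //.
Qed.

Lemma same_sign_small (a b c : R) :
  small (fun e => same_sign a (a + e * b + e * e * c)).
Proof.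
have [->|a0] := eqVneq a 0; first by apply: smallT => e _; rewrite /same_sign eqxx.
have a2 : 0 < a * a by rewrite -expr2 exprn_even_gt0.
apply: smallW (small_quad (a * b) (a * c) a2) => e _ h _.
by move: h; congr (0 < _); ring.
Qed.

Lemma placed_same_sign (T : finType) (g m : rel T) (p p' : T -> pt) :
  (forall i j k, same_sign (orient (p i) (p j) (p k)) (orient (p' i) (p' j) (p' k))) ->
  placed g m p -> placed g m p'.
Proof.
move=> ss [ap bl]; split.
  move=> a b c e ab ce un; have /orP[h|h] := ap a b c e ab ce un; apply/orP; [left|right].
    exact: same_sign_gt0 h.
  exact: same_sign_gt0 h.
move=> u v uv fu fv; have [|[a [b [ab /andP[h1 h2]]]]] := bl u v uv fu fv; first by left.
right; exists a, b; split=> //; apply/andP; split.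
  exact: same_sign_lt0 h1.
exact: same_sign_lt0 h2.
Qed.

(* Moving the points along a parabola by a small amount makes every orientation nonzero, since
   the coefficient of [e * e] is then a Vandermonde determinant. *)
Lemma generic_perturbation (T : finType) (p : T -> pt) : exists p' : T -> pt, generic p' /\
  forall i j k, same_sign (orient (p i) (p j) (p k)) (orient (p' i) (p' j) (p' k)).
Proof.
pose r (i : T) : R := (enum_rank i)%:R.
pose q (e : R) i : pt := ((p i).1 + e * r i, (p i).2 + e * (r i * r i)).
pose B i j k := ((p j).1 - (p i).1) * (r k * r k - r i * r i) + (r j - r i) * ((p k).2 - (p i).2)
  - ((p j).2 - (p i).2) * (r k - r i) - (r j * r j - r i * r i) * ((p k).1 - (p i).1).
pose C i j k := (r j - r i) * (r k - r i) * (r k - r j).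
have E e i j k : orient (q e i) (q e j) (q e k) =
    orient (p i) (p j) (p k) + e * B i j k + e * e * C i j k.
  by rewrite /orient /cross /B /C /=; ring.
have Cn i j k : uniq [:: i; j; k] -> C i j k != 0.
  rewrite /= !inE negb_or andbT => /andP[/andP[ij ik] jk].
  have rn x y : x != y -> r y - r x != 0.
    by rewrite subr_eq0 eqr_nat eq_sym => xy; rewrite (inj_eq (@ord_inj _)) (inj_eq enum_rank_inj).
  by rewrite /C !mulf_neq0 ?rn.
(* The orientation is a polynomial in [e], and its first nonzero coefficient decides for small
   [e]. *)
have nz i j k : uniq [:: i; j; k] -> small (fun e => orient (q e i) (q e j) (q e k) != 0).
  move=> un; have [a0|a0] := eqVneq (orient (p i) (p j) (p k)) 0; last first.
    apply: smallW (same_sign_small (orient (p i) (p j) (p k)) (B i j k) (C i j k)) => e _ /(_ a0).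
    by rewrite E; apply: contraTneq => ->; rewrite mulr0 ltxx.
  have [b0|b0] := eqVneq (B i j k) 0.
    apply: smallT => e e0; have en : e != 0 by rewrite gt_eqF.
    rewrite E a0 b0 mulr0 !add0r; apply: mulf_neq0; first exact: mulf_neq0.
    exact: Cn.
  apply: smallW (same_sign_small (B i j k) (C i j k) 0) => e e0 /(_ b0) h.
  rewrite E a0 add0r (_ : _ + _ = e * (B i j k + e * C i j k + e * e * 0)); last by ring.
  have en : e != 0 by rewrite gt_eqF.
  by rewrite mulf_neq0 //; apply: contraTneq h => ->; rewrite mulr0 ltxx.
have nz' i j k : small (fun e => uniq [:: i; j; k] -> orient (q e i) (q e j) (q e k) != 0).
  have [un|un] := boolP (uniq [:: i; j; k]); last by apply: smallT.
  by apply: smallW (nz i j k un).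
have [e _ he] := small_ex (small_allT (fun i => small_allT (fun j => small_allT (fun k =>
  smallI (same_sign_small (orient (p i) (p j) (p k)) (B i j k) (C i j k)) (nz' i j k))))).
exists (q e); split=> [i j k un|i j k]; first by have [_] := he i j k; apply.
by rewrite E; have [] := he i j k.
Qed.

Definition sum_rel (S T : finType) (r : rel S) (s : rel T) : rel (S + T) :=
  fun x y => match x, y with
  | inl a, inl b => r a b | inr a, inr b => s a b | _, _ => false end.

Lemma card_sum_set (S T : finType) (A : pred (S + T)) :
  #|[set x | A x]| = (#|[set a | A (inl a)]| + #|[set b | A (inr b)]|)%N.
Proof. by rewrite -!sum1dep_card big_mkcond big_sumType /= -!big_mkcond. Qed.

Lemma pattern_sum d k k' (S T : finType) (g m : rel S) (g' m' : rel T) :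
  pattern d k g m -> pattern d k' g' m' ->
  pattern d (k + k') (sum_rel g g') (sum_rel m m').
Proof.
move=> [a1 a2 a3 a4 a5 a6 a7 a8] [b1 b2 b3 b4 b5 b6 b7 b8]; split.
- by move=> [x|x] [y|y] //=.
- by move=> [x|x] /=.
- by move=> [x|x] [y|y] //=.
- by move=> [x|x] /=.
- by move=> [x|x] [y|y] [z|z] //= h1 h2; congr (_ _); [apply: a5 h1 h2|apply: b5 h1 h2].
- by move=> [x|x] [y|y] //=; [apply: a6|apply: b6].
- move=> [x|x]; rewrite card_sum_set /=.
    by rewrite a7 (_ : [set _ | false] = set0) ?cards0 ?addn0 //; apply/setP => y; rewrite !inE.
  by rewrite b7 (_ : [set _ | false] = set0) ?cards0 //; apply/setP => y; rewrite !inE.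
rewrite card_sum_set mulnDr -a8 -b8; congr (_ + _)%N; apply: eq_card => x; rewrite !inE.
  apply/existsP/existsP => [[[y|y]//= h]|[y h]]; first by exists y.
  by exists (inl y).
apply/existsP/existsP => [[[y|y]//= h]|[y h]]; first by exists y.
by exists (inr y).
Qed.

(** An outer and an inner edge are kept apart by the line of the outer one, and an outer vertex is
    hidden from an inner one by an outer edge. So triples with one outer and two inner points, which
    degenerate as the copy shrinks, are never consulted; triples of inner points are merely
    rescaled. *)
Lemma placed_sum (S T : finType) (g m : rel S) (g' m' : rel T) (q : S -> pt) (p : T -> pt) :
  ring_gadget g m q -> placed g' m' p ->
  exists p' : S + T -> pt, placed (sum_rel g g') (sum_rel m m') p'.
Proof.
move=> [[ap bl] av sh] [ap' bl'].
pose P e (x : S + T) : pt := match x with inl a => q a | inr b => (e * (p b).1, e * (p b).2) end.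
have E1 e a b x : orient (q a) (q b) (P e (inr x)) = orient (q a) (q b) (0, 0) +
    e * cross (vec (q a) (q b)) (p x) + e * e * 0.
  by rewrite /orient /cross /=; ring.
have E2 e u a x : orient (q u) (P e (inr x)) (q a) = orient (q u) (0, 0) (q a) +
    e * cross (p x) (vec (q u) (q a)) + e * e * 0.
  by rewrite /orient /cross /=; ring.
have E3 e x y z : orient (P e (inr x)) (P e (inr y)) (P e (inr z)) =
    e * e * orient (p x) (p y) (p z).
  by rewrite /orient /cross /=; ring.
have [e e0 he] := small_ex (small_allT (fun a => small_allT (fun b => small_allT (fun x =>
  smallI (same_sign_small (orient (q a) (q b) (0, 0)) (cross (vec (q a) (q b)) (p x)) 0)
   (same_sign_small (orient (q a) (0, 0) (q b)) (cross (p x) (vec (q a) (q b))) 0))))).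
have S1 a b x : same_sign (orient (q a) (q b) (0, 0)) (orient (q a) (q b) (P e (inr x))).
  by rewrite E1; have [] := he a b x.
have S2 a b x : same_sign (orient (q a) (0, 0) (q b)) (orient (q a) (P e (inr x)) (q b)).
  by rewrite E2; have [] := he a b x.
have S3 x y z : same_sign (orient (p x) (p y) (p z))
    (orient (P e (inr x)) (P e (inr y)) (P e (inr z))).
  rewrite E3 => n0; rewrite mulrCA; apply: mulr_gt0; first exact: mulr_gt0.
  by rewrite -expr2 exprn_even_gt0.
have S0 (x : R) : same_sign x x by move=> x0; rewrite -expr2 exprn_even_gt0.
have avoid a b x y : g a b || m a b ->
    0 < orient (q a) (q b) (P e (inr x)) * orient (q a) (q b) (P e (inr y)).
  move=> ab; have n0 := av a b ab.
  by apply: same_sign_gt0 (S1 a b x) (S1 a b y) _; rewrite -expr2 exprn_even_gt0.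
have free_l x : free_vertex (sum_rel m m') (inl x) -> free_vertex m x.
  by apply: contra => /existsP[y h]; apply/existsP; exists (inl y).
have free_r x : free_vertex (sum_rel m m') (inr x) -> free_vertex m' x.
  by apply: contra => /existsP[y h]; apply/existsP; exists (inr y).
have shield u x : free_vertex m u -> exists a b,
    sum_rel g g' a b || sum_rel m m' a b /\ crossing (q u) (P e (inr x)) (P e a) (P e b).
  move=> /sh[a [b [ab /andP[h1 h2]]]]; exists (inl a), (inl b); split=> //.
  apply/andP; split; first exact: same_sign_lt0 h1.
  exact: same_sign_lt0 h2.
have linj : injective (inl : S -> S + T) by move=> ? ? [].
have rinj : injective (inr : T -> S + T) by move=> ? ? [].
exists (P e); split.
  move=> [a|a] [b|b] // [c|c] [f|f] // ab cf un.
  - apply: ap => //; rewrite -(map_inj_uniq linj).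
  - by rewrite /apart avoid.
  - by rewrite /apart avoid // orbT.
  have un' : uniq [:: a; b; c; f].
    by rewrite -(map_inj_uniq rinj).
  have /orP[h|h] := ap' a b c f ab cf un'; apply/orP; [left|right].
    exact: same_sign_gt0 h.
  exact: same_sign_gt0 h.
move=> [u|u] [v|v] uv fu fv.
- have uv' : u != v by apply: contra uv => /eqP->.
  have [|[a [b [ab h]]]] := bl u v uv' (free_l _ fu) (free_l _ fv); first by left.
  by right; exists (inl a), (inl b).
- by right; apply: shield; apply: free_l.
- right; have [a [b [ab /andP[h1 h2]]]] := shield v u (free_l _ fv).
  exists a, b; split=> //; apply/andP; split; last by rewrite mulrC.
  have sw x : orient (P e (inr u)) (P e (inl v)) x = - orient (q v) (P e (inr u)) x.
    by rewrite /orient /cross /=; ring.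
  by rewrite !sw mulrNN.
have uv' : u != v by apply: contra uv => /eqP->.
have [|[a [b [ab /andP[h1 h2]]]]] := bl' u v uv' (free_r _ fu) (free_r _ fv); first by left.
right; exists (inr a), (inr b); split=> //; apply/andP; split.
  exact: same_sign_lt0 h1.
exact: same_sign_lt0 h2.
Qed.

Lemma nested_gadgets d k (S T : finType) (g m : rel S) (g' m' : rel T) (q : S -> pt) (p : T -> pt) N :
  pattern d k g m -> ring_gadget g m q -> pattern d 0 g' m' -> placed g' m' p ->
  exists (U : finType) (h l : rel U) (r : U -> pt),
    [/\ #|U| = (N * #|S| + #|T|)%N, pattern d (N * k) h l & placed h l r].
Proof.
move=> pS rS pT rT; elim: N => [|N [U [h [l [r [cU pU rU]]]]]]; first by exists T, g', m', p.
have [r' pr] := placed_sum rS rU.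
exists (S + U)%type, (sum_rel g h), (sum_rel m l), r'; split=> //.
  by rewrite card_sum cU; lia.
have := pattern_sum pS pU; congr (pattern _ _ _ _); lia.
Qed.

End Configurations.

(** * Checking gadgets by integer computation *)

Section IntegerGadgets.
Variable R : realType.
Notation pt := (R * R)%type.

(** Coordinates are given in the binary integers [Z], in which the checks can be evaluated, and
    carried into the field by this map. *)
Definition zR (z : Z) : R := (int_of_Z z)%:~R.
Definition zpt (p : Z * Z) : pt := (zR p.1, zR p.2).
Definition crossZ (a b c d : Z) : Z := Z.sub (Z.mul a d) (Z.mul b c).
Definition orientZ (p q r : Z * Z) : Z :=
  crossZ (Z.sub q.1 p.1) (Z.sub q.2 p.2) (Z.sub r.1 p.1) (Z.sub r.2 p.2).
Definition negZ z := Z.ltb z Z0.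
Definition posZ z := Z.ltb Z0 z.
Definition crossingZ u v a b : bool :=
  negZ (Z.mul (orientZ u v a) (orientZ u v b)) && negZ (Z.mul (orientZ a b u) (orientZ a b v)).
Definition apartZ a b c e : bool :=
  posZ (Z.mul (orientZ a b c) (orientZ a b e)) || posZ (Z.mul (orientZ c e a) (orientZ c e b)).

Lemma zRM x y : zR (Z.mul x y) = zR x * zR y.
Proof. by rewrite /zR -rmorphM -(rmorphM (int_of_Z : {rmorphism _ -> _})). Qed.

Lemma zRB x y : zR (Z.sub x y) = zR x - zR y.
Proof. by rewrite /zR -rmorphB -(rmorphB (int_of_Z : {rmorphism _ -> _})). Qed.

Lemma zR_neg z : negZ z -> zR z < 0.
Proof. by rewrite /zR ltrz0; case: z => // p _; rewrite /int_of_Z NegzE oppr_lt0. Qed.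

Lemma zR_pos z : posZ z -> 0 < zR z.
Proof. by rewrite /zR ltr0z; case: z => // p _ /=; rewrite ltz_nat; apply/ssrnat.ltP/Pos2Nat.is_pos. Qed.

Lemma zR_orient p q r : orient (zpt p) (zpt q) (zpt r) = zR (orientZ p q r).
Proof. by rewrite /orient /cross /orientZ /crossZ !zRB !zRM !zRB. Qed.

Lemma zR_crossing u v a b : crossingZ u v a b -> crossing (zpt u) (zpt v) (zpt a) (zpt b).
Proof. by move=> /andP[h1 h2]; rewrite /crossing !zR_orient -!zRM !zR_neg. Qed.

Lemma zR_apart a b c e : apartZ a b c e -> apart (zpt a) (zpt b) (zpt c) (zpt e).
Proof.
by move=> /orP[] /zR_pos h; rewrite /apart !zR_orient -!zRM h ?orbT.
Qed.

(** Every edge is listed in both directions, which makes membership a symmetric relation. *)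
Definition darts (es : seq (nat * nat)) : seq (nat * nat) := es ++ [seq (e.2, e.1) | e <- es].

Lemma dartsC es i j : ((i, j) \in darts es) = ((j, i) \in darts es).
Proof.
have h a b : (a, b) \in darts es -> (b, a) \in darts es.
  rewrite !mem_cat => /orP[ab|/mapP[[c e] ce [-> ->]]]; last by rewrite ce.
  by apply/orP; right; apply/mapP; exists (a, b).
by apply/idP/idP; apply: h.
Qed.

Section Check.
Variables (d k N : nat) (pts : seq (Z * Z)) (ge me : seq (nat * nat)).

Let p i : Z * Z := nth (Z0, Z0) pts i.
Let free i : bool := ~~ has (fun e => e.1 == i) (darts me).

(** Boolean counterpart of the fields of [pattern] and [ring_gadget]; the symmetry of both relations
    comes from [darts]. *)
Definition gadget_check : bool :=
  [&& all (fun e => [&& e.1 < N, e.2 < N & e.1 != e.2]%N) (darts ge ++ darts me),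
      all (fun e => e \notin darts me) (darts ge),
      all (fun e => all (fun f => (e.1 == f.1) ==> (e.2 == f.2)) (darts me)) (darts me),
      all (fun i => count (fun j => (i, j) \in darts ge) (iota 0 N) == d) (iota 0 N),
      count (fun i => ~~ free i) (iota 0 N) == (2 * k)%N,
      all (fun e => all (fun f => uniq [:: e.1; e.2; f.1; f.2] ==>
        apartZ (p e.1) (p e.2) (p f.1) (p f.2)) (darts ge ++ darts me)) (darts ge ++ darts me),
      all (fun u => all (fun v => [&& u != v, free u & free v] ==>
        ((u, v) \in darts ge) ||
        has (fun e => crossingZ (p u) (p v) (p e.1) (p e.2)) (darts ge ++ darts me))
        (iota 0 N)) (iota 0 N),
      all (fun e => orientZ (p e.1) (p e.2) (Z0, Z0) != Z0) (darts ge ++ darts me) &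
      all (fun u => free u ==>
        has (fun e => crossingZ (p u) (Z0, Z0) (p e.1) (p e.2)) (darts ge ++ darts me))
        (iota 0 N)].

Definition gadget_rel (es : seq (nat * nat)) : rel 'I_N := fun i j => (val i, val j) \in darts es.

Lemma card_ord_count (P : pred nat) : #|[set i : 'I_N | P i]| = count P (iota 0 N).
Proof.
by rewrite -sum1dep_card -sum1_count -val_enum_ord big_map big_enum_cond.
Qed.

Lemma gadget_checkP : gadget_check ->
  pattern d k (gadget_rel ge) (gadget_rel me) /\
  ring_gadget (gadget_rel ge) (gadget_rel me) (fun i : 'I_N => zpt (p i)).
Proof.
move=> /and5P[/allP ends /allP disj /allP mone /allP deg /and5P[/eqP mat /allP ap /allP bl /allP av /allP sh]].
have D i j : gadget_rel ge i j || gadget_rel me i j -> (val i, val j) \in darts ge ++ darts me.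
  by rewrite mem_cat.
have V (i : 'I_N) : val i \in iota 0 N by rewrite mem_iota /= ltn_ord.
have ex e : e \in darts ge ++ darts me -> exists i j : 'I_N,
    [/\ val i = e.1, val j = e.2 & gadget_rel ge i j || gadget_rel me i j].
  move=> eD; have /and3P[h1 h2 _] := ends e eD; exists (Ordinal h1), (Ordinal h2); split=> //.
  by rewrite /gadget_rel /= -mem_cat -surjective_pairing.
have fr (i : 'I_N) : free_vertex (gadget_rel me) i = free i.
  rewrite /free_vertex /free; congr (~~ _); apply/existsP/hasP => [[j ij]|[e eM /eqP ei]].
    by exists (val i, val j) => /=.
  have eD : e \in darts ge ++ darts me by rewrite mem_cat eM orbT.
  have /and3P[_ h2 _] := ends e eD; exists (Ordinal h2).
  by rewrite /gadget_rel /= -ei -surjective_pairing.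
split; first split.
- by move=> i j; apply: dartsC.
- move=> i; apply/negP => /(fun h => D i i (introT orP (or_introl h))) /ends /and3P[_ _].
  by rewrite eqxx.
- by move=> i j; apply: dartsC.
- move=> i; apply/negP => /(fun h => D i i (introT orP (or_intror h))) /ends /and3P[_ _].
  by rewrite eqxx.
- move=> i j l ij il; apply: val_inj; apply/eqP.
  by have := allP (mone _ ij) _ il; rewrite /= eqxx.
- by move=> i j ij; have := disj _ ij.
- by move=> i; rewrite (card_ord_count (fun j => (val i, j) \in darts ge)); apply/eqP/deg.
- rewrite -mat -card_ord_count; apply: eq_card => i; rewrite !inE.
  by have := fr i; rewrite /free_vertex => /negb_inj->; rewrite negbK.
split; first split.
- move=> a b c e /D ab /D ce un; apply: zR_apart.
  have := allP (ap _ ab) _ ce => /implyP; apply.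
  by rewrite -(map_inj_uniq val_inj) in un.
- move=> u v uv; rewrite !fr => fu fv.
  have := allP (bl _ (V u)) _ (V v) => /implyP; rewrite fu fv !andbT => /(_ uv) /orP[|/hasP[e eD h]].
    by left.
  right; have [i [j [ie je ij]]] := ex e eD; exists i, j; split=> //.
  by rewrite ie je; apply: zR_crossing.
- move=> a b /D ab; have := av _ ab; have -> : (0, 0) = zpt (Z0, Z0) by rewrite /zpt /zR.
  rewrite zR_orient /= => /eqP n0; apply/eqP => h; apply: n0; move/eqP: h.
  rewrite /zR intr_eq0 => /eqP h; rewrite -[LHS]int_of_ZK h. done.
move=> u; rewrite fr => fu; have := sh _ (V u); rewrite fu /= => /hasP[e eD h].
have [i [j [ie je ij]]] := ex e eD; exists i, j; split=> //.
have -> : (0, 0) = zpt (Z0, Z0) by rewrite /zpt /zR.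
by rewrite ie je; apply: zR_crossing.
Qed.

End Check.
End IntegerGadgets.

Definition zpair (p : int * int) : Z * Z := (Z_of_int p.1, Z_of_int p.2).

(** The matching edge joins points 0 and 1 and hides the free point 2 from the origin. *)
Definition segment_points : seq (Z * Z) := map zpair [:: (1, -1); (1, 1); (2, 0)].

(** The sides of a square around the origin belong alternately to the graph and to the matching.
    Just beyond each side lies an unmatched edge, so close that it does not see around the
    corners. *)
Definition square_points : seq (Z * Z) := map zpair
  [:: (10, 10); (-10, 10); (-10, -10); (10, -10); (3, 11); (-3, 11);
      (-11, 3); (-11, -3); (-3, -11); (3, -11); (11, -3); (11, 3)].

(* Order 3, the rotation by a third of a turn in a hexagonal lattice basis. In the gadget for
   2-regular graphs, point [j + 11 * i] is point [j] rotated [i] times. Points 0 and 1 span an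
   outer triangle and a twisted inner one, joined by the matching edges. The other points form
   unmatched triangles: one beyond each outer side, and two near the opposite tips of each of the
   three nonconvex quadrilaterals. *)
Definition rot3 (p : int * int) : int * int := (- p.2, p.1 - p.2).
Definition third_points : seq (int * int) :=
  [:: (-44, 12); (6, 12); (-5, 26); (18, 34); (7, 32);
      (-28, 13); (-23, 13); (-25, 15); (7, -1); (9, -1); (9, 2)].
Definition prism_points : seq (Z * Z) := map zpair
  (third_points ++ map rot3 third_points ++ map (rot3 \o rot3) third_points).
Definition rotated_edges (es : seq (nat * nat)) : seq (nat * nat) :=
  [seq ((e.1 + 11 * i) %% 33, (e.2 + 11 * i) %% 33)%N | i <- iota 0 3, e <- es].
Definition prism_edges : seq (nat * nat) := rotated_edges
  [:: (0, 11); (1, 12); (2, 3); (3, 4); (2, 4); (5, 6); (6, 7); (5, 7); (8, 9); (9, 10); (8, 10)].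

Lemma segment_check : gadget_check 0 1 3 segment_points [::] [:: (0, 1)%N].
Proof. by vm_compute. Qed.

Lemma square_check : gadget_check 1 2 12 square_points
  [:: (0, 1); (2, 3); (4, 5); (6, 7); (8, 9); (10, 11)]%N [:: (1, 2); (3, 0)]%N.
Proof. by vm_compute. Qed.

Lemma prism_check : gadget_check 2 3 33 prism_points prism_edges (rotated_edges [:: (0, 1)%N]).
Proof. by vm_compute. Qed.

(** * From drawings to geometric graphs *)

Section Realization.
Variable R : realType.
Notation pt := (R * R)%type.

Lemma pattern_ord d k (T : finType) (g m : rel T) : pattern d k g m ->
  pattern d k (fun i j : 'I_#|T| => g (enum_val i) (enum_val j))
    (fun i j : 'I_#|T| => m (enum_val i) (enum_val j)).
Proof.
have card (A : pred T) : #|[set i : 'I_#|T| | A (enum_val i)]| = #|[set x | A x]|.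
  rewrite -!sum1dep_card [RHS](reindex (@enum_val T T)) //.
  by apply: onW_bij; apply: enum_val_bij.
move=> [a1 a2 a3 a4 a5 a6 a7 a8]; split.
- by move=> x y; apply: a1.
- by move=> x; apply: a2.
- by move=> x y; apply: a3.
- by move=> x; apply: a4.
- by move=> x y z h1 h2; apply: enum_val_inj; apply: a5 h1 h2.
- by move=> x y; apply: a6.
- by move=> x; rewrite (card (fun y => g (enum_val x) y)).
rewrite -a8 -(card (fun x => [exists y, m x y])); apply: eq_card => x; rewrite !inE.
apply/existsP/existsP => [[y h]|[y h]]; first by exists (enum_val y).
by exists (enum_rank y); rewrite enum_rankK.
Qed.

Lemma placed_ord (T : finType) (g m : rel T) (p : T -> pt) : placed g m p ->
  placed (fun i j : 'I_#|T| => g (enum_val i) (enum_val j))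
    (fun i j : 'I_#|T| => m (enum_val i) (enum_val j)) (fun i => p (enum_val i)).
Proof.
move=> [ap bl]; split.
  move=> a b c e ab ce un; apply: ap => //.
  by rewrite -(map_inj_uniq (@enum_val_inj T T)) in un.
have fr (i : 'I_#|T|) : free_vertex (fun i j : 'I_#|T| => m (enum_val i) (enum_val j)) i ->
    free_vertex m (enum_val i).
  by apply: contra => /existsP[y h]; apply/existsP; exists (enum_rank y); rewrite enum_rankK.
move=> u v uv /fr fu /fr fv; have uv' : enum_val u != enum_val v.
  by apply: contra uv => /eqP/enum_val_inj->.
have [|[a [b [ab h]]]] := bl _ _ uv' fu fv; first by left.
by right; exists (enum_rank a), (enum_rank b); rewrite !enum_rankK.
Qed.

Variables (n d k : nat) (g m : rel 'I_n) (p : 'I_n -> pt).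
Hypothesis pat : pattern d k g m.
Hypothesis plc : placed g m p.
Hypothesis gen : generic p.
Hypothesis n3 : (2 < n)%N.

Definition realize (i : 'I_n) : 'rV[R]_2 := \row_j (if j == 0 then (p i).1 else (p i).2).

Lemma realizeE i : toP (realize i) = p i.
Proof. by apply: pt_eq; rewrite /= !mxE. Qed.

(** Two coinciding points would be collinear with any third one, which [n3] provides. *)
Lemma realize_inj : injective realize.
Proof.
move=> i j ij; apply/eqP; apply: contrapT => /negP nij.
have pij : p i = p j by rewrite -!realizeE ij.
have [l /andP[li lj]] : exists l, (l != i) && (l != j).
  apply/existsP; apply: contraTT n3 => /existsPn h; rewrite -leqNgt -(card_ord n).
  have c2 : (#|[set i; j]| <= 2)%N by rewrite cards2 nij.
  apply: leq_trans c2; rewrite -cardsT; apply: subset_leq_card.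
  by apply/subsetP => x _; rewrite !inE; have := h x; rewrite negb_and !negbK.
have := gen (i := i) (j := j) (k := l); rewrite /= !inE negb_or nij ![_ == l]eq_sym li lj.
by move=> /(_ isT); rewrite pij /orient /cross /= !subrr !mul0r subrr eqxx.
Qed.

Definition rel_edges (r : rel 'I_n) : {set edge n} :=
  [set e | [exists i, [exists j, (val e == [set i; j]) && r i j]]].

Lemma rel_edgesP (r : rel 'I_n) e i j : symmetric r -> val e = [set i; j] ->
  (e \in rel_edges r) = r i j.
Proof.
move=> sr eE; rewrite inE; apply/existsP/idP => [[a /existsP[b /andP[/eqP h ab]]]|ij].
  by move: h; rewrite eE => /set2_eq[] [-> ->] //; rewrite sr.
by exists i; apply/existsP; exists j; rewrite eE eqxx.
Qed.

Definition realization : geometric_graph R n := GeometricGraph realize_inj (rel_edges g).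
Notation G := realization.
Notation P := (vpos G).

Lemma realizationP i : P i = p i.
Proof. exact: realizeE. Qed.

Lemma realization_gp : general_position G.
Proof.
move=> i j l un [a [c [_ h]]]; have := gen un; rewrite -!realizationP /vpos.
have [s ->] := h (pos G i) (mem_head _ _).
have [|t ->] := h (pos G j); first by rewrite !inE eqxx orbT.
have [|u ->] := h (pos G l); first by rewrite !inE eqxx !orbT.
rewrite /orient /cross /toP /= !mxE => /eqP; apply; ring.
Qed.

Lemma crossing_meet u v a b : crossing (P u) (P v) (P a) (P b) ->
  exists2 z, seg (P u) (P v) z & seg (P a) (P b) z.
Proof.
move=> /andP[h1 h2].
have [s [t [s01 t01 e]]] := seg_meet h2 (ltW h1).
by exists (lerp (P u) (P v) s); [|rewrite e]; apply: seg_lerp => //; case/andP: s01 => *; rewrite !ltW.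
Qed.

(** A proper crossing puts the ends of each edge on opposite sides of the other, against [apart].
    The edge set is arbitrary so as to cover both the graph and its union with the matching. *)
Lemma realization_meet (B : {set edge n}) : (forall e, e \in B -> exists i j, val e = [set i; j] /\
    (g i j || m i j)) -> noncrossing (GeometricGraph realize_inj B).
Proof.
move=> hB; split; first by move=> e w _; apply: (relint_vertex realization_gp).
move=> e f eB fB ef x xe xf; have [u [v [eE uv]]] := hB e eB; have [a [b [fE ab]]] := hB f fB.
have un := edge_neq eE; have an := edge_neq fE.
have ne : [set u; v] != [set a; b].
  by apply: contra ef => /eqP h; apply/eqP/val_inj; rewrite /= eE fE.
have := seg_meet_cases realization_gp un an ne (proj1 (on_segmentP G x eE) xe)
  (proj1 (on_segmentP G x fE) xf).
case=> [[w [w1 w2 /toP_inj xw]]|[[n1 n2 n4 n5] [s [t [s01 t01 z1 z2]]]]].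
  by exists w; rewrite eE fE.
have u4 : uniq [:: u; v; a; b].
  by rewrite /= !inE !negb_or un an ![_ == a]eq_sym ![_ == b]eq_sym n1 n2 n4 n5.
have := placed_apart plc uv ab u4; rewrite -!realizationP.
have o3 i j l : uniq [:: i; j; l] -> orient (P i) (P j) (P l) != 0.
  by move=> /(orientP realization_gp).
have opp i j c c' (y y' : R) : orient (P i) (P j) (P c) != 0 -> 0 < y' < 1 ->
    lerp (P i) (P j) y = lerp (P c) (P c') y' ->
    orient (P i) (P j) (P c) * orient (P i) (P j) (P c') < 0.
  move=> n0 y01 e0; apply: opposite_signs n0 y01 _.
  have := orient_lerp (P i) (P j) y; rewrite e0 -aff_orientl aff_lerp !aff_orientl; exact.
have e0 : lerp (P u) (P v) s = lerp (P a) (P b) t by rewrite -z1 -z2.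
have ua : uniq [:: u; v; a] by rewrite /= !inE negb_or un ![_ == a]eq_sym n1 n2.
have au : uniq [:: a; b; u] by rewrite /= !inE negb_or an n1 n4.
have h1 := opp u v a b s t (o3 _ _ _ ua) t01 e0.
have h2 := opp a b u v t s (o3 _ _ _ au) s01 (esym e0).
by rewrite /apart !ltNge !ltW.
Qed.

Lemma realization_noncrossing : noncrossing G.
Proof.
apply: realization_meet => e; rewrite inE => /existsP[i /existsP[j /andP[/eqP eE gij]]].
by exists i, j; rewrite gij.
Qed.

Lemma realization_regular : regular G d.
Proof.
move=> u; rewrite -card_nbrs -(pat_deg pat u); apply: eq_card => v; rewrite !inE.
apply/gadjP/idP => [[e eG eE]|uv].
  by rewrite -(rel_edgesP (pat_gsym pat) eE).
have [e eE] : exists e : edge n, val e = [set u; v].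
  by apply: edge_of; apply: contraTneq uv => ->; rewrite (pat_girr pat).
by exists e; rewrite // (rel_edgesP (pat_gsym pat) eE).
Qed.

Notation M := (rel_edges m).

Lemma rel_edge (r : rel 'I_n) u v : irreflexive r -> symmetric r -> r u v ->
  exists2 e, e \in rel_edges r & val e = [set u; v].
Proof.
move=> ir sr uv; have [e eE] : exists e : edge n, val e = [set u; v].
  by apply: edge_of; apply: contraTneq uv => ->; rewrite ir.
by exists e; rewrite // (rel_edgesP sr eE).
Qed.

Lemma realization_maximal : maximal_compatible_matching G M.
Proof.
split.
  split.
  - move=> e f; rewrite !inE => /existsP[i /existsP[j /andP[/eqP eE ij]]].
    move=> /existsP[a /existsP[b /andP[/eqP fE ab]]] ef.
    rewrite eE fE disjoints_subset; apply/subsetP => x xe; rewrite !inE; apply/negP => xf.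
    case/eqP: ef; apply: val_inj; rewrite /= eE fE.
    have [y xy ->] : exists2 y, m x y & [set i; j] = [set x; y].
      move: xe; rewrite !inE => /orP[]/eqP->; first by exists j.
      by exists i; rewrite 1?setUC // (pat_msym pat).
    have [z xz ->] : exists2 y, m x y & [set a; b] = [set x; y].
      move: xf => /orP[]/eqP->; first by exists b.
      by exists a; rewrite 1?setUC // (pat_msym pat).
    by rewrite (pat_mone pat xy xz).
  - rewrite disjoints_subset; apply/subsetP => e; rewrite !inE.
    move=> /existsP[i /existsP[j /andP[/eqP eE ij]]]; apply/negP => eG.
    have : e \in rel_edges g by rewrite inE.
    rewrite (rel_edgesP (pat_gsym pat) eE) => gij.
    by have := pat_disj pat gij; rewrite ij.
  apply: realization_meet => e; rewrite inE => /orP[]; rewrite inE;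
    by move=> /existsP[i /existsP[j /andP[/eqP eE ij]]]; exists i, j; rewrite ij ?orbT.
(* An additional edge has both ends free, so by [placed_block] it is an edge of the graph already or
   crosses one of the graph or the matching. *)
move=> [M' [[mM' dM' [_ ncM']] /properP[MM' [e eM' eM]]]].
have [u [v [uv eE]]] := edge_ends e.
have fr w w' : val e = [set w; w'] -> free_vertex m w.
  move=> eE'; apply/negP => /existsP[y wy].
  have [f fM fE] := rel_edge (pat_mirr pat) (pat_msym pat) wy.
  have ef : e != f by apply: contra eM => /eqP->.
  have := mM' e f eM' (subsetP MM' _ fM) ef; rewrite disjoints_subset => /subsetP/(_ w).
  by rewrite eE' fE !inE eqxx => /(_ isT).
have fu := fr u v eE; have fv : free_vertex m v by apply: (fr v u); rewrite setUC.
have [guv|[a [b [ab cr]]]] := placed_block plc uv fu fv.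
  move: dM'; rewrite disjoints_subset => /subsetP/(_ e eM').
  by rewrite inE (rel_edgesP (pat_gsym pat) eE) guv.
rewrite -!realizationP in cr; have [z zuv zab] := crossing_meet cr.
have [f fA fE] : exists2 f, f \in edges (add_edges G M') & val f = [set a; b].
  case/orP: ab => h.
    have [f fG fE] := rel_edge (pat_girr pat) (pat_gsym pat) h.
    by exists f; rewrite // inE fG.
  have [f fM fE] := rel_edge (pat_mirr pat) (pat_msym pat) h.
  by exists f; rewrite // inE (subsetP MM' _ fM) orbT.
have [x xz] : exists x, toP x = z.
  by exists (\row_j (if j == 0 then z.1 else z.2)); apply: pt_eq; rewrite /= !mxE.
have sep w : w \in [set u; v] -> w \in [set a; b] -> False.
  have oii (q r : pt) : orient q r q = 0 /\ orient q r r = 0.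
    by rewrite /orient /cross /=; split; ring.
  move: cr => /andP[+ _]; rewrite !inE => cr' /orP[]/eqP-> /orP[]/eqP h; move: cr';
    by rewrite h ?(proj1 (oii _ _)) ?(proj2 (oii _ _)) ?mulr0 ?mul0r ltxx.
have ef : e != f by apply/eqP => h; apply: (sep u); rewrite ?set21 // -fE -h eE set21.
have [|||w [we wf _]] := ncM' e f _ fA ef x.
- by rewrite inE eM' orbT.
- by apply/(on_segmentP G x eE); rewrite xz.
- by apply/(on_segmentP G x fE); rewrite xz.
by apply: (sep w); rewrite -?eE -?fE.
Qed.

(** The edges are counted through their ends: [pat_matched] gives the number of covered vertices and
    [card_unmatched] relates the others to the size of the matching. *)
Lemma realization_size : #|M| = k.
Proof.
have := card_unmatched realization_maximal.
have := cardsC [set x | [exists y, m x y]]; rewrite (pat_matched pat) card_ord.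
have -> : #|~: [set x | [exists y, m x y]]| = #|[set u | unmatched M u]|.
  apply: eq_card => u; rewrite !inE; apply/idP/idP.
    move=> nu; apply/forallP => e; apply/implyP; rewrite inE.
    move=> /existsP[i /existsP[j /andP[/eqP eE ij]]]; apply: contra nu => ue; apply/existsP.
    move: ue; rewrite eE !inE => /orP[]/eqP->; first by exists j.
    by exists i; rewrite (pat_msym pat).
  apply: contraL => /existsP[y uy]; have [e eM eE] := rel_edge (pat_mirr pat) (pat_msym pat) uy.
  apply/negP => un; have := unmatchedP un eM; rewrite eE set21; done.
lia.
Qed.

End Realization.

(** * Attaining the bounds *)

Section Tightness.
Variable R : realType.

(** The drawn matching shows [mm G <= k]. The bound applied to a smallest maximal matching gives
    [k <= mm G], because the number of vertices is exactly [c * k + c0]. *)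
Lemma mm_attained (d c c0 k : nat) (T : finType) (g m : rel T) (p : T -> R * R) :
  (forall n (G : geometric_graph R n) M, general_position G ->
     maximal_compatible_matching G M -> regular G d -> (n <= c * #|M| + c0)%N) ->
  (0 < c)%N -> pattern d k g m -> placed g m p -> (2 < #|T|)%N -> #|T| = (c * k + c0)%N ->
  exists G : geometric_graph R #|T|,
    [/\ noncrossing G, general_position G, regular G d & (mm G)%:R = ((#|T|)%:R - c0%:R) / c%:R :> R].
Proof.
move=> bound c_gt0 pat plc T2 cT.
have [p' [gen ss]] := generic_perturbation p.
have pat' := pattern_ord pat; have plc' := placed_ord (placed_same_sign ss plc).
have gen' : generic (fun i : 'I_#|T| => p' (enum_val i)).
  by move=> i j l un; apply: gen; rewrite -(map_inj_uniq (@enum_val_inj T T)) in un.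
pose G := realization (fun i j : 'I_#|T| => g (enum_val i) (enum_val j)) gen' T2.
have gp : general_position G by apply: realization_gp.
have nc : noncrossing G by apply: realization_noncrossing plc' _ _.
have rg : regular G d by apply: realization_regular pat' _ _.
have mx := realization_maximal pat' plc' gen' T2.
have sz := realization_size pat' plc' gen' T2.
exists G; split=> //.
have [[M0 mx0 sM0] /(_ _ mx)] := mmP nc.
rewrite sz => le; have := bound _ G M0 gp mx0 rg; rewrite sM0 {1}cT leq_add2r leq_pmul2l // => ge.
have -> : mm G = k by apply/eqP; rewrite eqn_leq le.
by rewrite cT natrD addrK natrM mulrC mulKf // pnatr_eq0 -lt0n.
Qed.

End Tightness.

Theorem theorem2 (R : realType) :
  (forall (n : nat) (G : geometric_graph R n),
     (1 <= n)%N -> noncrossing G -> general_position G ->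
     [/\ regular G 0 -> (mm G)%:R >= (n%:R - 1) / 3 :> R,
         regular G 1 -> (mm G)%:R >= (n%:R - 2) / 6 :> R
       & regular G 2 -> (mm G)%:R >= (n%:R - 3) / 11 :> R]) /\
  [/\ forall N : nat, exists (n : nat) (G : geometric_graph R n),
        [/\ (N < n)%N, noncrossing G, general_position G, regular G 0
          & (mm G)%:R = (n%:R - 1) / 3 :> R],
      forall N : nat, exists (n : nat) (G : geometric_graph R n),
        [/\ (N < n)%N, noncrossing G, general_position G, regular G 1
          & (mm G)%:R = (n%:R - 2) / 6 :> R]
    & forall N : nat, exists (n : nat) (G : geometric_graph R n),
        [/\ (N < n)%N, noncrossing G, general_position G, regular G 2
          & (mm G)%:R = (n%:R - 3) / 11 :> R]].
Proof.
split.
  move=> n G _ nc gp; have [[M mx sM] _] := mmP nc.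
  have key c c0 : (0 < c)%N -> (n <= c * #|M| + c0)%N -> (n%:R - c0%:R) / c%:R <= (mm G)%:R :> R.
    move=> c_gt0; rewrite sM => le; rewrite ler_pdivrMr ?ltr0n // lerBlDr -natrM -natrD ler_nat mulnC.
    exact: le.
  split=> rg; [apply: (key 3%N 1%N) | apply: (key 6%N 2%N) | apply: (key 11%N 3%N)] => //.
  - exact: (bound_0_regular gp mx rg).
  - exact: (bound_1_regular gp mx rg).
  exact: (bound_2_regular gp mx rg).
(* The innermost configuration is a complete graph on at most three vertices: no segment can be
   added to it, and it has no two edges with four distinct ends. *)
have base_placed (T : finType) (g m : rel T) (p : T -> R * R) :
    (forall x y, x != y -> g x y) -> (forall x y, m x y = false) -> (#|T| <= 3)%N -> placed g m p.
  move=> hg hm cT; split=> [a b c e _ _ un|u v uv _ _]; last by left; apply: hg.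
  by have := max_card (mem [:: a; b; c; e]); rewrite (card_uniqP un) => /leq_trans/(_ cT).
have base_pattern d (T : finType) : #|T| = d.+1 ->
    pattern d 0 (fun x y : T => x != y) (fun _ _ : T => false).
  move=> cT; split=> //; [by move=> x y; rewrite eq_sym|by move=> x /=; rewrite eqxx| |].
  - move=> x; rewrite (_ : [set y | x != y] = ~: [set x]); last first.
      by apply/setP => y; rewrite !inE eq_sym.
    by rewrite cardsC1 cT.
  rewrite (_ : [set x | _] = set0) ?cards0 //; apply/setP => x; rewrite !inE.
  by apply/existsP => -[].
have tight d c c0 k s pts ge me : (d < 3)%N ->
    gadget_check d k s pts ge me -> s = (c * k)%N -> (0 < k)%N -> (0 < c)%N -> c0 = d.+1 ->
    (2 < s)%N ->
    (forall n (G : geometric_graph R n) M, general_position G ->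
     maximal_compatible_matching G M -> regular G d -> (n <= c * #|M| + c0)%N) ->
    forall N, exists n (G : geometric_graph R n), [/\ (N < n)%N, noncrossing G,
      general_position G, regular G d & (mm G)%:R = (n%:R - c0%:R) / c%:R :> R].
  move=> d3 /(gadget_checkP R)[pat ring] sE k0 c_gt0 c0E s2 bound N.
  have bp := base_pattern d 'I_d.+1 (card_ord _).
  (* All base vertices may sit at the origin, since [placed] demands nothing of their positions; the
     perturbation in [mm_attained] separates them. *)
  have bl := base_placed 'I_d.+1 (fun x y => x != y) (fun _ _ => false) (fun _ => (0, 0))
    (fun _ _ h => h) (fun _ _ => erefl) ltac:(by rewrite card_ord).
  have [U [h [l [r [cU pU plU]]]]] := nested_gadgets N.+1 pat ring bp bl.
  have cU' : #|U| = (c * (N.+1 * k) + c0)%N by rewrite cU !card_ord sE c0E; lia.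
  have U2 : (2 < #|U|)%N by rewrite cU !card_ord; lia.
  have [G [nc gp rg mmE]] := mm_attained bound c_gt0 pU plU U2 cU'.
  exists #|U|, G; split=> //; rewrite cU card_ord; nia.
split.
- by apply: (tight 0%N 3%N 1%N) segment_check _ _ _ _ _ _ => // n G M gp mx rg;
    apply: (bound_0_regular gp mx rg).
- by apply: (tight 1%N 6%N 2%N) square_check _ _ _ _ _ _ => // n G M gp mx rg;
    apply: (bound_1_regular gp mx rg).
by apply: (tight 2%N 11%N 3%N) prism_check _ _ _ _ _ _ => // n G M gp mx rg;
    apply: (bound_2_regular gp mx rg).
Qed.
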